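(* Let $n\geq 1$ be an integer and $A$ be a commutative von Neumann algebra. Suppose that $\Psi$ is a ring automorphism of $LS(\mathbb{M}_n(A))$. Then there exist a ring automorphism $\psi\colon LS(A)\to LS(A)$ and an invertible element $y$ in $LS(\mathbb{M}_n(A))$ such that $\Psi(x)=y\psi'(x)y^{-1}$ for all $x\in LS(\mathbb{M}_n(A))$, where $\psi'$ is the ring automorphism of $LS(\mathbb{M}_n(A))$ given by $\psi'((x_{ij})_{ij}) = (\psi(x_{ij}))_{ij}$.
   Context: $\mathbb{M}_n(A)$ is the von Neumann algebra of $n\times n$ matrices with entries in $A$. For a von Neumann algebra $M\subset B(H)$, a densely defined closed operator $x$ on $H$ is affiliated with $M$ if $yx\subset xy$ for every $y$ in the commutant $M'$. An affiliated operator $x$ is measurable with respect to $M$ if the spectral projection $\chi_{(c,\infty)}(|x|)$ is a finite projection of $M$ for some real $c>0$. It is locally measurable with respect to $M$ if there is an increasing sequence $(p_n)_{n\ge 1}$ of central projections of $M$ with $p_n\nearrow 1$ such that $xp_n$ is measurable for every $n$. $LS(M)$ is the set of all locally measurable operators; it is a $^*$-algebra containing $M$, with sum and product given by the closures of the operator sum and product. $LS(\mathbb{M}_n(A))$ is identified with the algebra of $n\times n$ matrices with entries in $LS(A)$. (If $A=L^\infty(\mu)$, then $LS(A)=L^0(\mu)$, the algebra of all complex-valued measurable functions modulo almost-everywhere equality.) A ring automorphism is an additive and multiplicative bijection onto itself (not assumed linear). *)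

(* Defs.v *)
From HB Require Import structures.
From mathcomp Require Import all_boot all_order all_algebra.
From mathcomp Require Import sesquilinear complex.
From mathcomp Require Import all_classical all_reals all_analysis.
Set Implicit Arguments.
Unset Strict Implicit.
Unset Printing Implicit Defensive.
Import Order.TTheory GRing.Theory Num.Theory.
Import numFieldNormedType.Exports.
Local Open Scope classical_set_scope.
Local Open Scope ring_scope.
Local Open Scope complex_scope.


Definition dot_norm (R : realType) (V : lmodType R[i]) (f : V -> V -> R[i])
  (x : V) : R := Num.sqrt (complex.Re (f x x)).

Definition dot_complete (R : realType) (V : lmodType R[i])
    (f : V -> V -> R[i]) : Prop :=
  forall u : nat -> V,
    (forall e : R, 0 < e -> exists N : nat, forall m n : nat,
      (N <= m)%N -> (N <= n)%N -> dot_norm f (u m - u n) < e) ->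
    exists l : V, dot_norm f (u n - l) @[n --> \oo] --> (0 : R).

(* The inner product is linear in its first argument, conjugate-linear in its
   second one.  No separability and no lower bound on the dimension. *)
Record hilbertType (R : realType) := HilbertType {
  hilbert_sort :> lmodType R[i];
  hdot : {dot hilbert_sort for (@Num.conj R[i])};
  hilbert_complete : dot_complete hdot
}.

Arguments hdot {R h}.

Definition hnorm (R : realType) (H : hilbertType R) (x : H) : R :=
  dot_norm hdot x.

Section HilbertPower.
Variables (R : realType) (H : hilbertType R) (n : nat).
Local Notation V := {ffun 'I_n -> H}.

Definition pow_dot (x y : V) : R[i] := \sum_i hdot (x i) (y i).

Fact pow_dot_addl y : zmod_morphism (pow_dot^~ y).
Proof.
move=> u v; rewrite /pow_dot -sumrB; apply: eq_bigr => i _.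
by rewrite !ffunE linearBl.
Qed.

Fact pow_dot_addr x : zmod_morphism (pow_dot x).
Proof.
move=> u v; rewrite /pow_dot -sumrB; apply: eq_bigr => i _.
by rewrite !ffunE linearBr.
Qed.

Fact pow_dot_scalel y : scalable_for *%R (pow_dot^~ y).
Proof.
move=> a u; rewrite /pow_dot mulr_sumr; apply: eq_bigr => i _.
by rewrite !ffunE linearZl_LR.
Qed.

Fact pow_dot_scaler x :
  scalable_for ((@Num.conj R[i]) \; *%R) (pow_dot x).
Proof.
move=> a u; rewrite /= /pow_dot mulr_sumr; apply: eq_bigr => i _.
by rewrite !ffunE linearZr_LR.
Qed.

HB.instance Definition _ := isBilinear.Build R[i] V V R[i] *%R
  ((@Num.conj R[i]) \; *%R) pow_dot pow_dot_addl pow_dot_addr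
  pow_dot_scalel pow_dot_scaler.

Fact pow_dot_herm (x y : V) :
  pow_dot x y = (-1) ^+ false * Num.conj (pow_dot y x).
Proof.
rewrite expr0 mul1r /pow_dot rmorph_sum /=; apply: eq_bigr => i _.
by rewrite hermC expr0 mul1r.
Qed.

HB.instance Definition _ := isHermitianSesquilinear.Build R[i] V false
  (@Num.conj R[i]) pow_dot pow_dot_herm.

Fact hdot_ge0 (x : H) : 0 <= hdot x x.
Proof.
have [->|x0] := eqVneq x 0; first by rewrite linear0l.
by rewrite ltW// neq0_dnorm_gt0.
Qed.

Fact pow_dot_gt0 (x : V) : x != 0 -> 0 < pow_dot x x.
Proof.
move=> x0; rewrite lt_neqAle sumr_ge0 ?andbT; last by move=> i _; exact: hdot_ge0.
apply: contra x0; rewrite eq_sym psumr_eq0; last by move=> i _; exact: hdot_ge0.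
move=> /allP h; apply/eqP/ffunP => i; rewrite ffunE; apply/eqP.
apply: contraTT (h i (mem_index_enum i)) => xi0.
by rewrite implyTb gt_eqF// neq0_dnorm_gt0.
Qed.

HB.instance Definition _ := isDotProduct.Build R[i] V pow_dot pow_dot_gt0.

Let Re_ge0 (x : H) : 0 <= complex.Re (hdot x x).
Proof. by have := hdot_ge0 x; rewrite lecE => /andP[]. Qed.

Let Re_pow_dot (x : V) :
  complex.Re (pow_dot x x) = \sum_i complex.Re (hdot (x i) (x i)).
Proof. by rewrite /pow_dot (raddf_sum (@complex.Re R)). Qed.

Fact pow_dot_complete : dot_complete pow_dot.
Proof.
move=> u cu.
have comp_le (x : V) i : hnorm (x i) <= dot_norm pow_dot x.
  rewrite /hnorm /dot_norm ler_sqrt; last first.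
    by rewrite Re_pow_dot sumr_ge0.
  by rewrite Re_pow_dot (bigD1 i)//= lerDl sumr_ge0.
have /choice[l hl] : forall i, exists l : H,
    hnorm (u k i - l) @[k --> \oo] --> (0 : R).
  move=> i; apply: (@hilbert_complete R H (fun k => u k i)) => e e0.
  have [N hN] := cu e e0; exists N => p q Np Nq.
  apply: le_lt_trans (hN p q Np Nq).
  by have := comp_le (u p - u q) i; rewrite !ffunE.
exists [ffun i => l i].
have -> : (fun k => dot_norm pow_dot (u k - [ffun i => l i])) =
    (fun k => Num.sqrt (\sum_i (hnorm (u k i - l i)) ^+ 2)).
  apply/funext => k; rewrite /dot_norm Re_pow_dot; congr Num.sqrt.
  by apply: eq_bigr => i _; rewrite !ffunE sqr_sqrtr.
have h : \sum_i hnorm (u k i - l i) ^+ 2 @[k --> \oo] --> (0 : R).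
  have hi i : true -> hnorm (u k i - l i) ^+ 2 @[k --> \oo] --> ((0 : R) ^+ 2).
    by move=> _; rewrite expr2; under eq_fun do rewrite expr2; exact: cvgM.
  have e0 : \sum_(i < n) ((0 : R) ^+ 2) = 0.
    by rewrite big1// => i _; rewrite expr0n.
  have := @cvg_big R _ +%R 0 xpredT (@add_continuous R) _ _
    (index_enum 'I_n) _ _ _ hi; rewrite e0; apply.
by rewrite -[X in _ --> X]sqrtr0; exact: (cvg_comp _ _ h (@sqrt_continuous R 0)).
Qed.

Definition hilbert_pow : hilbertType R := HilbertType pow_dot_complete.

Definition hcoord (u : hilbert_pow) (i : 'I_n) : H := (u : V) i.

End HilbertPower.

Section VonNeumann.
Variables (R : realType) (H : hilbertType R).
Implicit Types (f g p q v w : H -> H) (S M : set (H -> H)).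

Definition bounded_op f : Prop :=
  linear f /\ exists C : R, forall x : H, hnorm (f x) <= C * hnorm x.

Definition is_adjoint f g : Prop :=
  forall x y : H, hdot (f x) y = hdot x (g y).

Definition commutant S : set (H -> H) :=
  [set f | bounded_op f /\ forall g, S g -> f \o g =1 g \o f].

(* A self-adjoint set equal to its bicommutant is automatically a unital
   *-subalgebra of B(H), closed in the weak operator topology. *)
Definition von_neumann_algebra M : Prop :=
  (forall f g, M f -> is_adjoint f g -> M g) /\ commutant (commutant M) = M.

Definition commutative_algebra M : Prop :=
  forall f g, M f -> M g -> f \o g =1 g \o f.

Definition is_projection p : Prop :=
  [/\ bounded_op p, p \o p =1 p & is_adjoint p p].

(* range q is contained in range p *)
Definition projection_le q p : Prop := p \o q =1 q.

Definition mvn_equiv M p q : Prop :=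
  exists v w, [/\ M v, is_adjoint v w, w \o v =1 p & v \o w =1 q].

Definition finite_projection M p : Prop :=
  [/\ M p, is_projection p &
    forall q, M q -> is_projection q -> projection_le q p ->
      mvn_equiv M p q -> q =1 p].

Definition central_projection M p : Prop :=
  [/\ M p, is_projection p & forall f, M f -> p \o f =1 f \o p].

End VonNeumann.

Section Unbounded.
Variables (R : realType) (H : hilbertType R).

Definition operator := set (H * H).

Implicit Types (x y T : operator) (f p : H -> H) (M : set (H -> H)).

Definition op_graph f : operator := [set z | z.2 = f z.1].

Definition op_dom x : set H := [set u | exists v, x (u, v)].

Definition linear_op x : Prop :=
  [/\ x (0, 0),
      forall (a : R[i]) u v, x u -> x v -> x (a *: u + v)
    & forall v, x (0, v) -> v = 0].

Definition densely_defined x : Prop :=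
  forall (u : H) (e : R), 0 < e -> exists2 v, op_dom x v & hnorm (u - v) < e.

Definition op_closure x : operator :=
  [set z | forall e : R, 0 < e ->
    exists2 t, x t & hnorm (z.1 - t.1) < e /\ hnorm (z.2 - t.2) < e].

Definition closed_op x : Prop := op_closure x `<=` x.

Definition op_add x y : operator :=
  [set z | exists v w, [/\ x (z.1, v), y (z.1, w) & z.2 = v + w]].

Definition op_mul x y : operator :=
  [set z | exists2 v, y (z.1, v) & x (v, z.2)].

Definition op_adjoint x : operator :=
  [set z | forall u v, x (u, v) -> hdot v z.1 = hdot u z.2].

Definition positive_selfadjoint T : Prop :=
  [/\ linear_op T, densely_defined T, op_adjoint T = T
    & forall u v, T (u, v) -> 0 <= hdot v u].

(* T = |x|, the positive square root of x^* x *)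
Definition is_modulus x T : Prop :=
  positive_selfadjoint T /\ op_mul T T = op_mul (op_adjoint x) x.

Definition spectral_family (E : R -> H -> H) : Prop :=
  [/\ forall l, is_projection (E l),
      forall l m, l <= m -> projection_le (E l) (E m),
      forall l u, hnorm (E m u - E l u) @[m --> l^'+] --> (0 : R),
      forall u, hnorm (E l u) @[l --> -oo] --> (0 : R)
    & forall u, hnorm (E l u - u) @[l --> +oo] --> (0 : R)].

(* T = \int l dE_l: the domain of T consists of the vectors u such that
   \int l^2 d<E_l u, u> < +oo, and then <T u, u> = \int l d<E_l u, u>. *)
Definition spectral_resolution T (E : R -> H -> H) : Prop :=
  spectral_family E /\
  forall u : H, exists F : cumulative R R,
    [/\ forall l, (F l)%:C = hdot (E l u) u,
        op_dom T u <->
          (\int[lebesgue_stieltjes_measure F]_(l in [set: R])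
             (l ^+ 2)%:E < +oo)%E
      & forall v, T (u, v) ->
          hdot v u =
            (\int[lebesgue_stieltjes_measure F]_(l in [set: R]) l)%:C].

(* p = chi_(c, +oo) (T); recall that E_c = chi_(-oo, c] (T) *)
Definition is_spectral_projection_gt T (c : R) p : Prop :=
  exists2 E, spectral_resolution T E & forall u, p u = u - E c u.

Definition affiliated M x : Prop :=
  [/\ linear_op x, densely_defined x, closed_op x
    & forall f, commutant M f ->
        op_mul (op_graph f) x `<=` op_mul x (op_graph f)].

Definition measurable_op M x : Prop :=
  affiliated M x /\
  exists (c : R) T p, [/\ 0 < c, is_modulus x T,
    is_spectral_projection_gt T c p & finite_projection M p].

Definition locally_measurable M x : Prop :=
  affiliated M x /\
  exists p : nat -> H -> H,
    [/\ forall k, central_projection M (p k),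
        forall k, projection_le (p k) (p k.+1),
        forall u, hnorm (p k u - u) @[k --> \oo] --> (0 : R)
      & forall k, measurable_op M (op_mul x (op_graph (p k)))].

Definition LS M : set operator := [set x | locally_measurable M x].

Definition ls_add x y : operator := op_closure (op_add x y).
Definition ls_mul x y : operator := op_closure (op_mul x y).
Definition ls_one : operator := op_graph id.

(* Psi restricts to a ring automorphism of LS M; its values outside LS M are
   irrelevant. *)
Definition ring_automorphism M (Psi : operator -> operator) : Prop :=
  [/\ set_bij (LS M) (LS M) Psi,
      forall x y, LS M x -> LS M y ->
        Psi (ls_add x y) = ls_add (Psi x) (Psi y)
    & forall x y, LS M x -> LS M y ->
        Psi (ls_mul x y) = ls_mul (Psi x) (Psi y)].

Definition ls_inverse M y z : Prop :=
  [/\ LS M y, LS M z, ls_mul y z = ls_one & ls_mul z y = ls_one].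

End Unbounded.

Section Matrices.
Variables (R : realType) (H : hilbertType R) (n : nat) (A : set (H -> H)).
Local Notation Hn := (hilbert_pow H n).

(* M_n(A), acting on the Hilbert sum of n copies of H *)
Definition matrix_algebra : set (Hn -> Hn) :=
  [set f | exists a : 'M[H -> H]_n, (forall i j, A (a i j)) /\
     forall u i, hcoord (f u) i = \sum_j a i j (hcoord u j)].

(* The operator given by a matrix of operators: the closure of
   u |-> (\sum_j x_ij u_j)_i with its natural domain.  This is the
   identification of matrices over LS A with elements of LS (M_n(A)). *)
Definition operator_of_mx (X : 'M[operator H]_n) : operator Hn :=
  op_closure [set z : Hn * Hn | exists V : 'M[H]_n,
    (forall i j, X i j (hcoord z.1 j, V i j)) /\
    forall i, hcoord z.2 i = \sum_j V i j].

Definition mx_over_LS (X : 'M[operator H]_n) : Prop :=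
  forall i j, LS A (X i j).

(* psi' (x_ij) = (psi x_ij).  The first clause says that every element of
   LS (M_n(A)) is of the form (x_ij), so that psi' is determined by psi. *)
Definition entrywise (psi : operator H -> operator H)
    (psi' : operator Hn -> operator Hn) : Prop :=
  (forall x, LS matrix_algebra x ->
     exists2 X, mx_over_LS X & x = operator_of_mx X) /\
  (forall X, mx_over_LS X ->
     psi' (operator_of_mx X) = operator_of_mx (map_mx psi X)).

End Matrices.

Arguments matrix_algebra {R H} n A.

(* Main.v *)
(* A locally measurable operator of M_n(A) is locally bounded: it is glued from
   bounded elements b_k of M_n(A) along central projections p_k increasing to 1.
   Indeed, if B = (1 + x^* x)^-1, then x is bounded on the spectral projections
   e_k = chi_(1/k, 1](B), which increase to 1 in M_n(A), and det(e_k) is a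
   central projection below e_k which also increases to 1.  Hence sums,
   products and identities of locally measurable operators are computed on the
   b_k, LS(M_n(A)) is the ring of matrices over L = LS(A), and L is commutative
   and von Neumann regular.  Let Phi be a ring automorphism of M_n(L) and psi
   its restriction to the centre L.  The idempotent P = Phi(e_11) satisfies
   P e_kl P = t_kl P with \sum_k t_kk = 1; by regularity there are disjoint
   idempotents s_k summing to 1 such that t_kk is invertible on s_k, and this
   factors P as a column times a row.  The column and the row, transported by
   the matrix units Phi(e_ij), give y and y^-1. *)
Require Import Defs.
From HB Require Import structures.
From mathcomp Require Import all_boot all_order all_algebra.
From mathcomp Require Import sesquilinear complex ring lra.
From mathcomp Require Import all_classical all_reals all_analysis.
From mathcomp Require Import measurable_realfun.
Set Implicit Arguments.
Unset Strict Implicit.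
Unset Printing Implicit Defensive.
Import Order.TTheory GRing.Theory Num.Theory.
Import numFieldNormedType.Exports.
Local Open Scope classical_set_scope.
Local Open Scope ring_scope.
Local Open Scope complex_scope.

(** * Hilbert spaces as real inner product spaces *)

(** No representation of A by functions is used: what would be pointwise is expressed by
    idempotents, determinants and supports. Over functions, the determinant of a projection matrix
    is 1 where the matrix is the identity and 0 elsewhere; algebraically, e adj(e) = det(e) puts it
    below e, and convergence to 1 holds because the determinant is strongly continuous on bounded
    sets. Unbounded operators are handled through their closed graphs: B and D = xB are the two
    components of the orthogonal projection of (u, 0) on the graph of x. Regularity of L follows
    from x = D B^-1 together with the case of a bounded a, whose quasi-inverse is glued from (a^*
    a)^-1 a^* on spectral pieces of a^* a. Conversely, showing that a glued operator is locally
    measurable requires a modulus and a Stieltjes spectral resolution of its bounded pieces. This is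
    why square roots, spectral projections and Stieltjes integrals are developed for bounded
    operators. *)

Lemma Re_conj (R : realType) (z : R[i]) : complex.Re (Num.conj z) = complex.Re z.
Proof. by case: z. Qed.

Lemma Re_realM (R : realType) (r : R) (z : R[i]) :
  complex.Re (r%:C * z) = r * complex.Re z.
Proof. by case: z => a b /=; rewrite mul0r subr0. Qed.

Lemma Re_iM (R : realType) (z : R[i]) : complex.Re ('i * z) = - complex.Im z.
Proof. by case: z => a b /=; rewrite mul0r mul1r sub0r. Qed.

Lemma Re_conjiM (R : realType) (z : R[i]) :
  complex.Re (Num.conj 'i * z) = complex.Im z.
Proof. by case: z => a b /=; rewrite mul0r sub0r mulN1r opprK. Qed.

Section RealDot.
Variables (R : realType) (H : hilbertType R).
Implicit Types (x y z : H) (r s : R).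

Definition rdot x y : R := complex.Re (hdot x y).

Lemma rdotC x y : rdot x y = rdot y x.
Proof. by rewrite /rdot hermC expr0 mul1r Re_conj. Qed.

Lemma rdotDl x y z : rdot (x + y) z = rdot x z + rdot y z.
Proof. by rewrite /rdot linearDl raddfD. Qed.

Lemma rdotNl x z : rdot (- x) z = - rdot x z.
Proof. by rewrite /rdot linearNl raddfN. Qed.

Lemma rdotZl r x z : rdot (r%:C *: x) z = r * rdot x z.
Proof. by rewrite /rdot linearZl_LR Re_realM. Qed.

Lemma rdotDr x y z : rdot z (x + y) = rdot z x + rdot z y.
Proof. by rewrite !(rdotC z) rdotDl. Qed.

Lemma rdotNr x z : rdot z (- x) = - rdot z x.
Proof. by rewrite !(rdotC z) rdotNl. Qed.

Lemma rdotZr r x z : rdot z (r%:C *: x) = r * rdot z x.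
Proof. by rewrite !(rdotC z) rdotZl. Qed.

Lemma rdot0l z : rdot 0 z = 0.
Proof. by rewrite /rdot linear0l. Qed.

Lemma rdot0r z : rdot z 0 = 0.
Proof. by rewrite rdotC rdot0l. Qed.

Definition rdotE := (rdotDl, rdotDr, rdotNl, rdotNr, rdotZl, rdotZr, rdot0l, rdot0r).

Lemma rdot_ge0 x : 0 <= rdot x x.
Proof. by have := hdot_ge0 x; rewrite lecE => /andP[]. Qed.

Lemma rdot_eq0 x : rdot x x = 0 -> x = 0.
Proof.
move=> x0; apply/eqP; rewrite -(dnorm_eq0 hdot); apply/eqP.
have := hdot_ge0 x; rewrite lecE /= => /andP[/eqP i0 _].
by apply/eqP; rewrite eq_complex i0 -[complex.Re _]/(rdot x x) x0 eqxx.
Qed.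

(** The real part determines the whole inner product: by conjugate-linearity in the second argument,
    multiplying it by ['i] exposes the imaginary part. *)
Lemma hdotE x y : hdot x y = (rdot x y) +i* (rdot x ('i *: y)).
Proof.
have -> : rdot x ('i *: y) = complex.Im (hdot x y).
  by rewrite /rdot linearZr_LR Re_conjiM.
by rewrite /rdot; case: (hdot x y).
Qed.

Lemma rdot_iZl x y : rdot ('i *: x) y = - rdot x ('i *: y).
Proof.
have -> : rdot ('i *: x) y = - complex.Im (hdot x y) by rewrite /rdot linearZl_LR Re_iM.
by rewrite hdotE.
Qed.

(** Testing the real identity at ['i *: x] as well, and using complex linearity of [f], supplies the
    imaginary parts. *)
Lemma is_adjointP (f g : H -> H) : linear f ->
  (forall x y, rdot (f x) y = rdot x (g y)) -> is_adjoint f g.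
Proof.
move=> lf fg x y.
have fi : f ('i *: x) = 'i *: f x.
  have f0 : f 0 = 0 by have := lf (-1) 0 0; rewrite scaler0 addr0 scaleN1r addNr.
  by have := lf 'i x 0; rewrite f0 !addr0.
have := fg ('i *: x) y; rewrite fi /rdot !linearZl_LR !Re_iM => /oppr_inj h.
by apply/eqP; rewrite eq_complex; apply/andP; split; apply/eqP; rewrite // -/(rdot _ _) fg.
Qed.

Lemma is_adjoint_rdot (f g : H -> H) x y : is_adjoint f g ->
  rdot (f x) y = rdot x (g y).
Proof. by move=> fg; rewrite /rdot fg. Qed.

Lemma hnormE x : hnorm x = Num.sqrt (rdot x x).
Proof. by []. Qed.

Lemma hnorm_ge0 x : 0 <= hnorm x.
Proof. exact: sqrtr_ge0. Qed.

Lemma hnorm_sq x : hnorm x ^+ 2 = rdot x x.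
Proof. by rewrite hnormE sqr_sqrtr ?rdot_ge0. Qed.

Lemma hnorm0 : hnorm (0 : H) = 0.
Proof. by rewrite hnormE rdot0l sqrtr0. Qed.

Lemma hnorm_eq0 x : hnorm x = 0 -> x = 0.
Proof. by move=> h; apply: rdot_eq0; rewrite -hnorm_sq h expr0n. Qed.

Lemma hnorm_opp x : hnorm (- x) = hnorm x.
Proof. by rewrite !hnormE !rdotE opprK. Qed.

Lemma hnorm_subC x y : hnorm (x - y) = hnorm (y - x).
Proof. by rewrite -hnorm_opp opprB. Qed.

Lemma hnormZ r x : hnorm (r%:C *: x) = `|r| * hnorm x.
Proof.
by rewrite !hnormE !rdotE mulrA -expr2 sqrtrM ?sqr_ge0// sqrtr_sqr.
Qed.

Lemma hnormZi x : hnorm ('i *: x) = hnorm x.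
Proof. by rewrite !hnormE rdot_iZl scalerA -expr2 sqr_i -rdotNr scaleN1r opprK. Qed.

Lemma hnorm_le x y : (hnorm x <= hnorm y) = (rdot x x <= rdot y y).
Proof. by rewrite !hnormE ler_sqrt// rdot_ge0. Qed.

(** Cauchy-Schwarz, by expanding the squared norm of |y| x - |x| y. *)
Lemma rdot_le x y : rdot x y <= hnorm x * hnorm y.
Proof.
have [/hnorm_eq0->|x0] := eqVneq (hnorm x) 0; first by rewrite rdot0l hnorm0 mul0r.
have [/hnorm_eq0->|y0] := eqVneq (hnorm y) 0; first by rewrite rdot0r hnorm0 mulr0.
have := rdot_ge0 ((hnorm y)%:C *: x - (hnorm x)%:C *: y).
rewrite !rdotE (rdotC y x) -!hnorm_sq => h.
have xp : 0 < hnorm x by rewrite lt_def x0 hnorm_ge0.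
have yp : 0 < hnorm y by rewrite lt_def y0 hnorm_ge0.
rewrite -(ler_pM2l (mulr_gt0 xp yp)) -subr_ge0; nra.
Qed.

Lemma rdot_normr x y : `|rdot x y| <= hnorm x * hnorm y.
Proof. by rewrite ler_norml rdot_le andbT lerNl -rdotNl -(hnorm_opp x) rdot_le. Qed.

Lemma ler_hnormD x y : hnorm (x + y) <= hnorm x + hnorm y.
Proof.
rewrite -ler_sqr ?nnegrE ?addr_ge0 ?hnorm_ge0// hnorm_sq !rdotE (rdotC y x).
by rewrite sqrrD !hnorm_sq; have := rdot_le x y; lra.
Qed.

Lemma ler_hnorm_dist x y z : hnorm (x - z) <= hnorm (x - y) + hnorm (y - z).
Proof. by apply: le_trans (ler_hnormD _ _); rewrite addrA subrK. Qed.

Lemma ler_hnormB x y : hnorm x <= hnorm (x - y) + hnorm y.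
Proof. by apply: le_trans (ler_hnormD _ _); rewrite subrK. Qed.

Lemma hnorm_lt_eq x : (forall e, 0 < e -> hnorm x < e) -> x = 0.
Proof.
move=> h; apply: hnorm_eq0; apply/eqP; rewrite eq_le hnorm_ge0 andbT.
by apply/ler_addgt0Pl => e /h /ltW; rewrite addr0.
Qed.

(** [H] carries no topology here, so norm convergence is stated with epsilons; [hcvgP] translates it
    into the filter form of the definitions. *)
Definition hcvg (u : nat -> H) x := forall e, 0 < e ->
  exists N, forall n, (N <= n)%N -> hnorm (u n - x) < e.

Lemma hcvgP (u : nat -> H) x :
  hcvg u x <-> (hnorm (u n - x) @[n --> \oo] --> (0 : R)).
Proof.
split=> [h|/cvgrPdist_lt h].
  apply/cvgrPdist_lt => e /h[N hN]; exists N => // n /= /hN.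
  by rewrite sub0r normrN ger0_norm ?hnorm_ge0.
move=> e /h[N _ hN]; exists N => n /hN /=.
by rewrite sub0r normrN ger0_norm ?hnorm_ge0.
Qed.

Lemma hilbert_cvg (u : nat -> H) :
  (forall e, 0 < e -> exists N, forall m n, (N <= m)%N -> (N <= n)%N ->
     hnorm (u m - u n) < e) -> exists x, hcvg u x.
Proof.
by move=> /(@hilbert_complete R H)[l hl]; exists l; apply/hcvgP.
Qed.

Lemma hcvg_cst x : hcvg (fun=> x) x.
Proof. by move=> e e0; exists 0%N => n _; rewrite subrr hnorm0. Qed.

Lemma hcvg_unique (u : nat -> H) x y : hcvg u x -> hcvg u y -> x = y.
Proof.
move=> ux uy; apply/eqP; rewrite -subr_eq0; apply/eqP/hnorm_lt_eq => e e0.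
have e2 : 0 < e / 2 by rewrite divr_gt0.
have [N hN] := ux _ e2; have [M hM] := uy _ e2.
have /hN := leq_maxl N M; have /hM := leq_maxr N M.
have := ler_hnorm_dist x (u (maxn N M)) y; rewrite (hnorm_subC x (u _)); lra.
Qed.

Lemma hcvgD (u v : nat -> H) x y : hcvg u x -> hcvg v y ->
  hcvg (fun n => u n + v n) (x + y).
Proof.
move=> ux uy e e0.
have e2 : 0 < e / 2 by rewrite divr_gt0.
have [N hN] := ux _ e2; have [M hM] := uy _ e2; exists (maxn N M) => n.
rewrite geq_max => /andP[/hN h1 /hM h2].
have := ler_hnormD (u n - x) (v n - y); rewrite opprD addrACA; lra.
Qed.

Lemma hcvg_bounded (f : H -> H) C (u : nat -> H) x :
  (forall x y, hnorm (f x - f y) <= C * hnorm (x - y)) -> hcvg u x ->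
  hcvg (f \o u) (f x).
Proof.
move=> fC ux e e0.
have C1 : 0 < `|C| + 1 by rewrite ltr_pwDr.
have [N hN] := ux (e / (`|C| + 1)) (divr_gt0 e0 C1).
exists N => n /hN; rewrite ltr_pdivlMr// => h; apply: le_lt_trans h.
apply: le_trans (fC _ _) _; rewrite mulrC ler_wpM2l ?hnorm_ge0//.
by apply: le_trans (ler_norm _) _; rewrite lerDl.
Qed.

Lemma cvg_rdotl (u : nat -> H) x z : hcvg u x ->
  rdot (u n) z @[n --> \oo] --> rdot x z.
Proof.
move=> ux; apply/cvgrPdist_lt => e e0.
have z1 : 0 < hnorm z + 1 by rewrite ltr_wpDl ?hnorm_ge0.
have [N hN] := ux _ (divr_gt0 e0 z1); exists N => // n /= /hN.
rewrite ltr_pdivlMr// hnorm_subC -rdotNl -rdotDl; apply: le_lt_trans.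
by apply: le_trans (rdot_normr _ _) _; rewrite ler_wpM2l ?hnorm_ge0// lerDl.
Qed.

Lemma hcvg_rdot (u v : nat -> H) x y (c : R) : hcvg u x -> hcvg v y ->
  (forall n, rdot (u n) (v n) = c) -> rdot x y = c.
Proof.
move=> ux uy h; apply/eqP; rewrite -subr_eq0 -normr_eq0.
rewrite eq_le normr_ge0 andbT; apply/ler_addgt0Pl => e e0; rewrite addr0.
(* With d at most 1, [v n] is bounded by 1 + |y|, and the two error terms add up to at most d *
   K. *)
pose K := hnorm x + hnorm y + 1.
have K1 : 0 < K by rewrite /K; have := hnorm_ge0 x; have := hnorm_ge0 y; lra.
pose d := Num.min (e / K) 1.
have d0 : 0 < d by rewrite lt_min divr_gt0//=.
have dK : d * K <= e by rewrite -ler_pdivlMr// ge_min lexx.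
have d1 : d <= 1 by rewrite ge_min lexx orbT.
have [N hN] := ux _ d0; have [M hM] := uy _ d0.
have /hN {}hN := leq_maxl N M; have /hM {}hM := leq_maxr N M.
set n := maxn N M in hN hM.
have -> : rdot x y - c = - (rdot (u n - x) (v n) + rdot x (v n - y)).
  by rewrite -(h n) !rdotE; ring.
rewrite normrN; apply: le_trans (ler_normD _ _) _.
have h1 := rdot_normr (u n - x) (v n); have h2 := rdot_normr x (v n - y).
have h3 : hnorm (v n) <= 1 + hnorm y.
  by apply: le_trans (ler_hnormB _ y) _; rewrite lerD2r; apply: le_trans d1; exact: ltW.
apply: le_trans dK; rewrite /K.
have h4 : hnorm (u n - x) * hnorm (v n) <= d * (1 + hnorm y).
  by rewrite ler_pM ?hnorm_ge0// ltW.
have h5 : hnorm x * hnorm (v n - y) <= hnorm x * d.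
  by rewrite ler_wpM2l ?hnorm_ge0// ltW.
lra.
Qed.

(* Real subspaces are enough: they cover both complex subspaces and kernels of
   the real functionals [rdot (f _) y]. *)
Definition closed_subspace (S : set H) :=
  [/\ S 0, forall x y, S x -> S y -> S (x + y), forall r x, S x -> S (r%:C *: x)
    & forall u x, (forall n : nat, S (u n)) -> hcvg u x -> S x].

Lemma closed_subspaceB S x y : closed_subspace S -> S x -> S y -> S (x - y).
Proof.
move=> [_ SD SZ _] Sx Sy; apply: SD => //.
by have := SZ (-1) _ Sy; rewrite rmorphN1 scaleN1r.
Qed.

(** Both residuals are orthogonal to p - q, which lies in S; subtracting gives |p - q|^2 = 0. *)
Lemma proj_unique (S : set H) x p q : closed_subspace S ->
  S p -> (forall y, S y -> rdot (x - p) y = 0) ->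
  S q -> (forall y, S y -> rdot (x - q) y = 0) -> p = q.
Proof.
move=> cS Sp hp Sq hq; apply/eqP; rewrite -subr_eq0; apply/eqP/rdot_eq0.
have S_pq := closed_subspaceB cS Sp Sq.
have := hp _ S_pq; have := hq _ S_pq; rewrite !rdotE; lra.
Qed.

Lemma parallelogram x y : rdot (x - y) (x - y) =
  2 * rdot x x + 2 * rdot y y - 4 * rdot (2^-1%:C *: (x + y)) (2^-1%:C *: (x + y)).
Proof. by rewrite !rdotE (rdotC y x); field. Qed.

(** A minimizing sequence for the distance to S is Cauchy by the parallelogram identity, since
    midpoints stay in S; its limit realizes the minimum, and varying it along S yields
    orthogonality. *)
Lemma proj_exists (S : set H) x : closed_subspace S ->
  exists2 p, S p & forall y, S y -> rdot (x - p) y = 0.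
Proof.
move=> cS; have [S0 SD SZ Scl] := cS.
pose D : set R := [set rdot (x - y) (x - y) | y in S].
have D0 : has_inf D.
  split; first by exists (rdot (x - 0) (x - 0)), 0.
  by exists 0 => _ [y _ <-]; exact: rdot_ge0.
pose d := inf D.
have dle y : S y -> d <= rdot (x - y) (x - y).
  by move=> Sy; apply: ge_inf; [case: D0|exists y].
have /choice[u hu] : forall n : nat, exists y, S y /\ rdot (x - y) (x - y) < d + n.+1%:R^-1.
  move=> n; have := @inf_adherent _ D n.+1%:R^-1; rewrite invr_gt0 ltr0Sn => /(_ isT D0)[_ [y Sy <-] h].
  by exists y.
have dist m n : hnorm (u m - u n) ^+ 2 <= 2 * m.+1%:R^-1 + 2 * n.+1%:R^-1.
  have [Sm hm] := hu m; have [Sn hn] := hu n.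
  rewrite hnorm_sq -[u m - u n](_ : (x - u n) - (x - u m) = _); last first.
    by rewrite opprB addrC addrA subrK.
  rewrite parallelogram.
  have -> : 2^-1%:C *: (x - u n + (x - u m)) = x - 2^-1%:C *: (u n + u m).
    rewrite addrACA -opprD scalerBr; congr (_ - _).
    by rewrite -[x in x + _]scale1r -[x in _ + x]scale1r -scalerDl scalerA -natr1 -(rmorph1 (real_complex R)) -rmorphD -rmorphM mulVf ?pnatr_eq0// rmorph1 scale1r.
  have := dle _ (SZ 2^-1 _ (SD _ _ Sn Sm)).
  move: hm hn; move: (rdot _ _) (rdot _ _) (rdot _ _) (m.+1%:R^-1) (n.+1%:R^-1).
  by move=> a b c a1 b1; lra.
have [e e0|p up] := @hilbert_cvg u.
  have e2 : 0 < e ^+ 2 / 4 by rewrite divr_gt0// exprn_gt0.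
  have [N hN] : exists N : nat, N.+1%:R^-1 < e ^+ 2 / 4.
    have [N _ /(_ N (leqnn N)) /=] := (cvgrPdist_lt _ _).1 (@cvg_harmonic R) _ e2.
    by rewrite sub0r normrN ger0_norm ?harmonic_ge0// => h; exists N.
  exists N => m n Nm Nn; rewrite -ltr_sqr ?nnegrE ?hnorm_ge0 ?ltW//.
  apply: le_lt_trans (dist m n) _.
  have inv_le k : (N <= k)%N -> k.+1%:R^-1 <= N.+1%:R^-1 :> R.
    by move=> Nk; rewrite lef_pV2 ?posrE ?ltr0Sn// ler_nat ltnS.
  have := inv_le _ Nm; have := inv_le _ Nn; move: hN.
  by move: (N.+1%:R^-1) (m.+1%:R^-1) (n.+1%:R^-1) => a b c; lra.
have Sp : S p by apply: Scl up => n; case: (hu n).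
exists p => // y Sy.
(* The limit attains the infimum: combine |x - u_n|^2 < d + 1/(n+1) with the triangle inequality. *)
have pd : rdot (x - p) (x - p) <= d.
  rewrite -hnorm_sq; have d0 : 0 <= d by apply: lb_le_inf; [case: D0|move=> _ [z _ <-]; exact: rdot_ge0].
  rewrite -(sqr_sqrtr d0) ler_sqr ?nnegrE ?hnorm_ge0 ?sqrtr_ge0//.
  apply/ler_addgt0Pl => e e0.
  have [N hN] := up _ (divr_gt0 e0 (ltr0n _ 2)).
  have [M hM] : exists M, forall n, (M <= n)%N -> hnorm (x - u n) < Num.sqrt d + e / 2.
    have e2 : 0 < (e / 2) ^+ 2 by rewrite exprn_gt0// divr_gt0.
    have [M _ hM] := (cvgrPdist_lt _ _).1 (@cvg_harmonic R) _ e2.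
    exists M => n /hM /=; rewrite sub0r normrN ger0_norm ?harmonic_ge0// => h.
    rewrite -ltr_sqr ?nnegrE ?hnorm_ge0 ?addr_ge0 ?sqrtr_ge0 ?divr_ge0 ?ltW//.
    rewrite hnorm_sq sqrrD sqr_sqrtr//; have [_] := hu n; rewrite /harmonic /= in h.
    by move: h (sqrtr_ge0 d); move: (n.+1%:R^-1) => a; nra.
  have /hN := leq_maxl N M; have /hM := leq_maxr N M; have := ler_hnorm_dist x (u (maxn N M)) p; lra.
set q := rdot (x - p) y.
(* Comparing p with p + r y gives a quadratic inequality in r; at its minimizer r = q / |y|^2 it
   reads - q^2 / |y|^2 >= 0. *)
have key r : 0 <= - 2 * r * q + r ^+ 2 * rdot y y.
  have := dle _ (SD _ _ Sp (SZ r _ Sy)).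
  have -> : x - (p + r%:C *: y) = (x - p) - r%:C *: y by rewrite opprD addrA.
  move: pd; rewrite /q; move: (x - p) => w; rewrite !rdotE (rdotC y w); lra.
have := rdot_ge0 y; rewrite le_eqVlt => /orP[/eqP/esym y0|y0].
  by rewrite /q (rdot_eq0 y0) rdot0r.
have := key (q / rdot y y).
have -> : - 2 * (q / rdot y y) * q + (q / rdot y y) ^+ 2 * rdot y y = - (q ^+ 2 / rdot y y).
  by field; rewrite gt_eqF.
rewrite oppr_ge0 pmulr_lle0 ?invr_gt0// => h2; apply/eqP; rewrite -sqrf_eq0.
by rewrite eq_le h2 sqr_ge0.
Qed.

End RealDot.
Arguments hcvg {R H}.

(** * The ring of bounded operators *)

Section BoundedOperators.
Variables (R : realType) (H : hilbertType R).

(** Bundling boundedness makes the operators a ring, so that identities are proved by ring rewriting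
    and commutation by [GRing.comm]. The ring may be zero, because [H] may be. *)
Record bop := Bop { bop_fun :> H -> H; bop_bounded : bounded_op bop_fun }.

HB.instance Definition _ := gen_eqMixin bop.
HB.instance Definition _ := gen_choiceMixin bop.

Lemma bopP (f g : bop) : f =1 g -> f = g.
Proof.
case: f g => [f hf] [g hg] /= /funext e; rewrite -e in hg *.
by congr Bop; exact: Prop_irrelevance.
Qed.

Fact bop_linear (f : bop) : linear f.
Proof. by case: f => f []. Qed.

HB.instance Definition _ (f : bop) :=
  GRing.isLinear.Build R[i] H H *:%R f (bop_linear f).

Lemma bopD (f : bop) x y : f (x + y) = f x + f y. Proof. exact: linearD. Qed.
Lemma bopB (f : bop) x y : f (x - y) = f x - f y. Proof. exact: linearB. Qed.
Lemma bopN (f : bop) x : f (- x) = - f x. Proof. exact: linearN. Qed.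
Lemma bop0 (f : bop) : f 0 = 0. Proof. exact: linear0. Qed.
Lemma bopZ (f : bop) (a : R[i]) x : f (a *: x) = a *: f x.
Proof. exact: linearZ. Qed.

Lemma bop_bound (f : bop) : exists2 C : R, 0 < C & forall x, hnorm (f x) <= C * hnorm x.
Proof.
case: f => f [lf [C hC]] /=; exists (`|C| + 1); first by rewrite ltr_pwDr.
move=> x; apply: le_trans (hC x) _; rewrite ler_wpM2r ?hnorm_ge0//.
by apply: le_trans (ler_norm _) _; rewrite lerDl.
Qed.

Lemma bop_cvg (f : bop) u x : hcvg u x -> hcvg (f \o u) (f x).
Proof.
have [C _ hC] := bop_bound f.
by apply: (hcvg_bounded (C := C)) => a b; rewrite -bopB; exact: hC.
Qed.

Fact bop0_bounded : bounded_op (fun _ : H => 0 : H).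
Proof.
split; first by move=> a u v; rewrite scaler0 addr0.
by exists 0 => x; rewrite mul0r hnorm0.
Qed.

Fact bop1_bounded : bounded_op (fun x : H => x).
Proof. by split => //; exists 1 => x; rewrite mul1r. Qed.

Fact bopD_bounded (f g : bop) : bounded_op (fun x => f x + g x).
Proof.
split; first by move=> a u v; rewrite !linearP scalerDr addrACA.
have [C _ hC] := bop_bound f; have [D _ hD] := bop_bound g.
exists (C + D) => x; rewrite mulrDl; apply: le_trans (ler_hnormD _ _) _.
exact: lerD.
Qed.

Fact bopN_bounded (f : bop) : bounded_op (fun x => - f x).
Proof.
split; first by move=> a u v; rewrite linearP opprD scalerN.
by have [C _ hC] := bop_bound f; exists C => x; rewrite hnorm_opp.
Qed.

Fact bopM_bounded (f g : bop) : bounded_op (fun x => f (g x)).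
Proof.
split; first by move=> a u v; rewrite !linearP.
have [C C0 hC] := bop_bound f; have [D _ hD] := bop_bound g.
exists (C * D) => x; rewrite -mulrA; apply: le_trans (hC _) _.
by rewrite ler_pM2l.
Qed.

(** Only real scalars act on [bop]: the adjoint is linear over them, and they suffice to form T -
    l. *)
Fact bopZ_bounded (r : R) (f : bop) : bounded_op (fun x => r%:C *: f x).
Proof.
split; first by move=> a u v; rewrite linearP scalerDr !scalerA mulrC.
have [C C0 hC] := bop_bound f; exists (`|r| * C) => x.
by rewrite hnormZ -mulrA ler_wpM2l.
Qed.

Definition bop_add f g := Bop (bopD_bounded f g).
Definition bop_opp f := Bop (bopN_bounded f).
Definition bop_mul f g := Bop (bopM_bounded f g).
Definition bop_scale r f := Bop (bopZ_bounded r f).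

Fact bop_addA : associative bop_add.
Proof. by move=> f g h; apply: bopP => x /=; rewrite addrA. Qed.
Fact bop_addC : commutative bop_add.
Proof. by move=> f g; apply: bopP => x /=; rewrite addrC. Qed.
Fact bop_add0 : left_id (Bop bop0_bounded) bop_add.
Proof. by move=> f; apply: bopP => x /=; rewrite add0r. Qed.
Fact bop_addN : left_inverse (Bop bop0_bounded) bop_opp bop_add.
Proof. by move=> f; apply: bopP => x /=; rewrite addNr. Qed.

HB.instance Definition _ :=
  GRing.isZmodule.Build bop bop_addA bop_addC bop_add0 bop_addN.

Fact bop_mulA : associative bop_mul.
Proof. by move=> f g h; apply: bopP. Qed.
Fact bop_mul1 : left_id (Bop bop1_bounded) bop_mul.
Proof. by move=> f; apply: bopP. Qed.
Fact bop_mulr1 : right_id (Bop bop1_bounded) bop_mul.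
Proof. by move=> f; apply: bopP. Qed.
Fact bop_mulDl : left_distributive bop_mul bop_add.
Proof. by move=> f g h; apply: bopP. Qed.
Fact bop_mulDr : right_distributive bop_mul bop_add.
Proof. by move=> f g h; apply: bopP => x /=; rewrite raddfD. Qed.

HB.instance Definition _ := GRing.Zmodule_isPzRing.Build bop
  bop_mulA bop_mul1 bop_mulr1 bop_mulDl bop_mulDr.

Fact bop_scaleA r s f : bop_scale r (bop_scale s f) = bop_scale (r * s) f.
Proof. by apply: bopP => x /=; rewrite scalerA rmorphM. Qed.
Fact bop_scale1 : left_id 1 bop_scale.
Proof. by move=> f; apply: bopP => x /=; rewrite scale1r. Qed.
Fact bop_scaleDr : right_distributive bop_scale +%R.
Proof. by move=> r f g; apply: bopP => x /=; rewrite scalerDr. Qed.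
Fact bop_scaleDl f : {morph bop_scale^~ f : r s / r + s}.
Proof. by move=> r s; apply: bopP => x /=; rewrite rmorphD scalerDl. Qed.

HB.instance Definition _ := GRing.Zmodule_isLmodule.Build R bop
  bop_scaleA bop_scale1 bop_scaleDr bop_scaleDl.

Implicit Types (f g h T : bop) (x y : H).

Lemma bop0E x : (0 : bop) x = 0. Proof. by []. Qed.
Lemma bop1E x : (1 : bop) x = x. Proof. by []. Qed.
Lemma bopDE f g x : (f + g) x = f x + g x. Proof. by []. Qed.
Lemma bopNE f x : (- f) x = - f x. Proof. by []. Qed.
Lemma bopBE f g x : (f - g) x = f x - g x. Proof. by []. Qed.
Lemma bopME f g x : (f * g) x = f (g x). Proof. by []. Qed.
Lemma bopZE r f x : (r *: f) x = r%:C *: f x. Proof. by []. Qed.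
Definition bopE := (bop0E, bop1E, bopDE, bopNE, bopBE, bopME, bopZE).

Lemma bopZAl r f g : (r *: f) * g = r *: (f * g). Proof. by apply: bopP. Qed.
Lemma bopZAr r f g : f * (r *: g) = r *: (f * g).
Proof. by apply: bopP => x; rewrite !bopE bopZ. Qed.

Lemma ker_functional_closed f y : closed_subspace [set x | rdot (f x) y = 0].
Proof.
split => [|x z /= hx hz|r x /= hx|u x hu ux /=].
- by rewrite /= bop0 rdot0l.
- by rewrite bopD rdotDl hx hz addr0.
- by rewrite bopZ rdotZl hx mulr0.
- exact: (hcvg_rdot (bop_cvg f ux) (hcvg_cst y)).
Qed.

(** A vector w orthogonal to the kernel of a nonzero real functional spans a complement of it, so a
    multiple of w represents the functional. *)
Lemma riesz f y : exists z, forall x, rdot (f x) y = rdot x z.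
Proof.
have [h|/existsNP[x0 hx0]] := pselect (forall x, rdot (f x) y = 0).
  by exists 0 => x; rewrite rdot0r.
have [p /= hp hort] := proj_exists x0 (ker_functional_closed f y).
set w := x0 - p in hort.
have fw : rdot (f w) y != 0 by rewrite bopB rdotDl rdotNl hp subr0; apply/eqP.
move: w hort fw => {p hp hx0 x0} w hort fw.
have w0 : rdot w w != 0.
  by apply: contra_neq fw => /rdot_eq0->; rewrite bop0 rdot0l.
(* The coefficient is the one that makes both sides agree at x = w. *)
exists ((rdot (f w) y / rdot w w)%:C *: w) => x; rewrite rdotZr.
have h : rdot (f (x - (rdot (f x) y / rdot (f w) y)%:C *: w)) y = 0.
  by rewrite bopB bopZ rdotDl rdotNl rdotZl divfK// subrr.
have := hort _ h; rewrite rdotDr rdotNr rdotZr (rdotC w x) => /eqP.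
rewrite subr_eq0 => /eqP ->; field; exact/andP.
Qed.

Lemma badj_exists f : exists g : bop, forall x y, rdot (f x) y = rdot x (g y).
Proof.
have /choice[g hg] := riesz f.
have rdot_inj z w : (forall x, rdot x z = rdot x w) -> z = w.
  move=> h; apply/eqP; rewrite -subr_eq0; apply/eqP/rdot_eq0.
  by rewrite rdotDr rdotNr h subrr.
have hga : is_adjoint f g by apply: is_adjointP; [exact: bop_linear|move=> x y; exact: hg].
suff gb : bounded_op g by exists (Bop gb) => x y; exact: hg.
split.
  move=> a u v; apply: rdot_inj => x.
  have L b p q : hdot b (a *: p + q) = Num.conj a * hdot b p + hdot b q :> R[i].
    by rewrite linearDr linearZr_LR.
  by congr complex.Re; rewrite -hga !L !hga.
have [C C0 hC] := bop_bound f; exists C => y.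
have [/eqP ->|gy0] := boolP (hnorm (g y) == 0); first by rewrite mulr_ge0 ?hnorm_ge0 ?ltW.
have gyp : 0 < hnorm (g y) by rewrite lt_def gy0 hnorm_ge0.
(* |g y|^2 equals rdot (f (g y)) y, so after Cauchy-Schwarz one factor |g y| cancels. *)
rewrite -(ler_pM2l gyp) -expr2 hnorm_sq -hg; apply: le_trans (rdot_le _ _) _.
by rewrite mulrA (mulrC _ C) ler_wpM2r ?hnorm_ge0.
Qed.

Definition badj f : bop := sval (cid (badj_exists f)).

Lemma badjP f x y : rdot (f x) y = rdot x (badj f y).
Proof. by rewrite /badj; case: cid. Qed.

Lemma badjPl f x y : rdot (badj f x) y = rdot x (f y).
Proof. by rewrite rdotC -badjP rdotC. Qed.

Lemma is_adjoint_badj f : is_adjoint f (badj f).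
Proof. by apply: is_adjointP; [exact: bop_linear|exact: badjP]. Qed.

Lemma rdot_inj x y : (forall z, rdot x z = rdot y z) -> x = y.
Proof.
move=> h; apply/eqP; rewrite -subr_eq0; apply/eqP/rdot_eq0.
by rewrite rdotDl rdotNl h subrr.
Qed.

Lemma badj_unique f g : (forall x y, rdot (f x) y = rdot x (g y)) -> badj f = g.
Proof.
by move=> h; apply: bopP => y; apply: rdot_inj => x; rewrite badjPl rdotC h rdotC.
Qed.

Lemma is_adjointE f (g : H -> H) : is_adjoint f g -> g = badj f.
Proof.
move=> fg; apply/funext => y; apply: rdot_inj => x.
by rewrite badjPl [RHS]rdotC (is_adjoint_rdot _ _ fg) rdotC.
Qed.

Lemma badjK : involutive badj.
Proof. by move=> f; apply: badj_unique => x y; rewrite badjPl. Qed.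

Lemma badjD f g : badj (f + g) = badj f + badj g.
Proof. by apply: badj_unique => x y; rewrite !bopE !rdotE !badjP. Qed.

Lemma badjN f : badj (- f) = - badj f.
Proof. by apply: badj_unique => x y; rewrite !bopE !rdotE !badjP. Qed.

Lemma badjB f g : badj (f - g) = badj f - badj g.
Proof. by rewrite badjD badjN. Qed.

Lemma badjM f g : badj (f * g) = badj g * badj f.
Proof. by apply: badj_unique => x y; rewrite !bopE !badjP. Qed.

Lemma badjZ r f : badj (r *: f) = r *: badj f.
Proof. by apply: badj_unique => x y; rewrite !bopE !rdotE !badjP. Qed.

Lemma badj1 : badj 1 = 1.
Proof. exact: badj_unique. Qed.

Lemma badj0 : badj 0 = 0.
Proof. by apply: badj_unique => x y; rewrite !rdotE. Qed.

Definition hermitian_op f := badj f = f.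

Lemma hermP f : hermitian_op f -> forall x y, rdot (f x) y = rdot x (f y).
Proof. by move=> hf x y; rewrite badjP hf. Qed.

Definition bnd f (C : R) := forall x, hnorm (f x) <= C * hnorm x.

Lemma bndD f g C D : bnd f C -> bnd g D -> bnd (f + g) (C + D).
Proof.
move=> hf hg x; rewrite mulrDl; apply: le_trans (ler_hnormD _ _) _; exact: lerD.
Qed.

Lemma bndM f g C D : 0 <= C -> bnd f C -> bnd g D -> bnd (f * g) (C * D).
Proof.
move=> C0 hf hg x; rewrite -mulrA; apply: le_trans (hf _) _; exact: ler_wpM2l.
Qed.

Lemma bndZ r f C : bnd f C -> bnd (r *: f) (`|r| * C).
Proof. by move=> hf x; rewrite bopZE hnormZ -mulrA ler_wpM2l. Qed.

Definition is_proj f := f * f = f /\ hermitian_op f.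

Lemma is_projP f : is_projection f <-> is_proj f.
Proof.
split=> [[_ ff /is_adjointE fa]|[ff fa]].
  by split; [exact: bopP|apply: bopP => x; rewrite -fa].
split; [exact: bop_bounded|by move=> x; rewrite /= -bopME ff|].
by rewrite -{2}fa; exact: is_adjoint_badj.
Qed.

Lemma proj_sq f x : is_proj f -> rdot (f x) x = hnorm (f x) ^+ 2.
Proof. by move=> [ff hf]; rewrite hnorm_sq [RHS](hermP hf) -(bopME f f) ff rdotC. Qed.

Lemma proj_bnd f : is_proj f -> bnd f 1.
Proof.
move=> pf x; rewrite mul1r; have [/eqP ->|f0] := boolP (hnorm (f x) == 0); first exact: hnorm_ge0.
have fp : 0 < hnorm (f x) by rewrite lt_def f0 hnorm_ge0.
by rewrite -(ler_pM2l fp) -expr2 -proj_sq// rdot_le.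
Qed.

Lemma proj_compl f : is_proj f -> is_proj (1 - f).
Proof.
move=> [ff hf]; split; last by rewrite /hermitian_op badjB badj1 hf.
by rewrite mulrBl mul1r mulrBr mulr1 ff subrr subr0.
Qed.

Lemma ker_closed f : closed_subspace [set x | f x = 0].
Proof.
split => [|x z /= hx hz|r x /= hx|u x hu ux /=]; first by rewrite /= bop0.
- by rewrite /= bopD hx hz addr0.
- by rewrite /= bopZ hx scaler0.
- by apply: (hcvg_unique (bop_cvg f ux)) => e e0; exists 0%N => n _ /=; rewrite hu subr0 hnorm0.
Qed.

(** Nearest points depend real-linearly on x; stability of S under ['i] keeps complex multiples of
    residuals orthogonal to S, which makes the projection complex linear. *)
Lemma proj_bop (S : set H) : closed_subspace S ->
  (forall x, S x -> S ('i *: x)) ->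
  exists e : bop, [/\ is_proj e, forall x, S (e x) & forall x, S x -> e x = x].
Proof.
move=> cS Si; have [S0 SD SZ _] := cS.
have /choice[e he] : forall x, exists p, S p /\ forall y, S y -> rdot (x - p) y = 0.
  by move=> x; have [p Sp hp] := proj_exists x cS; exists p.
have SC (a : R[i]) x : S x -> S (a *: x).
  move=> Sx; rewrite [a]complexE scalerDl; apply: SD; first exact: SZ.
  by rewrite mulrC -scalerA; apply: SZ; exact: Si.
have eS x : S (e x) by case: (he x).
have eort x y : S y -> rdot (x - e x) y = 0 by case: (he x) => _; apply.
have eortC (a : R[i]) x y : S y -> rdot (a *: (x - e x)) y = 0.
  move=> Sy; rewrite [a]complexE scalerDl rdotDl rdotZl eort// mulr0 add0r.
  by rewrite mulrC -scalerA rdotZl rdot_iZl eort ?oppr0 ?mulr0//; exact: Si.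
have elin : linear e.
  move=> a x y; apply: (proj_unique (x := a *: x + y) cS) => //.
  - by move=> z; exact: eort.
  - by apply: SD => //; exact: SC.
  - move=> z Sz; rewrite opprD addrACA -scalerBr rdotDl eortC// eort// addr0 //.
(* This identity gives the bound 1 and, its right side being symmetric in x and y,
   self-adjointness. *)
have ecs x y : rdot (e x) y = rdot (e x) (e y).
  have := eort y _ (eS x); rewrite rdotC rdotDr rdotNr => /eqP.
  by rewrite subr_eq0 => /eqP.
have eb : bounded_op e.
  split => //; exists 1 => x; rewrite mul1r.
  have [/eqP ->|f0] := boolP (hnorm (e x) == 0); first exact: hnorm_ge0.
  have fp : 0 < hnorm (e x) by rewrite lt_def f0 hnorm_ge0.
  by rewrite -(ler_pM2l fp) -expr2 hnorm_sq -ecs rdot_le.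
have eid x : S x -> e x = x.
  move=> Sx; apply: (proj_unique (x := x) cS) => //; first by move=> y; exact: eort.
  by move=> y _; rewrite subrr rdot0l.
exists (Bop eb); split => //; split.
  by apply: bopP => x /=; rewrite eid.
by apply: badj_unique => x y /=; rewrite ecs rdotC -ecs rdotC.
Qed.

End BoundedOperators.

(** * Square roots and spectral projections *)

Section SpectralProjections.
Variables (R : realType) (H : hilbertType R).
Local Notation bop := (bop H).
Implicit Types (T S W E g X : bop).

Lemma hcvg_hnorm_le (u : nat -> H) x C : hcvg u x -> (forall n, hnorm (u n) <= C) ->
  hnorm x <= C.
Proof.
move=> ux uC; apply/ler_addgt0Pl => e /ux[N hN]; have {}hN := hN N (leqnn N).
apply: le_trans (ler_hnormB x (u N)) _; rewrite hnorm_subC lerD// ltW//.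
Qed.

Lemma hcvgZ (u : nat -> H) x (a : R[i]) : hcvg u x -> hcvg (fun n => a *: u n) (a *: x).
Proof.
move=> ux.
apply: (hcvg_bounded (f := fun y => a *: y) (C := `|complex.Re a| + `|complex.Im a|)) => // y z.
rewrite -scalerBr [a in a *: _]complexE scalerDl; apply: le_trans (ler_hnormD _ _) _.
by rewrite (mulrC 'i) -scalerA !hnormZ !hnormZi -mulrDl.
Qed.

Lemma bop_strong_limit (Y : nat -> bop) C : (forall n, bnd (Y n) C) ->
  (forall u, exists l, hcvg (fun n => Y n u) l) ->
  exists2 L : bop, bnd L C & forall u, hcvg (fun n => Y n u) (L u).
Proof.
move=> YC /choice[L hL].
have LC u : hnorm (L u) <= C * hnorm u by apply: hcvg_hnorm_le (hL u) _ => n; exact: YC.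
have Ll : linear L.
  move=> a u v; apply: (hcvg_unique (hL _)).
  have := hcvgD (hcvgZ a (hL u)) (hL v).
  by congr hcvg; apply/funext => n; rewrite bopD bopZ.
by exists (Bop (conj Ll (ex_intro _ C LC) : bounded_op L)).
Qed.

Lemma hermitian_limit (Y : nat -> bop) (L : bop) : (forall n, hermitian_op (Y n)) ->
  (forall u, hcvg (fun n => Y n u) (L u)) -> hermitian_op L.
Proof.
move=> hY hL; apply: badj_unique => x y; rewrite [RHS]rdotC.
have := cvg_rdotl (z := x) (hL y); have := cvg_rdotl (z := y) (hL x).
under eq_fun do rewrite (hermP (hY _)) rdotC.
exact: cvg_unique.
Qed.

Lemma sqr_sub_comm (A : pzRingType) (a b : A) : a * b = b * a ->
  a * a - b * b = (a - b) * (a + b).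
Proof. by move=> ab; rewrite mulrBl !mulrDr ab opprD addrA addrK. Qed.

(** Evaluate the positive form of T at x - C^-1 T x, where the quadratic term is at most C^-1 |T
    x|^2. *)
Lemma pos_sq_bound T C x : 0 < C -> hermitian_op T -> (forall u, 0 <= rdot (T u) u) -> bnd T C ->
  hnorm (T x) ^+ 2 <= C * rdot (T x) x.
Proof.
move=> C0 hT pT TC; have := pT (x - C^-1%:C *: T x).
have h1 : rdot (T (T x)) (T x) <= C * hnorm (T x) ^+ 2.
  by apply: le_trans (rdot_le _ _) _; rewrite expr2 mulrA ler_wpM2r ?hnorm_ge0.
rewrite bopB bopZ !rdotE (hermP hT (T x) x) -hnorm_sq => h2.
have h3 : C^-1 * (C^-1 * rdot (T (T x)) (T x)) <= C^-1 * hnorm (T x) ^+ 2.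
  by rewrite ler_pM2l ?invr_gt0// ler_pdivrMl.
rewrite -ler_pdivrMl//; lra.
Qed.

Lemma pos_ker T x : hermitian_op T -> (forall u, 0 <= rdot (T u) u) ->
  rdot (T x) x = 0 -> T x = 0.
Proof.
move=> hT pT Tx; have [C C0 TC] := bop_bound T.
have := pos_sq_bound x C0 hT pT TC; rewrite Tx mulr0 => h.
by apply/hnorm_eq0/eqP; rewrite -sqrf_eq0 eq_le h sqr_ge0.
Qed.

(** In the expansion of |y - C^-1 T y|^2 the square term is absorbed by half of the cross term,
    thanks to [pos_sq_bound]. *)
Lemma contraction_of_pos T C : 0 < C -> hermitian_op T -> (forall u, 0 <= rdot (T u) u) ->
  bnd T C -> bnd (1 - C^-1 *: T) 1.
Proof.
move=> C0 hT pT TC y; rewrite mul1r hnorm_le !bopE !rdotE (rdotC y (T y)) -(hnorm_sq (T y)).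
have h1 := pos_sq_bound y C0 hT pT TC.
have h2 : C^-1 * (C^-1 * hnorm (T y) ^+ 2) <= C^-1 * rdot (T y) y.
  by rewrite ler_pM2l ?invr_gt0// ler_pdivrMl.
have h3 : 0 <= C^-1 * rdot (T y) y by rewrite mulr_ge0 ?invr_ge0 ?pT// ltW.
lra.
Qed.

(** * Iteration for the square root of a positive operator *)

Section SqrtIteration.
Variable X : bop.
Hypotheses (X1 : bnd X 1) (hX : hermitian_op X).

(* The iterates and their increments are dominated in norm by those of the
   same iteration for X = 1, which increases to its fixed point 1. *)
Fixpoint sqrt_iter n : bop :=
  if n is n'.+1 then 2^-1 *: (X + sqrt_iter n' * sqrt_iter n') else 0.

Fixpoint sqrt_dom n : R :=
  if n is n'.+1 then 2^-1 * (1 + sqrt_dom n' * sqrt_dom n') else 0.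

Lemma sqrt_dom01 n : 0 <= sqrt_dom n <= 1.
Proof. by elim: n => [|n /andP[h0 h1]] /=; [lra|nra]. Qed.

Lemma sqrt_dom_leS n : sqrt_dom n <= sqrt_dom n.+1.
Proof. by have /andP[] := sqrt_dom01 n => /=; move: (sqrt_dom n) => a; nra. Qed.

Lemma comm_scale (g h : bop) r : GRing.comm g h -> GRing.comm g (r *: h).
Proof. by move=> gh; rewrite /GRing.comm bopZAr bopZAl gh. Qed.

Lemma sqrt_iter_comm g n : GRing.comm g X -> GRing.comm g (sqrt_iter n).
Proof.
move=> gX; elim: n => [|n IH] /=; first exact: commr0.
by apply: comm_scale; apply: commrD => //; exact: commrM.
Qed.

Lemma sqrt_iter_comm2 m n : GRing.comm (sqrt_iter m) (sqrt_iter n).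
Proof. by apply: sqrt_iter_comm; apply/commr_sym/sqrt_iter_comm. Qed.

Lemma sqrt_iter_herm n : hermitian_op (sqrt_iter n).
Proof.
elim: n => [|n IH]; first exact: badj0.
by rewrite /hermitian_op /= badjZ badjD badjM hX IH.
Qed.

Lemma bnd0 : bnd (0 : bop) 0.
Proof. by move=> x; rewrite bop0E hnorm0 mul0r. Qed.

Lemma sqrt_iter_bnd n : bnd (sqrt_iter n) (sqrt_dom n).
Proof.
elim: n => [|n IH] /=; first exact: bnd0.
have /andP[d0 _] := sqrt_dom01 n.
by rewrite -[2^-1 in X in bnd _ X]ger0_norm ?invr_ge0//; apply/bndZ/bndD/bndM.
Qed.

(** The iterates commute, so an increment of squares factors as difference times sum; the dominating
    reals factor in the same way. *)
Lemma sqrt_iter_bndS n :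
  bnd (sqrt_iter n.+1 - sqrt_iter n) (sqrt_dom n.+1 - sqrt_dom n).
Proof.
elim: n => [|n IH].
  by rewrite !subr0; exact: (sqrt_iter_bnd 1).
have -> : sqrt_iter n.+2 - sqrt_iter n.+1 =
    2^-1 *: ((sqrt_iter n.+1 - sqrt_iter n) * (sqrt_iter n.+1 + sqrt_iter n)).
  rewrite -sqr_sub_comm; last exact: sqrt_iter_comm2.
  rewrite [in LHS]/= -[2^-1 *: (X + sqrt_iter n * _)]/(sqrt_iter n.+1) -scalerBr.
  by rewrite opprD addrACA subrr add0r.
have -> : sqrt_dom n.+2 - sqrt_dom n.+1 =
    `|2^-1| * ((sqrt_dom n.+1 - sqrt_dom n) * (sqrt_dom n.+1 + sqrt_dom n)).
  by rewrite ger0_norm ?invr_ge0//=; ring.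
apply: bndZ; apply: bndM => //; first by rewrite subr_ge0 sqrt_dom_leS.
by apply: bndD; exact: sqrt_iter_bnd.
Qed.

Lemma sqrt_iter_bndB n k :
  bnd (sqrt_iter (n + k) - sqrt_iter n) (sqrt_dom (n + k) - sqrt_dom n).
Proof.
elim: k => [|k IH]; first by rewrite addn0 !subrr; exact: bnd0.
have := bndD (sqrt_iter_bndS (n + k)) IH.
by rewrite addnS !addrA !subrK.
Qed.

(** The fixed-point equation amounts to (1 - Y)^2 = 1 - X. As [sqrt_dom] is monotone and bounded,
    domination of the increments makes the iterates strongly Cauchy. *)
Lemma sqrt_iter_limit : exists Y, [/\ bnd Y 1, hermitian_op Y,
  forall g, GRing.comm g X -> GRing.comm g Y & Y = 2^-1 *: (X + Y * Y)].
Proof.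
have dom1 n : bnd (sqrt_iter n) 1.
  move=> u; apply: le_trans (sqrt_iter_bnd n u) _.
  by rewrite ler_wpM2r ?hnorm_ge0//; case/andP: (sqrt_dom01 n).
have [|Y Y1 hY] := bop_strong_limit dom1.
  move=> u; apply: hilbert_cvg => e e0.
  have dcv : cvgn sqrt_dom.
    apply: nondecreasing_is_cvgn; last by exists 1 => _ [n _ <-]; case/andP: (sqrt_dom01 n).
    by apply/nondecreasing_seqP; exact: sqrt_dom_leS.
  (* The bound e / 2 below is twice e / 4, once for each distance to the limit of [sqrt_dom]; the +
     1 covers u = 0. *)
  have u1 : 0 < 4 * (hnorm u + 1) by rewrite mulr_gt0// ltr_wpDl ?hnorm_ge0.
  have [N _ hN] := (cvgrPdist_lt _ _).1 dcv _ (divr_gt0 e0 u1).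
  exists N => m n Nm Nn.
  have half k : (N <= k)%N -> hnorm (sqrt_iter k u - sqrt_iter N u) < e / 2.
    move=> Nk; have := sqrt_iter_bndB N (k - N) u; rewrite subnKC//.
    rewrite bopBE => h; apply: le_lt_trans h _.
    have := hN _ Nk; have := hN _ (leqnn N); rewrite !ltr_pdivlMr//= => hn hk.
    have u0 := hnorm_ge0 u; have lN := ler_norm (limn sqrt_dom - sqrt_dom N).
    have := ler_norm (- (limn sqrt_dom - sqrt_dom k)); rewrite normrN => lk.
    move: hn hk lN lk (normr_ge0 (limn sqrt_dom - sqrt_dom N)) (normr_ge0 (limn sqrt_dom - sqrt_dom k)).
    move: `|limn _ - sqrt_dom N| `|limn _ - sqrt_dom k| => p q hn hk lN lk p0 q0.
    have : (sqrt_dom k - sqrt_dom N) * hnorm u <= (p + q) * hnorm u by rewrite ler_wpM2r//; lra.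
    by nra.
  have := half _ Nm; have := half _ Nn.
  have := ler_hnorm_dist (sqrt_iter m u) (sqrt_iter N u) (sqrt_iter n u).
  rewrite (hnorm_subC (sqrt_iter N u)); lra.
exists Y; split => //.
- exact: hermitian_limit sqrt_iter_herm hY.
- move=> g gX; apply: bopP => u; rewrite !bopE.
  apply: (hcvg_unique (bop_cvg g (hY u))); rewrite /comp.
  have := hY (g u); congr hcvg; apply/funext => n.
  by rewrite -!bopME (sqrt_iter_comm n gX).
- apply: bopP => u.
  have h1 : hcvg (fun n => sqrt_iter n.+1 u) (Y u).
    by move=> e /(hY u)[N hN]; exists N => n /leqW; exact: hN.
  apply: (hcvg_unique h1); rewrite /=.
  apply: hcvgZ; apply: hcvgD; first exact: hcvg_cst.
  move=> e e0; have e2 : 0 < e / 2 by rewrite divr_gt0.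
  have [N hN] := hY u _ e2; have [M hM] := hY (Y u) _ e2.
  exists (maxn N M) => n; rewrite geq_max => /andP[/hN h2 /hM h3].
  have := ler_hnorm_dist (sqrt_iter n (sqrt_iter n u)) (sqrt_iter n (Y u)) (Y (Y u)).
  have := dom1 n (sqrt_iter n u - Y u); rewrite bopB mul1r; lra.
Qed.

End SqrtIteration.

(** The iteration is applied to the contraction X = 1 - C^-1 T: then (1 - Y)^2 = C^-1 T, the norm
    bound on Y makes 1 - Y positive, and S is 1 - Y rescaled by the root of C. *)
Lemma sqrt_exists T : hermitian_op T -> (forall u, 0 <= rdot (T u) u) ->
  exists S, [/\ hermitian_op S, forall u, 0 <= rdot (S u) u, S * S = T &
    forall g, GRing.comm g T -> GRing.comm g S].
Proof.
move=> hT pT; have [C C0 TC] := bop_bound T.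
have hX : hermitian_op (1 - C^-1 *: T) by rewrite /hermitian_op badjB badj1 badjZ hT.
have [Y [Y1 hY cY eY]] := sqrt_iter_limit (contraction_of_pos C0 hT pT TC) hX.
exists (Num.sqrt C *: (1 - Y)); split.
- by rewrite /hermitian_op badjZ badjB badj1 hY.
- move=> u; rewrite !bopE rdotZl mulr_ge0 ?sqrtr_ge0// rdotDl rdotNl subr_ge0.
  apply: le_trans (rdot_le _ _) _; rewrite -hnorm_sq expr2 ler_wpM2r ?hnorm_ge0//.
  by have := Y1 u; rewrite mul1r.
- rewrite bopZAl bopZAr scalerA -expr2 sqr_sqrtr ?ltW// mulrBl mul1r mulrBr mulr1.
  have e2 : Y + Y = 1 - C^-1 *: T + Y * Y.
    by rewrite -{1 2}[Y]scale1r -scalerDl eY scalerA; rewrite (_ : (1 + 1) * 2^-1 = 1) ?scale1r -?eY//; field.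
  have -> : 1 - Y - (Y - Y * Y) = C^-1 *: T.
    rewrite opprB addrACA -opprD e2 opprD opprB addrACA subrr addr0.
    by rewrite addrC subrK.
  by rewrite scalerA divff ?gt_eqF// scale1r.
- move=> g gT; apply: comm_scale; apply: commrB; first exact: commr1.
  by apply: cY; apply: commrB; [exact: commr1|exact: comm_scale].
Qed.

(** With N = T - l and S = |N|, E projects on the kernel of S + N: there N = - S, and N = S on the
    complement. The last clause puts the eigenvalue l into the range of E, which will make the
    family right-continuous. *)
Lemma spectral_proj_exists T (l : R) : hermitian_op T -> exists E, [/\ is_proj E,
  forall g, GRing.comm g T -> GRing.comm g E,
  forall u, E u = u -> rdot (T u) u <= l * rdot u u,
  forall u, E u = 0 -> l * rdot u u <= rdot (T u) u &
  forall u, E u = 0 -> rdot (T u) u = l * rdot u u -> u = 0].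
Proof.
move=> hT; pose N : bop := T - l *: (1 : bop).
have NE u : N u = T u - l%:C *: u by [].
have hN : hermitian_op N by rewrite /hermitian_op badjB badjZ badj1 hT.
have cN g : GRing.comm g T -> GRing.comm g N.
  by move=> gT; apply: commrB => //; apply: comm_scale; exact: commr1.
clearbody N; have [||S [hS pS SS cS]] := @sqrt_exists (N * N).
- by rewrite /hermitian_op badjM hN.
- by move=> u; rewrite bopME (hermP hN) rdot_ge0.
have cNS g : GRing.comm g T -> GRing.comm g S.
  by move=> gT; apply: cS; apply: commrM; exact: cN.
have SN : S * N = N * S by apply/esym/cNS/commr_sym/cN.
have [|E [pE Eker kerE]] := proj_bop (ker_closed (S + N)).
  move=> x hx; suff : (S + N) ('i *: x) = 0 by [].
  by rewrite bopZ [(S + N) x]hx scaler0.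
(* An operator commuting with T preserves the kernel of S + N, and so does its adjoint because T is
   self-adjoint; hence both commute with E. *)
have cE g : GRing.comm g T -> GRing.comm g E.
  have half h : GRing.comm h T -> h * E = E * (h * E).
    move=> hT'; apply: bopP => u; rewrite !bopME; apply/esym/kerE.
    suff : (S + N) (h (E u)) = 0 by [].
    have : (S + N) * h = h * (S + N) by apply/esym/commrD; [exact: cNS|exact: cN].
    by move/(congr1 (fun k : bop => k (E u))); rewrite !bopME => ->; rewrite [(S + N) _]Eker bop0.
  move=> gT; have agT : GRing.comm (badj g) T.
    by rewrite /GRing.comm -[in LHS]hT -badjM -gT badjM hT.
  have [_ hE] := pE.
  have := congr1 (@badj R H) (half _ agT); rewrite !badjM badjK hE => h.
  by rewrite /GRing.comm (half _ gT) mulrA -h.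
have ran u : E u = u -> N u = - S u.
  move=> Eu; have : (S + N) u = 0 by rewrite -Eu; exact: Eker.
  by rewrite bopDE addrC => /eqP; rewrite addr_eq0 => /eqP.
have kerS u : E u = 0 -> N u = S u.
  move=> Eu; have : E (S u - N u) = S u - N u.
    apply: kerE; suff : (S + N) ((S - N) u) = 0 by [].
    rewrite -bopME; suff -> : (S + N) * (S - N) = 0 by [].
    by rewrite mulrDl !mulrBr SN SS addrA subrK subrr.
  have cT : GRing.comm T (S - N).
    by apply: commrB; [apply: cNS|apply: cN]; exact: commr_refl.
  have := cE _ (commr_sym cT); rewrite -bopBE => cE'.
  rewrite -bopME -cE' bopME Eu bop0 => /esym/eqP.
  by rewrite bopBE subr_eq0 => /eqP.
exists E; split => //.
- move=> u /ran; rewrite NE => h; rewrite -subr_ge0.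
  have := pS u; have := congr1 (fun v => rdot v u) h; rewrite /= !rdotE; lra.
- move=> u /kerS; rewrite NE => h; rewrite -subr_ge0.
  have := pS u; have := congr1 (fun v => rdot v u) h; rewrite /= !rdotE; lra.
- move=> u Eu Tu; have h := kerS _ Eu.
  have : rdot (S u) u = 0 by rewrite -h NE !rdotE Tu subrr.
  move=> /(pos_ker hS pS) Su.
  rewrite -Eu kerE//; suff : (S + N) u = 0 by [].
  by rewrite bopDE h Su addr0.
Qed.

End SpectralProjections.

(** * Stieltjes integrals *)

Section Stieltjes.
Variable R : realType.

(** On a subdivision into n + 1 equal pieces the bounds telescope to (b - a)(F b - F a)/(n + 1),
    which is arbitrarily small. *)
Lemma increment_sq_const (h F : R -> R) (a b : R) : a <= b ->
  (forall s t, a <= s -> s <= t -> t <= b -> `|h t - h s| <= (t - s) * (F t - F s)) ->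
  h b = h a.
Proof.
move=> ab hF.
have step n : `|h b - h a| <= (b - a) / n.+1%:R * (F b - F a).
  pose d := (b - a) / n.+1%:R; pose x i := a + i%:R * d.
  have d0 : 0 <= d by rewrite divr_ge0// subr_ge0.
  have xb : x n.+1 = b by rewrite /x /d mulrC divfK ?pnatr_eq0//; ring.
  have x_le i j : (i <= j)%N -> x i <= x j by move=> ij; rewrite lerD2l ler_wpM2r ?ler_nat.
  have x0 : x 0%N = a by rewrite /x mul0r addr0.
  have xS i : x i.+1 - x i = d by rewrite /x -natr1; ring.
  suff H i : (i <= n.+1)%N -> `|h (x i) - h a| <= d * (F (x i) - F a).
    by have := H _ (leqnn _); rewrite xb.
  elim: i => [_|i IH ilt]; first by rewrite x0 !subrr normr0 mulr0.
  have xia : a <= x i by rewrite -x0 x_le.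
  have := hF _ _ xia (x_le _ _ (leqnSn i)); rewrite -[X in _ <= X -> _]xb => /(_ (x_le _ _ ilt)).
  rewrite xS => h1; have := IH (ltnW ilt); have := ler_distD (h (x i)) (h (x i.+1)) (h a).
  lra.
apply/eqP; rewrite -subr_eq0 -normr_le0 leNgt; apply/negP => h0.
have K0 : 0 < `|(b - a) * (F b - F a)| + 1 by rewrite ltr_wpDl.
have := archi_boundP (ltW (divr_gt0 K0 h0)); set n := Num.bound _; rewrite ltr_pdivrMr// => hn.
have n0 : 0 < n.+1%:R :> R by rewrite ltr0Sn.
have := step n; rewrite mulrAC ler_pdivlMr// -natr1 => h1.
have := ler_norm ((b - a) * (F b - F a)); rewrite mulrDr mulr1 in h1.
by move: (ltW h0) h1 hn; move: `|h b - h a| (n%:R : R) => c m; lra.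
Qed.

Variables (F : cumulative R R) (a b : R).
Hypotheses (ab : a <= b) (Fa : forall x, x <= a -> F x = F a)
  (Fb : forall x, b <= x -> F x = F b).
Let mu := lebesgue_stieltjes_measure F.

Lemma stieltjes_ocitv (s t : R) : s <= t -> mu `]s, t]%classic = (F t - F s)%:E.
Proof.
move=> st; rewrite /mu /lebesgue_stieltjes_measure /measure_extension.
rewrite measurable_mu_extE/=; last exact: is_ocitv.
by rewrite wlength_itv_bnd.
Qed.

Let D : set (measurableTypeR R) := `]a, b]%classic.

(** The complement of ]a, b] is exhausted by bounded half-open intervals, the sets on which
    [stieltjes_ocitv] evaluates the measure. *)
Let D_outer k : set (measurableTypeR R) :=
  `](a - k%:R), a]%classic `|` `]b, (b + k%:R)]%classic.

Let mocitv (s t : R) : measurable (`]s, t]%classic : set (measurableTypeR R)).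
Proof. exact: measurable_itv. Qed.

Lemma stieltjes_null : mu (~` D) = 0%E.
Proof.
have mD : measurable (~` D) by apply: measurableC; exact: mocitv.
apply: measure_negligible => //.
have sub : ~` D `<=` \bigcup_k D_outer k.
  move=> x; rewrite /D /= in_itv /= => /negP; rewrite negb_and -leNgt -ltNge => /orP[xa|bx].
    exists (Num.bound (a - x)) => //; left; rewrite /= in_itv /= xa andbT.
    have := archi_boundP (x := a - x); rewrite subr_ge0 => /(_ xa).
    by rewrite ltrBlDr -ltrBlDl.
  exists (Num.bound (x - b)) => //; right; rewrite /= in_itv /= bx /=.
  have := archi_boundP (x := x - b); rewrite subr_ge0 => /(_ (ltW bx)).
  by rewrite ltrBlDr addrC => /ltW.
apply: negligibleS sub _; apply: negligible_bigcup => k; apply: negligibleU.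
  apply/negligibleP; first exact: mocitv.
  apply: (eq_trans (stieltjes_ocitv _)); first by rewrite lerBlDr lerDl.
  by rewrite Fa ?subrr// lerBlDr lerDl.
apply/negligibleP; first exact: mocitv.
apply: (eq_trans (stieltjes_ocitv _)); first by rewrite lerDl.
by rewrite Fb ?subrr// lerDl.
Qed.

Let bounded_integrable (g : R -> R) (s t : R) : s <= t ->
  measurable_fun (setT : set (measurableTypeR R)) g ->
  (exists M, forall x, s < x -> x <= t -> `|g x| <= M) ->
  mu.-integrable (`]s, t]%classic : set (measurableTypeR R)) (EFin \o g).
Proof.
move=> st mg [M gM]; apply: measurable_bounded_integrable => //.
- by apply: (@eq_ind _ _ (fun y => (y < +oo)%E) _ _ (esym (stieltjes_ocitv st))); rewrite ltry.
- exact: measurable_funTS.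
- exists M; split; first exact: num_real.
  move=> K MK x /=; rewrite in_itv /= => /andP[sx xt].
  by apply: le_trans (ltW MK); exact: gM.
Qed.

Let setTD : setT `\` ~` D = D. Proof. by rewrite setTD setCK. Qed.

Let mid : measurable_fun (setT : set (measurableTypeR R)) (id : R -> R).
Proof. exact: measurable_id. Qed.

Let norm_bound (s t x : R) : s < x -> x <= t -> `|x| <= `|s| + `|t|.
Proof.
move=> sx xt; rewrite ler_norml; apply/andP; split.
  have := ler_norm (- s); rewrite normrN; have := normr_ge0 t; lra.
have := ler_norm t; have := normr_ge0 s; lra.
Qed.

Lemma stieltjes_sq_fin : (\int[mu]_(l in [set: R]) (l ^+ 2)%:E < +oo)%E.
Proof.
have mN : measurable (~` D) by apply: measurableC; exact: mocitv.
have m2 : measurable_fun (setT : set (measurableTypeR R)) (fun l : R => l ^+ 2).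
  exact: measurable_funX.
have m2E : measurable_fun (setT : set (measurableTypeR R)) (EFin \o (fun l : R => l ^+ 2)).
  exact/measurable_EFinP.
have i2 : mu.-integrable setT (EFin \o (fun l : R => l ^+ 2)).
  apply/(negligible_integrable mN measurableT m2E stieltjes_null).
  rewrite setTD; apply: bounded_integrable => //.
  exists ((`|a| + `|b|) ^+ 2) => x ax xb; rewrite normrX ler_sqr ?nnegrE ?addr_ge0//.
  exact: norm_bound.
have /integrableP[_] := i2; apply: le_lt_trans.
apply: ge0_le_integral => //=.
- by move=> x _; rewrite lee_fin sqr_ge0.
- exact/measurable_EFinP/measurableT_comp.
- by move=> x _; rewrite lee_fin ler_norm.
Qed.

Variable G : R -> R.
Hypothesis GF : forall s t, s <= t ->
  s * (F t - F s) <= G t - G s /\ G t - G s <= t * (F t - F s).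

(** The integral of l over ]a, t], as a function of t, obeys the same two-sided increment bounds as
    G, so [increment_sq_const] applies to the difference. For a spectral family G will be t |-> <T
    E_t u, u>. *)
Lemma stieltjes_integral : (\int[mu]_(l in [set: R]) l)%R = G b - G a.
Proof.
have mN : measurable (~` D) by apply: measurableC; exact: mocitv.
have int_id s t : s <= t -> mu.-integrable (`]s, t]%classic : set (measurableTypeR R)) (EFin \o id).
  by move=> st; apply: bounded_integrable => //; exists (`|s| + `|t|); exact: norm_bound.
have iT : mu.-integrable setT (EFin \o (id : R -> R)).
  apply/(negligible_integrable mN measurableT _ stieltjes_null).
    exact/measurable_EFinP.
  by rewrite setTD; exact: int_id.
have -> : (\int[mu]_(l in [set: R]) l)%R = (\int[mu]_(l in D) l)%R.
  rewrite /Rintegral; congr fine.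
  by rewrite (negligible_integral mN measurableT iT stieltjes_null) setTD.
pose I t := (\int[mu]_(l in (`]a, t]%classic : set (measurableTypeR R))) l)%R.
have IB s t : a <= s -> s <= t ->
    I t - I s = (\int[mu]_(l in (`]s, t]%classic : set (measurableTypeR R))) l)%R.
  move=> as_ st; rewrite /I.
  have e : (`]a, t]%classic : set (measurableTypeR R)) = `]a, s]%classic `|` `]s, t]%classic.
    by rewrite -itv_bndbnd_setU// bnd_simp.
  rewrite e Rintegral_setU//.
  - by rewrite addrAC subrr add0r.
  - by rewrite -e; apply: int_id; exact: (le_trans as_ st).
  - apply/disj_setPS => x [] /=; rewrite !in_itv /= => /andP[_ xs] /andP[sx _].
    by move: (lt_le_trans sx xs); rewrite ltxx.
have bnds s t : a <= s -> s <= t -> s * (F t - F s) <= I t - I s /\ I t - I s <= t * (F t - F s).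
  move=> as_ st; rewrite IB//.
  have cstE c : c * (F t - F s) = (\int[mu]_(l in (`]s, t]%classic : set (measurableTypeR R))) c)%R.
    rewrite Rintegral_cst; last exact: mocitv.
    by congr (_ * _); exact: (congr1 fine (esym (stieltjes_ocitv st))).
  have icst c : mu.-integrable (`]s, t]%classic : set (measurableTypeR R)) (EFin \o cst c).
    by apply: bounded_integrable => //; exists `|c|.
  split; rewrite cstE; apply: le_Rintegral => //; try exact: mocitv; try exact: int_id; try exact: icst.
  - by move=> x /=; rewrite in_itv /= => /andP[/ltW].
  - by move=> x /=; rewrite in_itv /= => /andP[].
have := @increment_sq_const (fun t => I t - (G t - G a)) F a b ab.
rewrite /I -/D (_ : `]a, a]%classic = set0) ?Rintegral_set0; last first.
  by rewrite set_itv_ge// bnd_simp ltxx.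
rewrite subrr subrr => h; apply/eqP; rewrite -subr_eq0; apply/eqP; apply: h.
move=> s t as_ st tb; have [h1 h2] := bnds _ _ as_ st; have [h3 h4] := GF st.
rewrite -/(I t) -/(I s) ler_norml; apply/andP; split; lra.
Qed.

End Stieltjes.

(** * Spectral resolution of a bounded positive operator *)

Section SpectralFamily.
Variables (R : realType) (H : hilbertType R).
Local Notation bop := (bop H).
Variables (T : bop) (E : R -> bop).
Hypotheses (hT : hermitian_op T)
  (pE : forall l, is_proj (E l))
  (cE : forall l g, GRing.comm g T -> GRing.comm g (E l))
  (Ele : forall l u, E l u = u -> rdot (T u) u <= l * rdot u u)
  (Ege : forall l u, E l u = 0 -> l * rdot u u <= rdot (T u) u)
  (Eeq : forall l u, E l u = 0 -> rdot (T u) u = l * rdot u u -> u = 0).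

Lemma spectral_comm l : GRing.comm T (E l).
Proof. exact/cE/commr_refl. Qed.

Lemma spectral_comm2 l m : GRing.comm (E l) (E m).
Proof. exact/cE/commr_sym/spectral_comm. Qed.

Let Eid l u : E l (E l u) = E l u.
Proof. by rewrite -bopME; case: (pE l) => ->. Qed.

(** The projections are chosen independently for each l, so monotonicity comes from the form
    inequalities: a vector w in the range of E_l killed by E_m satisfies m |w|^2 <= <T w, w> <= l
    |w|^2, hence vanishes when l < m. *)
Lemma spectral_mono l m : l <= m -> E m * E l = E l.
Proof.
rewrite le_eqVlt => /orP[/eqP <-|lm]; first by case: (pE l).
apply: bopP => u; rewrite bopME.
apply/eqP; rewrite eq_sym -subr_eq0; apply/eqP; set w := E l u - _.
have wl : E l w = w.
  by rewrite /w bopB Eid -(bopME (E l) (E m)) spectral_comm2 bopME Eid.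
have wm : E m w = 0 by rewrite /w bopB Eid subrr.
have := Ele wl; have := Ege wm => h1 h2.
have := rdot_ge0 w; rewrite le_eqVlt => /orP[/eqP/esym/rdot_eq0//|w0].
by have := le_trans h1 h2; rewrite ler_pM2r// leNgt lm.
Qed.

Lemma spectral_monoC l m : l <= m -> E l * E m = E l.
Proof. by move=> lm; rewrite spectral_comm2 spectral_mono. Qed.

Lemma spectral_lt0 l : (forall u, 0 <= rdot (T u) u) -> l < 0 -> E l = 0.
Proof.
move=> pT l0; apply: bopP => u; have := Ele (Eid l u).
have := pT (E l u) => h1 h2; have := le_trans h1 h2.
rewrite nmulr_rge0// => h3; apply: rdot_eq0; apply/eqP.
by rewrite eq_le h3 rdot_ge0.
Qed.

Lemma spectral_gt l C : bnd T C -> C < l -> E l = 1.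
Proof.
move=> TC Cl; apply: bopP => u; apply/eqP; rewrite eq_sym -subr_eq0; apply/eqP.
set w := _ - _; have w0 : E l w = 0 by rewrite /w bopB Eid subrr.
have h1 : rdot (T w) w <= C * rdot w w.
  by apply: le_trans (rdot_le _ _) _; rewrite -hnorm_sq expr2 mulrA ler_wpM2r ?hnorm_ge0.
have := rdot_ge0 w; rewrite le_eqVlt => /orP[/eqP/esym/rdot_eq0//|wp].
by have := le_trans (Ege w0) h1; rewrite ler_pM2r// leNgt Cl.
Qed.

Lemma spectral_sq l u : rdot (E l u) u = hnorm (E l u) ^+ 2.
Proof. exact: proj_sq. Qed.

Lemma spectral_dist l m u : l <= m ->
  hnorm (E m u - E l u) ^+ 2 = rdot (E m u) u - rdot (E l u) u.
Proof.
move=> lm; have [_ hm] := pE m; have [_ hl] := pE l.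
rewrite hnorm_sq !rdotE (rdotC (E l u) (E m u)) opprK -!hnorm_sq -!spectral_sq.
have -> : rdot (E m u) (E l u) = rdot (E l u) u.
  by rewrite (hermP hm) -bopME spectral_mono// rdotC.
ring.
Qed.

Lemma spectral_dot_mono l m u : l <= m -> rdot (E l u) u <= rdot (E m u) u.
Proof. by move=> lm; rewrite -subr_ge0 -spectral_dist// sqr_ge0. Qed.

(** The limit w of E_{l + 1/(k+1)} u lies in the range of E_x for every x > l. Its part w' killed by
    E_l then satisfies <T w', w'> = l |w'|^2 by the two inequalities, and the strict clause [Eeq]
    gives w' = 0. *)
Lemma spectral_rcont l u e : 0 < e -> exists2 d, 0 < d &
  forall m, l < m -> m < l + d -> hnorm (E m u - E l u) < e.
Proof.
move=> e0; pose m k : R := l + k.+1%:R^-1.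
have lm k : l < m k by rewrite ltrDl invr_gt0.
have mm j k : (j <= k)%N -> m k <= m j.
  by move=> jk; rewrite lerD2l lef_pV2 ?posrE ?ltr0Sn// ler_nat.
have mlim x : l < x -> exists k, m k <= x.
  rewrite -subr_gt0 => x0; exists (Num.bound (x - l)^-1).
  have := archi_boundP (x := (x - l)^-1); rewrite invr_ge0 ltW// => /(_ isT) h.
  rewrite /m -lerBrDl invf_ple ?posrE ?ltr0Sn//.
  by apply: le_trans (ltW h) _; rewrite ler_nat.
have [w hw] : exists w, hcvg (fun k => E (m k) u) w.
  apply: hilbert_cvg => e' e'0.
  pose F k := rdot (E (m k) u) u.
  have Fcv : cvgn F.
    apply: nonincreasing_is_cvgn; first by move=> j k jk; exact: spectral_dot_mono (mm _ _ jk).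
    by exists 0 => _ [k _ <-]; rewrite /F spectral_sq sqr_ge0.
  have e2 : 0 < (e' / 2) ^+ 2 / 2 by rewrite divr_gt0// exprn_gt0// divr_gt0.
  have [N _ hN] := (cvgrPdist_lt _ _).1 Fcv _ e2.
  have half k : (N <= k)%N -> hnorm (E (m N) u - E (m k) u) < e' / 2.
    move=> Nk; rewrite -ltr_sqr ?nnegrE ?hnorm_ge0 ?divr_ge0 ?ltW//.
    rewrite spectral_dist ?mm//; have := hN _ (leqnn N); have := hN _ Nk.
    rewrite /= !ltr_norml -/(F N) -/(F k) => /andP[h1 h2] /andP[h3 h4]; lra.
  exists N => j k /half hj /half hk.
  have := ler_hnorm_dist (E (m j) u) (E (m N) u) (E (m k) u).
  rewrite (hnorm_subC (E (m j) u) (E (m N) u)); lra.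
have Ew x : l < x -> E x w = w.
  move=> /mlim[k kx]; have h := bop_cvg (E x) hw; apply: (hcvg_unique h).
  move=> e' /(hw)[N hN]; exists (maxn N k) => j; rewrite geq_max => /andP[Nj kj] /=.
  by rewrite -bopME spectral_mono ?hN//; apply: le_trans kx; exact: mm.
have Elw : E l w = E l u.
  apply: (hcvg_unique (bop_cvg (E l) hw)) => e' e'0; exists 0%N => k _ /=.
  by rewrite -bopME spectral_monoC ?ltW// subrr hnorm0.
pose w' := w - E l w.
have w'0 : w' = 0.
  have w'l : E l w' = 0 by rewrite /w' bopB Eid subrr.
  apply: (Eeq w'l); apply/eqP; rewrite eq_le Ege// andbT.
  apply/ler_addgt0Pl => e' e'0.
  have K0 : 0 < rdot w' w' + 1 by rewrite ltr_wpDl ?rdot_ge0.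
  have lx : l < l + e' / (rdot w' w' + 1) by rewrite ltrDl divr_gt0.
  have : E (l + e' / (rdot w' w' + 1)) w' = w'.
    by rewrite /w' bopB Ew// -bopME spectral_mono// ltW.
  move=> /Ele h; apply: le_trans h _; rewrite mulrDl addrC lerD2r.
  by rewrite mulrAC ler_pdivrMr// ler_pM2l// lerDl.
have wE : w = E l u by rewrite -Elw; apply/eqP; rewrite -subr_eq0; apply/eqP.
have [k hk] := hw _ e0; exists k.+1%:R^-1; first by rewrite invr_gt0.
move=> x lx xk; have {}hk := hk k (leqnn k); rewrite wE in hk; apply: le_lt_trans hk.
(* Between l and [m k] the difference at x is E_x applied to the one at [m k], and E_x is a
   contraction; a single k controls every such x. *)
have -> : E x u - E l u = E x (E (m k) u - E l u).
  by rewrite bopB -!bopME (spectral_monoC (ltW xk)) (spectral_mono (ltW lx)).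
by have := proj_bnd (pE x) (E (m k) u - E l u); rewrite mul1r.
Qed.

Variable C : R.
Hypotheses (pT : forall u, 0 <= rdot (T u) u) (TC : bnd T C) (C0 : 0 <= C).

Lemma cvg_at_right_eps (f : R -> R) l :
  (forall e, 0 < e -> exists2 d, 0 < d & forall m, l < m -> m < l + d -> `|f m - f l| < e) ->
  f m @[m --> l^'+] --> f l.
Proof.
move=> h; apply/cvgrPdist_lt => e /h[d d0 hd]; near=> m.
rewrite distrC; apply: hd; near: m; first exact: nbhs_right_gt.
by apply: nbhs_right_lt; rewrite ltrDl.
Unshelve. all: by end_near. Qed.

Definition spectral_cumulative (u : H) (l : R) : R := rdot (E l u) u.

Lemma spectral_cumulative_nd u : {homo spectral_cumulative u : x y / x <= y}.
Proof. by move=> l m; exact: spectral_dot_mono. Qed.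

Lemma spectral_cumulative_rc u :
  forall l, spectral_cumulative u @ at_right l --> spectral_cumulative u l.
Proof.
move=> l; apply: (@cvg_at_right_eps (spectral_cumulative u)) => e e0.
have u1 : 0 < hnorm u + 1 by rewrite ltr_wpDl ?hnorm_ge0.
have [d d0 hd] := spectral_rcont l u (divr_gt0 e0 u1); exists d => // m lm md.
have := hd m lm md; rewrite ltr_pdivlMr//; apply: le_lt_trans.
rewrite -rdotNl -rdotDl; apply: le_trans (rdot_normr _ _) _.
by rewrite ler_wpM2l ?hnorm_ge0// lerDl.
Qed.

HB.instance Definition _ u := isCumulative.Build R _ R
  (spectral_cumulative u) (@spectral_cumulative_nd u) (@spectral_cumulative_rc u).

Lemma hermitian_hdot (f : bop) u : hermitian_op f -> hdot (f u) u = (rdot (f u) u)%:C.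
Proof.
move=> hf; rewrite hdotE; congr (_ +i* _).
have := rdot_iZl u (f u); rewrite -bopZ -(hermP hf) rdotC => h.
by rewrite (hermP hf); lra.
Qed.

Lemma spectral_resolution_bounded :
  spectral_resolution (op_graph T) (fun l => E l).
Proof.
split.
  split.
  - by move=> l; apply/is_projP.
  - by move=> l m lm u /=; rewrite -bopME spectral_mono.
  - move=> l u; rewrite -(_ : hnorm (E l u - E l u) = 0); last by rewrite subrr hnorm0.
    apply: (@cvg_at_right_eps (fun m => hnorm (E m u - E l u))) => e e0.
    have [d d0 hd] := spectral_rcont l u e0; exists d => // m lm md.
    by rewrite subrr hnorm0 subr0 ger0_norm ?hnorm_ge0// hd.
  - move=> u; apply/cvgrPdist_lt => e e0; near=> l.
    rewrite spectral_lt0 ?bop0E ?hnorm0 ?subr0 ?normr0//.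
  - move=> u; apply/cvgrPdist_lt => e e0; near=> l.
    rewrite (@spectral_gt l C)// ?bop1E ?subrr ?hnorm0 ?subr0 ?normr0//.
    by near: l; apply: nbhs_pinfty_gt; exact: num_real.
move=> u; pose F : cumulative R R := spectral_cumulative u.
have C0' : 0 <= C by [].
(* E_l is known to be 0 for l < 0 and 1 for l > C, both strictly, hence the margins on either side
   of [0, C]. *)
have ab : -1 <= C + 1 by lra.
have Fa x : x <= -1 -> F x = F (-1).
  by move=> x1; rewrite /F /= /spectral_cumulative !spectral_lt0//; lra.
have Fb x : C + 1 <= x -> F x = F (C + 1).
  by move=> x1; rewrite /F /= /spectral_cumulative !(@spectral_gt _ C)//; lra.
exists F; split.
- by move=> l; rewrite hermitian_hdot//; case: (pE l).
- split=> _; first exact: stieltjes_sq_fin ab Fa Fb.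
  by exists (T u).
- move=> v; rewrite /op_graph /= => ->; rewrite hermitian_hdot//; congr (_%:C).
  (* The increment of G from s to t is <T w, w> with w = E_t u - E_s u, which lies between s |w|^2
     and t |w|^2 by [Ege] and [Ele]. *)
  pose G l := rdot (T (E l u)) u.
  rewrite (@stieltjes_integral _ F _ _ ab Fa Fb G).
    by rewrite /G (@spectral_lt0 (-1))// (@spectral_gt (C + 1) C)// ?bop0E ?bop0 ?rdot0l ?subr0//; lra.
  move=> s t st; set w := E t u - E s u.
  have wt : E t w = w by rewrite /w bopB Eid -bopME spectral_mono.
  have ws : E s w = 0 by rewrite /w bopB Eid -bopME spectral_monoC// subrr.
  have -> : F t - F s = rdot w w by rewrite -hnorm_sq spectral_dist.
  have -> : G t - G s = rdot (T w) w.
    rewrite /G -rdotNl -rdotDl -bopB -/w; have [_ ht] := pE t; have [_ hs] := pE s.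
    rewrite [in RHS]/w rdotDr rdotNr -(hermP ht) -(hermP hs).
    rewrite -!(bopME _ T) -!(spectral_comm) !bopME wt ws.
    by rewrite bop0 rdot0l subr0.
  by split; [exact: Ege|exact: Ele].
Unshelve. all: by end_near. Qed.

End SpectralFamily.

(** * Von Neumann algebras *)

Section VN.
Variables (R : realType) (H : hilbertType R) (M : set (H -> H)).
Local Notation bop := (bop H).
Hypothesis vnM : von_neumann_algebra M.

Lemma vn_bounded f : M f -> bounded_op f.
Proof. by case: vnM => _ <- []. Qed.

Lemma vn_commute f g : M f -> commutant M g -> g \o f =1 f \o g.
Proof. by move=> Mf [_]; exact. Qed.

(** The bicommutant property turns membership in M into commutation with M', a condition inherited
    by the projections and inverses built from elements of M. *)
Lemma vn_bicomm (f : bop) : (forall g : bop, commutant M g -> GRing.comm g f) -> M f.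
Proof.
move=> h; case: vnM => _ <-; split; first exact: bop_bounded.
move=> g [gb cg] x /=; have /(congr1 (fun k : bop => k x)) := h (Bop gb) (conj gb cg).
by rewrite !bopME.
Qed.

Lemma vn_comm (f g : bop) : M f -> commutant M g -> GRing.comm g f.
Proof. by move=> Mf Mg; apply: bopP => x; exact: vn_commute. Qed.

Lemma vn_badj (f : bop) : M f -> M (badj f).
Proof. by case: vnM => h _ /h; apply; exact: is_adjoint_badj. Qed.

Lemma commutantP (g : bop) : (forall f : bop, M f -> GRing.comm g f) -> commutant M g.
Proof.
move=> h; split; first exact: bop_bounded.
move=> f Mf x; have := h (Bop (vn_bounded Mf)) Mf.
by move/(congr1 (fun k : bop => k x)).
Qed.

Lemma commutant_badj (g : bop) : commutant M g -> commutant M (badj g).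
Proof.
move=> Mg; apply: commutantP => f Mf; rewrite /GRing.comm -[in LHS](badjK f) -badjM.
by rewrite -(vn_comm (vn_badj Mf) Mg) badjM badjK.
Qed.

Lemma vn1 : M (1 : bop).
Proof. by apply: vn_bicomm => g _; exact: commr1. Qed.
Lemma vn0 : M (0 : bop).
Proof. by apply: vn_bicomm => g _; exact: commr0. Qed.
Lemma vn_add (f g : bop) : M f -> M g -> M (f + g : bop).
Proof. by move=> Mf Mg; apply: vn_bicomm => h Mh; apply: commrD; exact: vn_comm. Qed.
Lemma vn_opp (f : bop) : M f -> M (- f : bop).
Proof. by move=> Mf; apply: vn_bicomm => h Mh; apply: commrN; exact: vn_comm. Qed.
Lemma vn_sub (f g : bop) : M f -> M g -> M (f - g : bop).
Proof. by move=> Mf Mg; apply: vn_add => //; exact: vn_opp. Qed.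
Lemma vn_mul (f g : bop) : M f -> M g -> M (f * g : bop).
Proof. by move=> Mf Mg; apply: vn_bicomm => h Mh; apply: commrM; exact: vn_comm. Qed.
Lemma op_adjoint_graph (f : bop) : op_adjoint (op_graph f) = op_graph (badj f).
Proof.
apply/seteqP; split=> [[u v]|[u v]]; rewrite /op_adjoint /op_graph /=.
  move=> h; apply: rdot_inj => w; rewrite badjPl (rdotC v) (rdotC u) /rdot.
  by have /= -> := h w (f w) erefl.
by move=> -> a b ->; exact: is_adjoint_badj.
Qed.

Lemma op_mul_graph (f g : H -> H) : op_mul (op_graph f) (op_graph g) = op_graph (f \o g).
Proof.
apply/seteqP; split=> [[u v]|[u v]]; rewrite /op_mul /op_graph /=.
  by move=> [w -> ->].
by move=> ->; exists (g u).
Qed.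

Lemma linear_op_graph (f : bop) : linear_op (op_graph f).
Proof.
rewrite /op_graph; split=> /=; first by rewrite bop0.
  by move=> a [u1 u2] [v1 v2] /= -> ->; rewrite bopD bopZ.
by move=> v ->; rewrite bop0.
Qed.

Lemma dense_graph (f : H -> H) : densely_defined (op_graph f).
Proof.
move=> u e e0; exists u; first by exists (f u).
by rewrite subrr hnorm0.
Qed.

Lemma op_closureP (x : operator H) z : op_closure x z -> exists u v : nat -> H,
  [/\ forall n, x (u n, v n), hcvg u z.1 & hcvg v z.2].
Proof.
move=> xz; have /choice[t ht] : forall n : nat, exists t, [/\ x t, hnorm (z.1 - t.1) < n.+1%:R^-1 & hnorm (z.2 - t.2) < n.+1%:R^-1].
  move=> n; have [|t xt [h1 h2]] := xz n.+1%:R^-1; first by rewrite invr_gt0 ltr0Sn.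
  by exists t.
have hc (w : nat -> H) y : (forall n, hnorm (y - w n) < n.+1%:R^-1) -> hcvg w y.
  move=> hw e e0; have [N _ hN] := (cvgrPdist_lt _ _).1 (@cvg_harmonic R) _ e0.
  exists N => n /hN /=; rewrite sub0r normrN ger0_norm ?harmonic_ge0//.
  by apply: lt_trans; rewrite hnorm_subC.
exists (fun n => (t n).1), (fun n => (t n).2); split.
- by move=> n; rewrite -surjective_pairing; case: (ht n).
- by apply: hc => n; case: (ht n).
- by apply: hc => n; case: (ht n).
Qed.

Lemma op_closure_lim (x : operator H) (u v : nat -> H) a b :
  (forall n, x (u n, v n)) -> hcvg u a -> hcvg v b -> op_closure x (a, b).
Proof.
move=> xuv ua vb e e0; have [N hN] := ua _ e0; have [K hK] := vb _ e0.
exists (u (maxn N K), v (maxn N K)) => //=.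
by split; rewrite hnorm_subC; [exact: hN (leq_maxl _ _)|exact: hK (leq_maxr _ _)].
Qed.

Lemma closed_graph (f : bop) : closed_op (op_graph f).
Proof.
move=> [a b] /op_closureP[u [v [h ua vb]]]; rewrite /op_graph /=.
apply: (hcvg_unique vb); have := bop_cvg f ua; congr hcvg.
by apply/funext => n; have /= := h n; rewrite /op_graph /= => ->.
Qed.

Lemma affiliated_graph (b : bop) : M b -> affiliated M (op_graph b).
Proof.
move=> Mb; split; [exact: linear_op_graph|exact: dense_graph|exact: closed_graph|].
by move=> f Mf; rewrite !op_mul_graph => -[u v]; rewrite /op_graph /= => ->; exact: vn_commute.
Qed.

Lemma finite_projection0 : finite_projection M (fun=> 0).
Proof.
split; [exact: vn0|by apply/(is_projP (0 : bop)); split; [rewrite mul0r|exact: badj0]|].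
move=> q Mq pq + _ => q0 u.
by have := q0 u => /= <-.
Qed.

(** The modulus is the square root S of [badj b * b]. Taking c = C + 1, above a bound C of S, makes
    the spectral projection beyond c zero, and zero is finite. *)
Lemma bounded_measurable (b : bop) : M b -> measurable_op M (op_graph b).
Proof.
move=> Mb; split; first exact: affiliated_graph.
have [||S [hS pS SS cS]] := @sqrt_exists R H (badj b * b).
- by rewrite /hermitian_op badjM badjK.
- by move=> u; rewrite bopME badjPl rdot_ge0.
have /choice[E hE] := fun l => @spectral_proj_exists _ _ S l hS.
have [C C0 SC] := bop_bound S.
exists (C + 1), (op_graph S), (fun=> 0); split.
- by rewrite addr_gt0.
- split; last by rewrite op_adjoint_graph !op_mul_graph -[bop_fun S \o _]/(bop_fun (S * S)) SS.
  split; [exact: linear_op_graph|exact: dense_graph|by rewrite op_adjoint_graph hS|].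
  by move=> u v; rewrite /op_graph /= => ->; rewrite hermitian_hdot// lecE /= eqxx pS.
- exists (fun l => E l).
    apply: (spectral_resolution_bounded hS _ _ _ _ _ pS SC); last exact: ltW.
    + by move=> l; case: (hE l).
    + by move=> l; case: (hE l).
    + by move=> l; case: (hE l).
    + by move=> l; case: (hE l).
    + by move=> l; case: (hE l).
  move=> u; rewrite (@spectral_gt _ _ S E _ _ (C + 1) C) ?bop1E ?subrr ?ltrDl//.
  + by move=> l; case: (hE l).
  + by move=> l; case: (hE l).
- exact: finite_projection0.
Qed.

End VN.

(** * The bounded transform *)

Section PowerSpace.
Variables (R : realType) (H : hilbertType R) (n : nat).
Implicit Types z w : hilbert_pow H n.

Lemma rdot_powE z w : rdot z w = \sum_i rdot (hcoord z i) (hcoord w i).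
Proof. by rewrite /rdot /= /pow_dot (raddf_sum (@complex.Re R)). Qed.

Lemma hcoordD z w i : hcoord (z + w) i = hcoord z i + hcoord w i.
Proof. by rewrite /hcoord ffunE. Qed.

Lemma hcoordN z i : hcoord (- z) i = - hcoord z i.
Proof. by rewrite /hcoord ffunE. Qed.

Lemma hcoordZ (a : R[i]) z i : hcoord (a *: z) i = a *: hcoord z i.
Proof. by rewrite /hcoord ffunE. Qed.

Lemma hcoord0 i : hcoord (0 : hilbert_pow H n) i = 0.
Proof. by rewrite /hcoord ffunE. Qed.

Lemma hcoordP z w : (forall i, hcoord z i = hcoord w i) -> z = w.
Proof. by move=> h; apply/ffunP. Qed.

Definition hvec (f : 'I_n -> H) : hilbert_pow H n := [ffun i => f i].

Lemma hvecE f i : hcoord (hvec f) i = f i.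
Proof. by rewrite /hcoord ffunE. Qed.

Lemma hnorm_coord z i : hnorm (hcoord z i) <= hnorm z.
Proof.
rewrite !hnormE ler_sqrt ?rdot_ge0// rdot_powE (bigD1 i)//= lerDl.
by apply: sumr_ge0 => j _; exact: rdot_ge0.
Qed.

Lemma hcvg_coord (u : nat -> hilbert_pow H n) z i : hcvg u z ->
  hcvg (fun k => hcoord (u k) i) (hcoord z i).
Proof.
move=> uz e /uz[N hN]; exists N => k /hN; apply: le_lt_trans.
by rewrite -hcoordN -hcoordD hnorm_coord.
Qed.

(** Crude but convenient: n C^2 <= ((n + 1) C)^2, and the factor n + 1 can be divided by even when n
    = 0. *)
Lemma hnorm_pow_le z (C : R) : 0 <= C -> (forall i, hnorm (hcoord z i) <= C) ->
  hnorm z <= (n%:R + 1) * C.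
Proof.
move=> C0 zC; have n0 : 0 <= (n%:R : R) by [].
rewrite -ler_sqr ?nnegrE ?hnorm_ge0 ?mulr_ge0 ?addr_ge0// hnorm_sq rdot_powE.
apply: (@le_trans _ _ (\sum_(i < n) C ^+ 2)).
  by apply: ler_sum => i _; rewrite -hnorm_sq ler_sqr ?nnegrE ?hnorm_ge0.
rewrite sumr_const card_ord -[C ^+ 2 *+ n]mulr_natl exprMn. apply: ler_wpM2r; rewrite ?sqr_ge0//; nra.
Qed.

Lemma hcvg_pow (u : nat -> hilbert_pow H n) z :
  (forall i, hcvg (fun k => hcoord (u k) i) (hcoord z i)) -> hcvg u z.
Proof.
move=> uz e e0; have n0 : 0 < (n%:R + 1 : R) by rewrite ltr_wpDl.
have e2 : 0 < e / 2 / (n%:R + 1) by rewrite !divr_gt0.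
have /choice[N hN] : forall i, exists N, forall k, (N <= k)%N ->
    hnorm (hcoord (u k) i - hcoord z i) < e / 2 / (n%:R + 1).
  by move=> i; exact: uz.
exists (\max_i N i) => k hk; apply: (@le_lt_trans _ _ (e / 2)); last by lra.
rewrite -[e / 2](divfK (lt0r_neq0 n0)) mulrC; apply: hnorm_pow_le; first exact: ltW.
move=> i; rewrite hcoordD hcoordN ltW// hN//; apply: leq_trans hk.
exact: leq_bigmax.
Qed.

End PowerSpace.

Section BoundedTransform.
Variables (R : realType) (H : hilbertType R) (M : set (H -> H)).
Local Notation bop := (bop H).
Hypothesis vnM : von_neumann_algebra M.
Variable x : operator H.
Hypothesis aff : affiliated M x.

Local Notation pair a b := (@hvec R H 2 (fun i => if i == ord0 then a else b)).
Let fst2 (z : hilbert_pow H 2) : H := hcoord z ord0.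
Let snd2 (z : hilbert_pow H 2) : H := hcoord z ord_max.

Let rdot2 z w : rdot z w = rdot (fst2 z) (fst2 w) + rdot (snd2 z) (snd2 w).
Proof.
by rewrite rdot_powE big_ord_recl big_ord1 (_ : lift ord0 ord0 = ord_max); last exact: val_inj.
Qed.

Let pair1 a b : fst2 (pair a b) = a. Proof. by rewrite /fst2 hvecE. Qed.
Let pair2 a b : snd2 (pair a b) = b. Proof. by rewrite /snd2 hvecE. Qed.

Let x0 : x (0, 0). Proof. by case: aff => -[]. Qed.
Let xP (a : R[i]) u v u' v' : x (u, v) -> x (u', v') -> x (a *: u + u', a *: v + v').
Proof. by case: aff => -[_ h _] _ _ _ h1 h2; have := h a _ _ h1 h2. Qed.
Let xD u v u' v' : x (u, v) -> x (u', v') -> x (u + u', v + v').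
Proof. by move=> h1 h2; have := xP 1 h1 h2; rewrite !scale1r. Qed.
Let xZ (a : R[i]) u v : x (u, v) -> x (a *: u, a *: v).
Proof. by move=> h1; have := xP a h1 x0; rewrite !addr0. Qed.
Let xB u v u' v' : x (u, v) -> x (u', v') -> x (u - u', v - v').
Proof. by move=> h1 /(xZ (-1)); rewrite !scaleN1r; exact: xD. Qed.
Let xcl (u v : nat -> H) a b : (forall n, x (u n, v n)) -> hcvg u a -> hcvg v b -> x (a, b).
Proof. by case: aff => _ _ cl _ h ua vb; apply: cl; exact: op_closure_lim ua vb. Qed.
Let xf (f : bop) u v : commutant M f -> x (u, v) -> x (f u, f v).
Proof.
case: aff => _ _ _ h Mf xuv.
have [|w] := h f Mf (u, f v); first by exists v.
by rewrite /op_graph /= => ->.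
Qed.

(** The graph of x is placed in [hilbert_pow H 2] so that completeness, and with it the orthogonal
    projection, is inherited from that space. *)
Let G : set (hilbert_pow H 2) := [set z | x (fst2 z, snd2 z)].

Let G_closed : closed_subspace G.
Proof.
split; rewrite /G /fst2 /snd2 /=.
- by rewrite !hcoord0.
- by move=> a b; rewrite !hcoordD; exact: xD.
- by move=> r a; rewrite !hcoordZ; exact: xZ.
- by move=> u a hu ua; apply: xcl hu _ _; exact: hcvg_coord.
Qed.

(** Let Q be the projection on the graph and Q (u, 0) = (B u, D u). Then D = x B, and orthogonality
    of (u - B u, - D u) to the graph says that the adjoint of x sends D u to u - B u; hence B = (1 +
    x^* x)^-1. *)
Lemma bounded_transform : exists B D : bop, [/\ M B /\ M D, hermitian_op B,
  forall u, 0 <= rdot (B u) u, forall u, x (B u, D u) & forall u, B u = 0 -> u = 0].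
Proof.
have [|Q [[QQ hQ] GQ QG]] := proj_bop G_closed.
  by move=> z; rewrite /G /fst2 /snd2 /= !hcoordZ; exact: xZ.
have pair_lin (a : R[i]) u v : pair (a *: u + v) 0 = a *: pair u 0 + pair v 0.
  apply: hcoordP => i; rewrite hcoordD hcoordZ !hvecE.
  by case: ifP => // _; rewrite scaler0 addr0.
have pair_norm u : hnorm (pair u 0) = hnorm u.
  by rewrite !hnormE rdot2 pair1 pair2 rdot0l addr0.
have Qn z : hnorm (Q z) <= hnorm z by have := proj_bnd (conj QQ hQ) z; rewrite mul1r.
have bB : bounded_op (fun u => fst2 (Q (pair u 0))).
  split; first by move=> a u v; rewrite pair_lin bopD bopZ /fst2 hcoordD hcoordZ.
  exists 1 => u; rewrite mul1r -(pair_norm u); apply: le_trans (Qn _); exact: hnorm_coord.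
have bD : bounded_op (fun u => snd2 (Q (pair u 0))).
  split; first by move=> a u v; rewrite pair_lin bopD bopZ /snd2 hcoordD hcoordZ.
  exists 1 => u; rewrite mul1r -(pair_norm u); apply: le_trans (Qn _); exact: hnorm_coord.
pose B := Bop bB; pose D := Bop bD; exists B, D.
have xBD u : x (B u, D u) by have := GQ (pair u 0).
have ort u a b : x (a, b) -> rdot (u - B u) a = rdot (D u) b.
  move=> xab; have /QG e : G (pair a b) by rewrite /G /= pair1 pair2.
  have h : rdot (pair u 0 - Q (pair u 0)) (pair a b) = 0.
    by rewrite -e -(hermP hQ) bopB -bopME QQ subrr rdot0l.
  move: h; rewrite rdotDl rdotNl !rdot2 !pair1 !pair2 rdot0l addr0.
  rewrite -[fst2 _]/(B u) -[snd2 _]/(D u) => h.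
  by rewrite rdotDl rdotNl; lra.
have uniq u p q : x (p, q) -> (forall a b, x (a, b) -> rdot (u - p) a = rdot q b) ->
    p = B u /\ q = D u.
  move=> xpq h; have xd := xB xpq (xBD u).
  have := h _ _ xd; have := ort u _ _ xd => h1 h2.
  have : rdot (p - B u) (p - B u) + rdot (q - D u) (q - D u) = 0.
    move: h1 h2; rewrite !rdotE; lra.
  move/eqP; rewrite paddr_eq0 ?rdot_ge0// => /andP[/eqP/rdot_eq0 e1 /eqP/rdot_eq0 e2].
  by split; apply/eqP; rewrite -subr_eq0 ?e1 ?e2.
(* For f in M' the pair (f (B u), f (D u)) lies in the graph and satisfies the orthogonality
   relations of f u, because the adjoint of f is in M' too; the projection being unique, the pair is
   (B (f u), D (f u)). *)
have comm (f : bop) u : commutant M f -> f (B u) = B (f u) /\ f (D u) = D (f u).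
  move=> Mf; apply: uniq; first exact: xf.
  move=> a b xab; have xab' := xf (commutant_badj vnM Mf) xab.
  by rewrite -bopB !(badjP f); exact: ort xab'.
have BB u v : rdot u (B v) = rdot (B u) (B v) + rdot (D u) (D v).
  by have := ort u _ _ (xBD v); rewrite rdotDl rdotNl; lra.
split.
- by split; apply: (vn_bicomm vnM) => g Mg; apply: bopP => u; rewrite !bopME;
    case: (comm g u Mg).
- by apply: badj_unique => u v; rewrite (rdotC (B u) v) (BB v u) (BB u v) (rdotC (B v)) (rdotC (D v)).
- by move=> u; rewrite rdotC BB addr_ge0 ?rdot_ge0.
- exact: xBD.
(* If B u = 0 then D u = 0, so u is orthogonal to the domain of x, which is dense. *)
- move=> u Bu; have := BB u u; rewrite Bu !rdot0r add0r => /esym/rdot_eq0 Du.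
  have ux a b : x (a, b) -> rdot u a = 0.
    by move=> /(ort u); rewrite Bu subr0 Du rdot0l.
  apply: hnorm_lt_eq => e e0; rewrite ltNge; apply/negP => eu.
  have [_ dx _ _] := aff; have [a [b xab] ua] := dx u e e0.
  have : hnorm u ^+ 2 <= hnorm u * hnorm (u - a).
    by rewrite hnorm_sq -(subr0 (rdot u u)) -(ux _ _ xab) -rdotNr -rdotDr rdot_le.
  by rewrite expr2 ler_pM2l ?(lt_le_trans e0)// leNgt (lt_le_trans ua).
Qed.

End BoundedTransform.

(** * Inverting a positive operator on its spectral projections *)

Section SpectralInverse.
Variables (R : realType) (H : hilbertType R) (M : set (H -> H)).
Local Notation bop := (bop H).

(** The lower bound makes W injective with closed range, and a vector v orthogonal to the range
    satisfies d |v|^2 <= <W v, v> = 0. *)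
Lemma bop_inverse (W : bop) d : 0 < d -> hermitian_op W ->
  (forall u, d * rdot u u <= rdot (W u) u) -> exists V : bop, W * V = 1 /\ V * W = 1.
Proof.
move=> d0 hW Wd.
have lowb u : d * hnorm u <= hnorm (W u).
  have [/eqP ->|u0] := boolP (hnorm u == 0); first by rewrite mulr0 hnorm_ge0.
  have up : 0 < hnorm u by rewrite lt_def u0 hnorm_ge0.
  rewrite -(ler_pM2r up) -mulrA -expr2 hnorm_sq; apply: le_trans (Wd u) _; exact: rdot_le.
have inj u : W u = 0 -> u = 0.
  move=> Wu; apply: rdot_eq0; apply/eqP; rewrite eq_le rdot_ge0 andbT.
  by have := Wd u; rewrite Wu rdot0l pmulr_rle0.
have cS : closed_subspace [set W u | u in setT].
  split.
  - by exists 0 => //; rewrite bop0.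
  - by move=> _ _ [u _ <-] [v _ <-]; exists (u + v) => //; rewrite bopD.
  - by move=> r _ [u _ <-]; exists (r%:C *: u) => //; rewrite bopZ.
  - move=> v y hv vy.
    have /choice[u hu] : forall n, exists u, W u = v n by move=> n; have [u _ <-] := hv n; exists u.
    have [|l ul] := @hilbert_cvg _ _ u.
      move=> e e0; have [N hN] := vy _ (divr_gt0 (mulr_gt0 d0 e0) (ltr0n R 2)).
      exists N => m n Nm Nn; rewrite -(ltr_pM2l d0).
      apply: le_lt_trans (lowb _) _; rewrite bopB !hu.
      have := ler_hnorm_dist (v m) y (v n); rewrite (hnorm_subC y).
      have := hN _ Nm; have := hN _ Nn; lra.
    exists l => //; apply: hcvg_unique vy; have := bop_cvg W ul; congr hcvg.
    by apply/funext => n /=.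
have sur y : exists u, W u = y.
  have [p [u _ Wu] h] := proj_exists y cS; exists u; rewrite Wu; apply/eqP.
  rewrite eq_sym -subr_eq0; apply/eqP.
  have : rdot (y - p) (W (y - p)) = 0 by apply: h; exists (y - p).
  rewrite rdotC => h0; apply: rdot_eq0; apply/eqP; rewrite eq_le rdot_ge0 andbT.
  by have := Wd (y - p); rewrite h0 pmulr_rle0.
have /choice[V hV] := sur.
have injW u v : W u = W v -> u = v.
  by move=> e; apply/eqP; rewrite -subr_eq0; apply/eqP/inj; rewrite bopB e subrr.
have bV : bounded_op V.
  split; first by move=> a u v; apply: injW; rewrite bopD bopZ !hV.
  by exists d^-1 => u; rewrite ler_pdivlMl// -{2}(hV u).
exists (Bop bV); split; first by apply: bopP => u; rewrite bopME /= hV.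
by apply: bopP => u; apply: injW; rewrite bopME /= hV.
Qed.

Lemma comm_inverse (g W V : bop) : W * V = 1 -> V * W = 1 -> GRing.comm g W -> GRing.comm g V.
Proof.
move=> WV VW gW; rewrite /GRing.comm -[LHS]mul1r -VW -mulrA (mulrA W) -gW.
by rewrite -!mulrA WV mulr1.
Qed.

(** [e0] is the projection on the kernel of B, [e k] the spectral projection for ]1/(k+1), +oo[, and
    [c k] the inverse of B on the range of [e k], extended by 0. Right-continuity of the spectral
    family at 0 makes [e k] increase to 1 - e0. *)
Lemma spectral_inverse (B : bop) : hermitian_op B -> (forall u, 0 <= rdot (B u) u) ->
  exists (e0 : bop) (e c : nat -> bop),
  [/\ [/\ forall k, is_proj (e k), forall k, e k.+1 * e k = e k &
        forall u, hcvg (fun k => e k u) (u - e0 u)],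
      [/\ forall g, GRing.comm g B -> GRing.comm g e0,
        forall k g, GRing.comm g B -> GRing.comm g (e k) &
        forall k g, GRing.comm g B -> GRing.comm g (c k)],
      [/\ is_proj e0, B * e0 = 0 & forall k, e0 * e k = 0],
      forall k, B * c k = e k &
      [/\ forall k, c k * e k = c k & forall j k, (j <= k)%N -> e j * c k = c j]].
Proof.
move=> hB pB; have /choice[E hE] := fun l => @spectral_proj_exists _ _ B l hB.
have pE l : is_proj (E l) by case: (hE l).
have cE l g : GRing.comm g B -> GRing.comm g (E l) by case: (hE l) => _ + _ _ _; apply.
have Ele l u : E l u = u -> rdot (B u) u <= l * rdot u u by case: (hE l) => _ _ + _ _; apply.
have Ege l u : E l u = 0 -> l * rdot u u <= rdot (B u) u by case: (hE l) => _ _ _ + _; apply.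
have Eeq l u : E l u = 0 -> rdot (B u) u = l * rdot u u -> u = 0.
  by case: (hE l) => _ _ _ _; apply.
have mono := spectral_mono pE cE Ele Ege.
pose t k : R := k.+1%:R^-1; have t0 k : 0 < t k by rewrite invr_gt0 ltr0Sn.
have tS j k : (j <= k)%N -> t k <= t j by move=> jk; rewrite lef_pV2 ?posrE ?ltr0Sn// ler_nat ltnS.
pose e k := 1 - E (t k).
have pe k : is_proj (e k) by exact: proj_compl.
have ee k : e k * e k = e k by case: (pe k).
have ce k g : GRing.comm g B -> GRing.comm g (e k).
  by move=> gB; apply: commrB; [exact: commr1|exact: cE].
have Bcomm := commr_refl B.
have e_mono j k : (j <= k)%N -> e k * e j = e j.
  move=> jk; rewrite /e mulrBl mul1r mulrBr mulr1.
  rewrite (spectral_monoC pE cE Ele Ege (tS _ _ jk)) subrr subr0 //.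
have Ee k : E (t k) * e k = 0 by rewrite /e mulrBr mulr1; case: (pE (t k)) => -> _; rewrite subrr.
(* Replacing B by the identity off the range of [e k] gives an operator bounded below by the minimum
   of 1/(k+1) and 1. *)
have inv k : exists V : bop, (B * e k + E (t k)) * V = 1 /\ V * (B * e k + E (t k)) = 1.
  apply: (@bop_inverse _ (Num.min (t k) 1)).
  - by rewrite lt_min t0 ltr01.
  - rewrite /hermitian_op badjD badjM; have [_ ->] := pE (t k); have [_ ->] := pe k.
    by rewrite hB (ce k _ Bcomm).
  - move=> u; have [_ hEk] := pE (t k); have [_ hek] := pe k.
    have -> : rdot u u = rdot (e k u) (e k u) + rdot (E (t k) u) (E (t k) u).
      rewrite [in RHS](hermP hek) [X in _ + X](hermP hEk) -!bopME ee.
      have [-> _] := pE (t k).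
      by rewrite -rdotDr -bopDE /e subrK.
    have -> : rdot ((B * e k + E (t k)) u) u = rdot (B (e k u)) (e k u) + rdot (E (t k) u) (E (t k) u).
      rewrite bopDE rdotDl; congr (_ + _).
        have eBe : e k * (B * e k) = B * e k by rewrite mulrA -(ce k _ Bcomm) -mulrA ee.
        by rewrite -(hermP hek) -[B (e k u)]/((B * e k) u) -(bopME (e k)) eBe.
      by rewrite [RHS](hermP hEk) -bopME; have [-> _] := pE (t k); rewrite (hermP hEk).
    have h1 : t k * rdot (e k u) (e k u) <= rdot (B (e k u)) (e k u).
      by apply: Ege; rewrite -bopME Ee.
    have m1 : Num.min (t k) 1 <= t k by rewrite ge_min lexx.
    have m2 : Num.min (t k) 1 <= 1 by rewrite ge_min lexx orbT.
    rewrite mulrDr; apply: lerD; first by apply: le_trans h1; rewrite ler_wpM2r ?rdot_ge0.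
    by rewrite ler_piMl ?rdot_ge0.
have /choice[V hV] := inv.
pose c k := V k * e k.
have cV k g : GRing.comm g B -> GRing.comm g (V k).
  have [h1 h2] := hV k; move=> gB; apply: (comm_inverse h1 h2).
  by apply: commrD; [apply: commrM => //; exact: ce|exact: cE].
have cc k g : GRing.comm g B -> GRing.comm g (c k).
  by move=> gB; apply: commrM; [exact: cV|exact: ce].
have Bc k : B * c k = e k.
  rewrite /c mulrA (cV k _ Bcomm) -mulrA.
  have -> : B * e k = (B * e k + E (t k)) * e k by rewrite mulrDl Ee addr0 -mulrA ee.
  by rewrite mulrA; have [_ ->] := hV k; rewrite mul1r.
have ce_ k : c k * e k = c k by rewrite /c -mulrA ee.
exists (E 0), e, c; split.
- split=> //; first by move=> k; exact: e_mono.
  move=> u d d0; have [r r0 hr] := spectral_rcont pE cE Ele Ege Eeq 0 u d0.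
  have [N _ hN] := (cvgrPdist_lt _ _).1 (@cvg_harmonic R) _ r0.
  exists N => k /hN /=; rewrite sub0r normrN ger0_norm ?harmonic_ge0// => hk.
  have -> : e k u - (u - E 0 u) = E 0 u - E (t k) u.
    by rewrite bopBE bop1E opprB addrC addrA subrK.
  rewrite hnorm_subC.
  by apply: hr => //; rewrite add0r.
- by split=> // g; exact: cE.
- split=> //.
    apply: bopP => u; rewrite bopME; apply: (pos_ker hB pB); apply/eqP; rewrite eq_le pB andbT.
    have := Ele 0 (E 0 u); rewrite mul0r; apply.
    by rewrite -bopME; case: (pE 0) => ->.
  by move=> k; rewrite /e mulrBr mulr1 (spectral_monoC pE cE Ele Ege (ltW (t0 k))) subrr.
- exact: Bc.
- split=> // j k jk.
  have ej : e j * e k = e j.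
    by have := congr1 (@badj R H) (e_mono _ _ jk); rewrite badjM; have [_ ->] := pe k; have [_ ->] := pe j.
  (* Insert B c_k = e_k and let B commute past the other factors: c_j = c_j e_j B c_k = (B c_j) e_j
     c_k = e_j c_k. *)
  have -> : c j = c j * (e j * (B * c k)) by rewrite Bc ej ce_.
  rewrite [X in c j * X]mulrA -(ce j _ Bcomm) -[X in c j * X]mulrA [RHS]mulrA.
  by rewrite -(cc j _ Bcomm) Bc [RHS]mulrA ee.
Qed.

End SpectralInverse.

(** * Locally bounded operators *)

Section Approximation.
Variables (R : realType) (H : hilbertType R) (M : set (H -> H)).
Local Notation bop := (bop H).
Hypothesis vnM : von_neumann_algebra M.
Implicit Types (p q b c : nat -> bop) (x y : operator H).

Definition central_seq p := [/\ forall k, M (p k) /\ commutant M (p k),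
  forall k, is_proj (p k), forall k, p k.+1 * p k = p k
  & forall u, hcvg (fun k => p k u) u].

Lemma proj_mono_le (e : nat -> bop) : (forall k, is_proj (e k)) ->
  (forall k, e k.+1 * e k = e k) -> forall j k, (j <= k)%N ->
  e k * e j = e j /\ e j * e k = e j.
Proof.
move=> pe eS j k jk.
have ekj : e k * e j = e j.
  rewrite -(subnKC jk); elim: (k - j)%N => [|i IH]; first by rewrite addn0; case: (pe j).
  by rewrite addnS -{1}IH mulrA eS.
split=> //; have := congr1 (@badj R H) ekj; rewrite badjM.
by have [_ ->] := pe j; have [_ ->] := pe k.
Qed.

Lemma central_seq_le p j k : central_seq p -> (j <= k)%N ->
  p k * p j = p j /\ p j * p k = p j.
Proof. by move=> [_ pp pS _]; exact: proj_mono_le. Qed.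

Lemma central_seq_comm p f k : central_seq p -> M f -> f \o p k =1 p k \o f.
Proof. by move=> [pM _ _ _] Mf u; rewrite -(vn_commute Mf)//; case: (pM k). Qed.

Lemma central_seq_commb p (f : bop) k : central_seq p -> M f -> p k * f = f * p k.
Proof. by move=> cp Mf; apply: bopP => u; rewrite !bopME; exact/esym/(central_seq_comm k cp Mf). Qed.

(** The largest operator whose cuts by the [p k] are given by the [b k]; being cut out by equations
    between bounded operators, its graph is closed. *)
Definition glue_op p b : operator H := [set z | forall k, p k z.2 = b k z.1].

(** [b k] is x on the range of [p k], extended by 0; the two laws linking b and p say that these
    pieces fit together. *)
Definition bdd_approx x p b := [/\ central_seq p, forall k, M (b k),
  forall k, b k * p k = b k, forall j k, (j <= k)%N -> p j * b k = b j & x = glue_op p b].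

Lemma approx_commb x p b j k : bdd_approx x p b -> p j * b k = b k * p j.
Proof. by move=> [cp Mb _ _ _]; exact: central_seq_commb. Qed.

Lemma approx_mem x p b : bdd_approx x p b -> forall k u, x (p k u, b k u).
Proof.
move=> ap; have [cp Mb bp pb ->] := ap; move=> k u j /=; rewrite -!bopME; congr (bop_fun _ u).
have [jk|/ltnW kj] := leqP j k.
  by rewrite pb// -(bp j) -mulrA; have [_ ->] := central_seq_le cp jk.
have [pkj _] := central_seq_le cp kj.
by rewrite -{1}(pb k k (leqnn k)) mulrA pkj -(approx_commb _ _ ap) !pb.
Qed.

Lemma approxE x p b u v : bdd_approx x p b -> x (u, v) <-> forall k, p k v = b k u.
Proof. by move=> [_ _ _ _ ->]. Qed.

Lemma central_seq_eq0 p u : central_seq p -> (forall k, p k u = 0) -> u = 0.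
Proof.
move=> [_ _ _ pu] pu0; apply: (hcvg_unique (pu u)) => e e0; exists 0%N => n _.
by rewrite pu0 subrr hnorm0.
Qed.

Lemma approx_fun x p b u v w : bdd_approx x p b -> x (u, v) -> x (u, w) -> v = w.
Proof.
move=> ap; rewrite !(approxE _ _ ap) => hv hw; apply/eqP; rewrite -subr_eq0; apply/eqP.
have [cp _ _ _ _] := ap; apply: (central_seq_eq0 cp) => k.
by rewrite bopB hv hw subrr.
Qed.

Lemma approx_coef x p b c : bdd_approx x p b -> bdd_approx x p c -> b = c.
Proof.
move=> ab ac; apply/funext => k; apply: bopP => u.
exact: (approx_fun ab (approx_mem ab k u) (approx_mem ac k u)).
Qed.

Lemma approx_closed x p b : bdd_approx x p b -> closed_op x.
Proof.
move=> ap [u v] /op_closureP[a [c [h au cv]]]; rewrite (approxE _ _ ap) => k.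
apply: (hcvg_unique (bop_cvg (p k) cv)); have := bop_cvg (b k) au; congr hcvg.
by apply/funext => n /=; have := h n; rewrite (approxE _ _ ap) => ->.
Qed.

Lemma approx_affiliated x p b : bdd_approx x p b -> affiliated M x.
Proof.
move=> ap; have [cp Mb _ _ _] := ap; split.
- split.
  + by rewrite (approxE _ _ ap) => k; rewrite !bop0.
  + move=> a [u1 u2] [v1 v2]; rewrite !(approxE _ _ ap) => h1 h2 k /=.
    by rewrite !bopD !bopZ h1 h2.
  + by move=> v xv; apply: (approx_fun ap xv); rewrite (approxE _ _ ap) => k; rewrite !bop0.
- move=> u e; have [_ _ _ pu] := cp; move=> /(pu u)[N hN]; exists (p N u).
    by exists (b N u); exact: (approx_mem ap).
  by rewrite hnorm_subC; exact: hN (leqnn N).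
- exact: approx_closed ap.
- move=> f Mf [u w] [v]; rewrite /op_graph /= => xuv ->; exists (f u) => //.
  move: xuv; rewrite !(approxE _ _ ap) => h k.
  have [pM _ _ _] := cp; have [Mp _] := pM k.
  rewrite -[LHS](vn_commute Mp Mf) -[RHS](vn_commute (Mb k) Mf) /=.
  by rewrite h.
Qed.

Lemma approx_restrict x p b k : bdd_approx x p b -> op_mul x (op_graph (p k)) = op_graph (b k).
Proof.
move=> ap; apply/seteqP; split=> -[u v]; rewrite /op_mul /op_graph /=.
  by move=> [w ->] xv; apply: (approx_fun ap xv); exact: (approx_mem ap).
by move=> ->; exists (p k u) => //; exact: (approx_mem ap).
Qed.

Lemma approx_LS x p b : bdd_approx x p b -> LS M x.
Proof.
move=> ap; have [cp Mb _ _ _] := ap; split; first exact: approx_affiliated ap.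
have [pM pp pS pu] := cp; exists (fun k => p k); split.
- move=> k; split; [by case: (pM k)|exact/is_projP|].
  by move=> f Mf u; case: (pM k) => _ [_ h]; exact: h.
- by move=> k u /=; rewrite -bopME pS.
- by move=> u; apply/hcvgP.
- by move=> k; rewrite (approx_restrict _ ap); exact: bounded_measurable.
Qed.

(** This isolates the step that depends on the algebra: for A one takes g = e, for matrices over A
    the determinants of the [e k]. The [e k] will be spectral projections of (1 + x^* x)^-1. *)
Definition central_minorants := forall e : nat -> bop,
  (forall k, M (e k)) -> (forall k, is_proj (e k)) ->
  (forall k, e k.+1 * e k = e k) -> (forall u, hcvg (fun k => e k u) u) ->
  exists g, central_seq g /\ forall k, e k * g k = g k.

Lemma affiliated_commute x (f : bop) u v : affiliated M x -> commutant M f ->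
  x (u, v) -> x (f u, f v).
Proof.
case=> _ _ _ h Mf xuv; have [|w] := h f Mf (u, f v); first by exists v.
by rewrite /op_graph /= => ->.
Qed.

Lemma affiliated_fun x u v w : affiliated M x -> x (u, v) -> x (u, w) -> v = w.
Proof.
move=> [[x0 xD x1] _ _ _] xv xw; apply/eqP; rewrite -subr_eq0; apply/eqP/x1.
have := xD (-1) _ _ xw xv; rewrite scaleN1r addrC; congr x.
by apply: injective_projections; rewrite /= ?subrr.
Qed.

(** As [p k] lies in M', affiliation makes the graph of x stable under it; closedness of x then
    recovers a pair (u, v) from its cuts (p k u, p k v). *)
Lemma affiliated_glue x p b : affiliated M x -> central_seq p -> (forall k, M (b k)) ->
  (forall k, b k * p k = b k) -> (forall k u, x (p k u, b k u)) -> bdd_approx x p b.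
Proof.
move=> aff cp Mb bp xb; have [pM pp _ pu] := cp; split=> //.
  move=> j k jk; apply: bopP => u; apply: (affiliated_fun aff (u := p j u)) => //.
  have := affiliated_commute aff (pM j).2 (xb k u).
  by rewrite -!bopME; have [_ ->] := central_seq_le cp jk.
apply/seteqP; split=> -[u v].
  move=> xuv k /=; have := affiliated_commute aff (pM k).2 xuv => h.
  exact: (affiliated_fun aff h (xb k u)).
move=> /= h; have [_ _ cl _] := aff; apply: cl.
apply: (op_closure_lim (u := fun k => p k u) (v := fun k => p k v)) => // k.
by rewrite h.
Qed.

(** Since x B = D and B (c k) = e k, x coincides with the bounded D (c k) on the range of [e k],
    hence on that of the central projection [g k] below it. Injectivity of B is what makes the [e k]
    increase to 1. *)
Lemma affiliated_approx x : central_minorants -> affiliated M x ->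
  exists p b, bdd_approx x p b.
Proof.
move=> cm aff; have [B [D [[MB MD] hB pB xBD B0]]] := bounded_transform vnM aff.
have [e0 [e [c [[pe eS eu] [ce0 ce cc] [pe0 Be0 _] Bc _]]]] := spectral_inverse hB pB.
have inM (f : bop) : (forall g, GRing.comm g B -> GRing.comm g f) -> M f.
  by move=> h; apply: (vn_bicomm vnM) => g Mg; apply: h; exact: vn_comm MB Mg.
have e00 u : e0 u = 0 by apply: B0; rewrite -bopME Be0.
have [|k|k|u|g [cg eg]] := cm e; rewrite //.
- by move=> k; apply: inM; exact: ce.
- by have := eu u; rewrite e00 subr0.
have [gM pg _ _] := cg.
exists g, (fun k => D * c k * g k); apply: affiliated_glue => //.
- move=> k; apply: (vn_mul vnM); last by case: (gM k).
  by apply: (vn_mul vnM) => //; apply: inM; exact: cc.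
- by move=> k; rewrite -mulrA; have [-> _] := pg k.
- by move=> k u; have := xBD (c k (g k u)); rewrite -(bopME B) Bc -bopME eg.
Qed.

Lemma central_seqM p q : central_seq p -> central_seq q -> central_seq (fun k => p k * q k).
Proof.
move=> cp cq; have [pM pp pS pu] := cp; have [qM pq qS qu] := cq.
have pqC j k : p j * q k = q k * p j by apply: central_seq_commb => //; case: (qM k).
split.
- move=> k; split; first by apply: (vn_mul vnM); [case: (pM k)|case: (qM k)].
  apply: (commutantP vnM) => f Mf; rewrite /GRing.comm mulrA -(central_seq_commb k cp Mf).
  by rewrite -mulrA -[RHS]mulrA -(central_seq_commb k cq Mf).
- move=> k; split.
    by rewrite mulrA -(mulrA (p k)) -pqC mulrA; have [-> _] := pp k; rewrite -mulrA; have [-> _] := pq k.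
  by rewrite /hermitian_op badjM; have [_ ->] := pp k; have [_ ->] := pq k; rewrite pqC.
- by move=> k; rewrite mulrA -(mulrA (p k.+1)) -pqC mulrA pS -mulrA qS.
- move=> u e e2; have e0 : 0 < e / 2 by rewrite divr_gt0.
  have [N hN] := pu u _ e0; have [K hK] := qu u _ e0.
  exists (maxn N K) => k; rewrite geq_max => /andP[/hN h1 /hK h2].
  have := ler_hnorm_dist (p k (q k u)) (p k u) u; rewrite -bopB bopME.
  have := proj_bnd (pp k) (q k u - u); rewrite mul1r; lra.
Qed.

Lemma central_seq_commpq p q k : central_seq p -> central_seq q -> p k * q k = q k * p k.
Proof. by move=> cp [qM _ _ _]; apply: central_seq_commb => //; case: (qM k). Qed.

Lemma approx_refine x p b q : bdd_approx x p b -> central_seq q ->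
  bdd_approx x (fun k => p k * q k) (fun k => b k * q k).
Proof.
move=> ap cq; have [cp Mb bp _ _] := ap; have [qM pq _ _] := cq.
apply: affiliated_glue.
- exact: approx_affiliated ap.
- exact: central_seqM.
- by move=> k; apply: (vn_mul vnM) => //; case: (qM k).
- move=> k; rewrite -mulrA (mulrA (q k)) -(central_seq_commpq k cp cq).
  by rewrite -mulrA; have [-> _] := pq k; rewrite mulrA bp.
- by move=> k u; rewrite !bopME; exact: (approx_mem ap).
Qed.

(** The product of two central sequences refines both, so that two operators can be compared or
    combined term by term along one sequence. *)
Lemma approx_common x y p b q c : bdd_approx x p b -> bdd_approx y q c ->
  exists r b' c', bdd_approx x r b' /\ bdd_approx y r c'.
Proof.
move=> ax ay; have [cp _ _ _ _] := ax; have [cq _ _ _ _] := ay.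
exists (fun k => p k * q k), (fun k => b k * q k), (fun k => c k * p k).
split; first exact: approx_refine.
have := approx_refine ay cp; congr (bdd_approx y _ _).
by apply/funext => k; rewrite (central_seq_commpq k cp cq).
Qed.

Lemma glue_approx p b : central_seq p -> (forall k, M (b k)) ->
  (forall k, b k * p k = b k) -> (forall j k, (j <= k)%N -> p j * b k = b j) ->
  bdd_approx (glue_op p b) p b.
Proof. by move=> *; split. Qed.

(** The vectors [p k u] form a core of x, so an operator contained in x and defined on them has
    closure x. This computes the closures in [ls_add], [ls_mul] and [operator_of_mx]. *)
Lemma approx_closure (r : operator H) x p b : bdd_approx x p b ->
  (forall u v, r (u, v) -> x (u, v)) -> (forall k u, r (p k u, b k u)) ->
  op_closure r = x.
Proof.
move=> ap rx xr; apply/seteqP; split=> -[u v].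
  move=> /op_closureP[a [c [h au cv]]]; apply: (approx_closed ap).
  by apply: (op_closure_lim (u := a) (v := c)) => // n; exact: rx.
move=> xuv; have [[_ _ _ pu] _ _ _ _] := ap.
apply: (op_closure_lim (u := fun k => p k u) (v := fun k => p k v)) => // k.
by move: xuv; rewrite (approxE _ _ ap) => ->.
Qed.

Lemma approx_add x y p b c : bdd_approx x p b -> bdd_approx y p c ->
  bdd_approx (ls_add x y) p (fun k => b k + c k).
Proof.
move=> ax ay; have [cp Mb bp pb _] := ax; have [_ Mc cp' pc _] := ay.
have ag : bdd_approx (glue_op p (fun k => b k + c k)) p (fun k => b k + c k).
  apply: glue_approx => //.
  - by move=> k; apply: (vn_add vnM).
  - by move=> k; rewrite mulrDl bp cp'.
  - by move=> j k jk; rewrite mulrDr pb ?pc.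
rewrite /ls_add (approx_closure ag)//.
- move=> u v [w1 [w2 [/= + + ->]]]; rewrite (approxE _ _ ax) (approxE _ _ ay) => h1 h2 k /=.
  by rewrite bopD h1 h2.
- by move=> k u; exists (b k u), (c k u); split=> //=; [exact: (approx_mem ax)|exact: (approx_mem ay)].
Qed.

Lemma approx_mul x y p b c : bdd_approx x p b -> bdd_approx y p c ->
  bdd_approx (ls_mul x y) p (fun k => b k * c k).
Proof.
move=> ax ay; have [cp Mb bp pb _] := ax; have [_ Mc cp' pc _] := ay.
have ag : bdd_approx (glue_op p (fun k => b k * c k)) p (fun k => b k * c k).
  apply: glue_approx => //.
  - by move=> k; apply: (vn_mul vnM).
  - by move=> k; rewrite -mulrA cp'.
  - by move=> j k jk; rewrite mulrA pb// -{1}(bp j) -mulrA pc.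
rewrite /ls_mul (approx_closure ag)//.
- move=> u v [w /=]; rewrite (approxE _ _ ax) (approxE _ _ ay) => h2 h1 k /=.
  by rewrite h1 -h2 -bopME bp.
- move=> k u; exists (c k u) => /=; first exact: (approx_mem ay).
  by have := approx_mem ax k (c k u); rewrite -bopME pc.
Qed.

Lemma central_seq1 : central_seq (fun=> 1).
Proof.
split=> [k|k|k|u]; last exact: hcvg_cst.
- by split; [exact: (vn1 vnM)|apply: (commutantP vnM) => f _; exact/commr_sym/commr1].
- by split; [rewrite mulr1|exact: badj1].
- by rewrite mulr1.
Qed.

Lemma approx_graph p (f : bop) : central_seq p -> M f -> bdd_approx (op_graph f) p (fun k => f * p k).
Proof.
move=> cp Mf; have [pM pp _ _] := cp; apply: affiliated_glue => //.
- exact: affiliated_graph.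
- by move=> k; apply: (vn_mul vnM) => //; case: (pM k).
- by move=> k; rewrite -mulrA; have [-> _] := pp k.
Qed.

Lemma approx_opp x p b : bdd_approx x p b -> bdd_approx (glue_op p (fun k => - b k)) p (fun k => - b k).
Proof.
move=> [cp Mb bp pb _]; apply: glue_approx => //.
- by move=> k; apply: (vn_opp vnM).
- by move=> k; rewrite mulNr bp.
- by move=> j k jk; rewrite mulrN pb.
Qed.

Lemma LS_approx x : central_minorants -> LS M x -> exists p b, bdd_approx x p b.
Proof. by move=> cm [aff _]; exact: affiliated_approx. Qed.

End Approximation.

(** * Commutative von Neumann algebras *)

(** A bundle to which the canonical ring structures of [elt] and [ls] can be attached. *)
Record cvn (R : realType) (H : hilbertType R) := Cvn {
  cvn_set :> set (H -> H);
  cvnP : von_neumann_algebra cvn_set;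
  cvn_comm : commutative_algebra cvn_set
}.

Section CommutativeAlgebra.
Variables (R : realType) (H : hilbertType R) (A : cvn H).
Local Notation bop := (bop H).
Local Notation MA := (cvn_set A).

Lemma cvn_commutant (f : bop) : MA f -> commutant MA f.
Proof.
move=> Af; split; first exact: bop_bounded.
by move=> g Ag; exact: (@cvn_comm _ _ A _ _ Af Ag).
Qed.

Lemma cvn_central_minorants : central_minorants MA.
Proof.
move=> e Ae pe eS eu; exists e; split; last by move=> k; case: (pe k).
by split=> // k; split=> //; exact: cvn_commutant.
Qed.

Definition cvn_pred : {pred bop} := fun f : bop => `[< MA f >].

Fact cvn_subring : subring_closed cvn_pred.
Proof.
split; rewrite /cvn_pred /in_mem /=.
- by apply/asboolP; exact: vn1 (cvnP A).
- by move=> f g /asboolP Af /asboolP Ag; apply/asboolP; exact: (vn_sub (cvnP A)).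
- by move=> f g /asboolP Af /asboolP Ag; apply/asboolP; exact: (vn_mul (cvnP A)).
Qed.

HB.instance Definition _ := GRing.isSubringClosed.Build bop cvn_pred cvn_subring.

(** As a commutative ring in its own right, A gives access to determinants and adjugates of matrices
    over it. *)
Record elt := Elt { elt_bop :> bop; elt_in : elt_bop \in cvn_pred }.

HB.instance Definition _ := [isSub for elt_bop].
HB.instance Definition _ := [Choice of elt by <:].
HB.instance Definition _ := GRing.SubChoice_isSubPzRing.Build bop cvn_pred elt cvn_subring.

Lemma elt_mem (a : elt) : MA a.
Proof. by have := elt_in a; rewrite /cvn_pred /in_mem /= => /asboolP. Qed.

Fact elt_mulC : commutative (@GRing.mul elt).
Proof.
move=> a b; apply: val_inj; apply: bopP => u /=.
exact: (@cvn_comm _ _ A _ _ (elt_mem a) (elt_mem b)).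
Qed.

HB.instance Definition _ := GRing.PzRing_hasCommutativeMul.Build elt elt_mulC.

Lemma elt_exists (f : bop) : MA f -> exists a : elt, a = f :> bop.
Proof.
move=> Af; have Af' : f \in cvn_pred by rewrite /cvn_pred /in_mem /=; apply/asboolP.
by exists (Elt Af').
Qed.

Lemma elt_inj (a b : elt) : a = b :> bop -> a = b.
Proof. exact: val_inj. Qed.

Lemma eltP (a b : elt) : (forall u, a u = b u) -> a = b.
Proof. by move=> h; apply: val_inj; exact: bopP. Qed.

Lemma eltDE (a b : elt) : elt_bop (a + b) = elt_bop a + elt_bop b. Proof. by []. Qed.
Lemma eltME (a b : elt) : elt_bop (a * b) = elt_bop a * elt_bop b. Proof. by []. Qed.
Lemma elt1E : elt_bop 1 = 1. Proof. by []. Qed.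
Lemma elt0E : elt_bop 0 = 0. Proof. by []. Qed.
Lemma eltNE (a : elt) : elt_bop (- a) = - elt_bop a. Proof. by []. Qed.
Lemma eltBE (a b : elt) : elt_bop (a - b) = elt_bop a - elt_bop b. Proof. by []. Qed.
Definition eltE := (eltDE, eltBE, eltME, elt1E, elt0E, eltNE).

Definition star (a : elt) : elt := sval (cid (elt_exists (vn_badj (cvnP A) (elt_mem a)))).

Lemma starE a : star a = badj a :> bop.
Proof. by rewrite /star; case: cid. Qed.

Fact star_zmod : zmod_morphism star.
Proof. by move=> a b; apply: elt_inj; rewrite starE !eltBE badjB !starE. Qed.
Fact star_monoid : monoid_morphism star.
Proof.
split; first by apply: elt_inj; rewrite starE elt1E badj1.
by move=> a b; rewrite mulrC; apply: elt_inj; rewrite starE !eltME badjM !starE.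
Qed.

HB.instance Definition _ := GRing.isZmodMorphism.Build elt elt star star_zmod.
HB.instance Definition _ := GRing.isMonoidMorphism.Build elt elt star star_monoid.

(** The uniform bound belongs to the notion because multiplication is jointly continuous for strong
    convergence on bounded sets only. *)
Definition scvg (a : nat -> elt) (l : elt) :=
  (exists C, forall k, bnd (a k) C) /\ forall u, hcvg (fun k => a k u) (l u).

Lemma scvg_cst l : scvg (fun=> l) l.
Proof.
split; last by move=> u; exact: hcvg_cst.
by have [C _ lC] := bop_bound l; exists C => k.
Qed.

Lemma scvgD a b l m : scvg a l -> scvg b m -> scvg (fun k => a k + b k) (l + m).
Proof.
move=> [[C aC] al] [[D bD] bm]; split; last by move=> u; exact: hcvgD.
by exists (C + D) => k; exact: bndD.
Qed.

Lemma scvgM a b l m : scvg a l -> scvg b m -> scvg (fun k => a k * b k) (l * m).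
Proof.
move=> [[C aC] al] [[D bD] bm]; split.
  exists (`|C| * D) => k; apply: bndM => // u; apply: le_trans (aC k u) _.
  by rewrite ler_wpM2r ?hnorm_ge0// ler_norm.
move=> u e e0; have C1 : 0 < `|C| + 1 by rewrite ltr_wpDl.
have [N hN] := bm u _ (divr_gt0 e0 (mulr_gt0 (ltr0n R 2) C1)).
have [K hK] := al (m u) _ (divr_gt0 e0 (ltr0n R 2)).
exists (maxn N K) => k; rewrite geq_max => /andP[/hN h1 /hK h2].
have := ler_hnorm_dist (a k (b k u)) (a k (m u)) (l (m u)); rewrite -bopB.
have := aC k (b k u - m u) => h3.
have h4 : hnorm (a k (b k u - m u)) <= (`|C| + 1) * hnorm (b k u - m u).
  apply: le_trans h3 _; rewrite ler_wpM2r ?hnorm_ge0//.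
  by apply: le_trans (ler_norm _) _; rewrite lerDl.
move: h1; rewrite invfM mulrA ltr_pdivlMr// mulrC => h1; rewrite !eltE !bopE; lra.
Qed.

(** The determinant is a polynomial in the entries, and bounded strong convergence is stable under
    sums and products. *)
Lemma scvg_det n (a : nat -> 'M[elt]_n) (l : 'M[elt]_n) : (forall i j, scvg (fun k => a k i j) (l i j)) ->
  scvg (fun k => \det (a k)) (\det l).
Proof.
move=> al; rewrite /determinant.
have sumP (I : Type) (r : seq I) (f : nat -> I -> elt) g : (forall i, scvg (f^~ i) (g i)) ->
    scvg (fun k => \sum_(i <- r) f k i) (\sum_(i <- r) g i).
  move=> h; elim: r => [|i r IH].
    by under eq_fun do rewrite big_nil; rewrite big_nil; exact: scvg_cst.
  by under eq_fun do rewrite big_cons; rewrite big_cons; exact: scvgD.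
have prodP (I : Type) (r : seq I) (f : nat -> I -> elt) g : (forall i, scvg (f^~ i) (g i)) ->
    scvg (fun k => \prod_(i <- r) f k i) (\prod_(i <- r) g i).
  move=> h; elim: r => [|i r IH].
    by under eq_fun do rewrite big_nil; rewrite big_nil; exact: scvg_cst.
  by under eq_fun do rewrite big_cons; rewrite big_cons; exact: scvgM.
apply: sumP => s; apply: scvgM; first exact: scvg_cst.
by apply: prodP => i; exact: al.
Qed.

End CommutativeAlgebra.

(** * Matrix algebras *)

Section MatrixAlgebra.
Variables (R : realType) (H : hilbertType R) (n : nat) (A : cvn H).
Local Notation MA := (cvn_set A).
Local Notation K := (hilbert_pow H n).
Local Notation Mn := (matrix_algebra n MA).
Implicit Types (a b : 'M[elt A]_n) (u v : K).

Lemma hcoord_sum (I : Type) (r : seq I) (P : pred I) (F : I -> K) i :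
  hcoord (\sum_(j <- r | P j) F j) i = \sum_(j <- r | P j) hcoord (F j) i.
Proof.
elim/big_rec2: _ => [|j x y _ IH]; first exact: hcoord0.
by rewrite hcoordD IH.
Qed.

Fact bounded_coord (f : K -> K) : linear f ->
  (exists C, forall i u, hnorm (hcoord (f u) i) <= C * hnorm u) -> bounded_op f.
Proof.
move=> lf [C fC]; split=> //; exists ((n%:R + 1) * `|C|) => u.
rewrite -mulrA; apply: hnorm_pow_le => [|i]; first by rewrite mulr_ge0 ?hnorm_ge0.
by apply: le_trans (fC i u) _; rewrite ler_wpM2r ?hnorm_ge0// ler_norm.
Qed.

Definition mxfun (a : 'M[elt A]_n) (u : K) : K :=
  hvec (fun i => \sum_j a i j (hcoord u j)).

Fact mxfun_bounded a : bounded_op (mxfun a).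
Proof.
have /choice[C hC] : forall ij : 'I_n * 'I_n, exists C, 0 < C /\ bnd (a ij.1 ij.2) C.
  by move=> ij; have [C C0 aC] := bop_bound (a ij.1 ij.2); exists C.
apply: bounded_coord.
  move=> c u v; apply: hcoordP => i; rewrite hcoordD hcoordZ !hvecE scaler_sumr -big_split.
  by apply: eq_bigr => j _; rewrite hcoordD hcoordZ bopD bopZ.
exists (\sum_i \sum_j C (i, j)) => i u; rewrite hvecE [X in _ <= X * _](bigD1 i)//= mulrDl.
rewrite ler_wpDr//.
  by rewrite mulr_ge0 ?hnorm_ge0//; apply: sumr_ge0 => k _; apply: sumr_ge0 => j _; rewrite ltW//; case: (hC (k, j)).
rewrite mulr_suml; elim/big_ind2: _ => [|x c y d xc yd|j _]; first by rewrite hnorm0.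
  by apply: le_trans (ler_hnormD _ _) _; exact: lerD.
have [C0 aC] := hC (i, j); apply: le_trans (aC _) _.
by rewrite ler_pM2l// hnorm_coord.
Qed.

Definition mxop a : bop K := Bop (mxfun_bounded a).

Lemma mxopE a u i : hcoord (mxop a u) i = \sum_j a i j (hcoord u j).
Proof. by rewrite /= hvecE. Qed.

Lemma bop_sum (V : hilbertType R) (f : bop V) (I : Type) (r : seq I) (P : pred I) (F : I -> V) :
  f (\sum_(j <- r | P j) F j) = \sum_(j <- r | P j) f (F j).
Proof.
elim/big_rec2: _ => [|j x y _ IH]; first exact: bop0.
by rewrite bopD IH.
Qed.

Lemma elt_sumE (I : Type) (r : seq I) (P : pred I) (F : I -> elt A) x :
  (\sum_(j <- r | P j) F j) x = \sum_(j <- r | P j) F j x.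
Proof.
elim/big_rec2: _ => [|j y z _ IH]; first by rewrite elt0E.
by rewrite eltDE bopDE IH.
Qed.

Fact mxop_zmod : zmod_morphism mxop.
Proof.
move=> a b; apply: bopP => u; apply: hcoordP => i.
rewrite bopBE hcoordD hcoordN !mxopE -sumrB; apply: eq_bigr => j _.
by rewrite !mxE eltDE eltNE bopDE bopNE.
Qed.

Fact mxop_monoid : monoid_morphism mxop.
Proof.
split=> [|a b]; apply: bopP => u; apply: hcoordP => i.
  rewrite mxopE bop1E (bigD1 i)//= mxE eqxx elt1E bop1E big1 ?addr0// => j ji.
  by rewrite mxE eq_sym (negbTE ji) elt0E.
rewrite bopME !mxopE.
under [RHS]eq_bigr do rewrite mxopE bop_sum.
rewrite exchange_big /=; apply: eq_bigr => j _; rewrite mxE elt_sumE.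
by apply: eq_bigr => k _; rewrite eltME bopME.
Qed.

HB.instance Definition _ := GRing.isZmodMorphism.Build 'M[elt A]_n (bop K) mxop mxop_zmod.
HB.instance Definition _ := GRing.isMonoidMorphism.Build 'M[elt A]_n (bop K) mxop mxop_monoid.

Lemma mxopM a b : mxop (a *m b) = mxop a * mxop b. Proof. exact: rmorphM. Qed.
Lemma mxopD a b : mxop (a + b) = mxop a + mxop b. Proof. exact: rmorphD. Qed.

Definition dvec (j : 'I_n) (x : H) : K := hvec (fun i => if i == j then x else 0).

Lemma dvecE j x i : hcoord (dvec j x) i = if i == j then x else 0.
Proof. exact: hvecE. Qed.

Lemma hnorm_dvec j x : hnorm (dvec j x) = hnorm x.
Proof.
rewrite !hnormE rdot_powE (bigD1 j)//= dvecE eqxx big1 ?addr0// => i ij.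
by rewrite dvecE (negbTE ij) rdot0l.
Qed.

Lemma dvec_lin j (c : R[i]) x y : dvec j (c *: x + y) = c *: dvec j x + dvec j y.
Proof.
apply: hcoordP => i; rewrite hcoordD hcoordZ !dvecE; case: eqP => // _.
by rewrite scaler0 addr0.
Qed.

Lemma dvec_sum u : u = \sum_j dvec j (hcoord u j).
Proof.
apply: hcoordP => i; rewrite hcoord_sum (bigD1 i)//= dvecE eqxx big1 ?addr0// => j ji.
by rewrite dvecE eq_sym (negbTE ji).
Qed.

Lemma mxop_dvec a j x i : hcoord (mxop a (dvec j x)) i = a i j x.
Proof.
rewrite mxopE (bigD1 j)//= dvecE eqxx big1 ?addr0// => k kj.
by rewrite dvecE (negbTE kj) bop0.
Qed.

Lemma mxop_inj : injective mxop.
Proof.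
move=> a b ab; apply/matrixP => i j; apply: eltP => x.
by rewrite -!mxop_dvec ab.
Qed.

Lemma mxop_mem a : Mn (mxop a).
Proof.
exists (\matrix_(i, j) (a i j : H -> H)); split; first by move=> i j; rewrite mxE; exact: elt_mem.
by move=> u i; rewrite mxopE; apply: eq_bigr => j _; rewrite mxE.
Qed.

Lemma mxopP (f : K -> K) : Mn f -> exists a, f = mxop a.
Proof.
move=> [m [Am fm]].
have /choice[g hg] : forall ij : 'I_n * 'I_n, exists b : elt A, m ij.1 ij.2 = b.
  move=> [i j]; have [b hb] := elt_exists (A := A) (f := Bop (vn_bounded (cvnP A) (Am i j))) (Am i j).
  by exists b; rewrite hb.
exists (\matrix_(i, j) g (i, j)); apply/funext => u; apply: hcoordP => i.
by rewrite fm mxopE; apply: eq_bigr => j _; rewrite mxE -hg.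
Qed.

Lemma badj_mxop a : badj (mxop a) = mxop (map_mx (@star R H A) a^T).
Proof.
apply: badj_unique => u v; rewrite !rdot_powE.
have rsuml (I : Type) (r : seq I) (F : I -> H) y : rdot (\sum_(j <- r) F j) y = \sum_(j <- r) rdot (F j) y.
  by elim/big_rec2: _ => [|j x z _ IH]; rewrite ?rdot0l// rdotDl IH.
under eq_bigr do rewrite mxopE rsuml.
rewrite exchange_big /=; apply: eq_bigr => j _.
rewrite mxopE rdotC rsuml; apply: eq_bigr => i _.
by rewrite !mxE starE badjPl rdotC.
Qed.

Lemma diag_bounded (c : bop H) : bounded_op (fun u : K => hvec (fun i => c (hcoord u i))).
Proof.
apply: bounded_coord.
  move=> d u v; apply: hcoordP => i; rewrite [RHS]hcoordD hcoordZ [LHS]hvecE hcoordD hcoordZ bopD bopZ.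
  by congr (_ *: _ + _); rewrite hvecE.
have [C C0 cC] := bop_bound c; exists C => i u; rewrite hvecE.
by apply: le_trans (cC _) _; rewrite ler_pM2l// hnorm_coord.
Qed.

Definition diagop (c : bop H) : bop K := Bop (diag_bounded c).

Lemma diagopE c u i : hcoord (diagop c u) i = c (hcoord u i).
Proof. by rewrite /= hvecE. Qed.

Lemma mxop_scalar (c : elt A) : mxop c%:M = diagop c.
Proof.
apply: bopP => u; apply: hcoordP => i; rewrite mxopE diagopE (bigD1 i)//= mxE eqxx mulr1n.
by rewrite big1 ?addr0// => j ji; rewrite mxE eq_sym (negbTE ji) mulr0n.
Qed.

Lemma diagop_commutant (c : bop H) : commutant MA c -> commutant Mn (diagop c).
Proof.
move=> cc; split; first exact: bop_bounded.
move=> _ /mxopP[a ->] u /=; apply: hcoordP => i.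
rewrite !hvecE bop_sum; apply: eq_bigr => j _; rewrite hvecE.
by have [_] := cc; apply; exact: elt_mem.
Qed.

Lemma dvec_diagop (c : bop H) j x : dvec j (c x) = diagop c (dvec j x).
Proof.
by apply: hcoordP => i; rewrite diagopE !dvecE; case: eqP => // _; rewrite bop0.
Qed.

(** Diagonal operators with constant entry g in A' commute with all matrices over A. An operator in
    the bicommutant commutes with them, so each of its entries commutes with A' and hence lies in
    A. *)
Lemma matrix_algebra_vn : von_neumann_algebra Mn.
Proof.
split.
  move=> _ g /mxopP[a ->] /is_adjointE ->; rewrite badj_mxop; exact: mxop_mem.
apply/seteqP; split=> f.
  move=> [fb fc]; pose F := Bop fb.
  have eb i j : bounded_op (fun x => hcoord (F (dvec j x)) i).
    split; first by move=> c x y; rewrite dvec_lin bopD bopZ hcoordD hcoordZ.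
    have [C C0 FC] := bop_bound F; exists C => x; apply: le_trans (hnorm_coord _ _) _.
    by rewrite -(hnorm_dvec j x); exact: FC.
  have eA i j : MA (Bop (eb i j)).
    apply: (vn_bicomm (cvnP A)) => g gA; apply: bopP => x; rewrite !bopME /=.
    have := fc _ (diagop_commutant gA) (dvec j x) => /= /(congr1 (fun u => hcoord u i)).
    by rewrite -[hvec _]/(diagop g (dvec j x)) dvec_diagop => ->; rewrite hvecE.
  exists (\matrix_(i, j) (Bop (eb i j) : H -> H)); split.
    by move=> i j; rewrite mxE; exact: eA.
  move=> u i; rewrite -[f u]/(F u) [in LHS](dvec_sum u) bop_sum hcoord_sum.
  by apply: eq_bigr => j _; rewrite mxE.
move=> Mf; have [a ef] := mxopP Mf; split; first by rewrite ef; exact: bop_bounded.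
by move=> g [_ gc] x; have := gc f Mf x.
Qed.

Hypothesis n_gt0 : (0 < n)%N.

(** Commutation with the matrix units forces a scalar matrix; [n_gt0] provides an index at which to
    read the scalar. *)
Lemma central_mxop a : commutant Mn (mxop a) -> exists c : elt A, a = c%:M.
Proof.
case=> _ ca; pose i0 := Ordinal n_gt0; exists (a i0 i0).
have cd i j : a *m delta_mx i j = delta_mx i j *m a.
  apply: mxop_inj; apply: bopP => u.
  by rewrite !mxopM; exact: ca (mxop_mem _) u.
apply/matrixP => i j; rewrite mxE.
have := congr1 (fun m : 'M[elt A]_n => m i i0) (cd j i0).
rewrite !mxE (bigD1 j)//= mxE !eqxx mulr1 big1 ?addr0; last first.
  by move=> k kj; rewrite mxE (negbTE kj) mulr0.
move=> ->; rewrite (bigD1 i0)//= mxE eqxx andbT big1 ?addr0; last first.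
  by move=> k kj; rewrite mxE (negbTE kj) andbF mul0r.
by case: eqP => _; rewrite ?mul1r ?mul0r.
Qed.

Lemma elt_central_seq (p : nat -> elt A) : (forall k, p k * p k = p k) ->
  (forall k, star (p k) = p k) -> (forall k, p k.+1 * p k = p k) ->
  (forall x : H, hcvg (fun k => p k x) x) -> central_seq MA (fun k => elt_bop (p k)).
Proof.
move=> pp ps pS pu; split=> //.
- by move=> k; split; [exact: elt_mem|exact/cvn_commutant/elt_mem].
- by move=> k; split; [rewrite -eltME pp|rewrite /hermitian_op -starE ps].
- by move=> k; rewrite -eltME pS.
Qed.

Lemma central_seq_diag (p : nat -> elt A) : central_seq MA (fun k => elt_bop (p k)) ->
  central_seq Mn (fun k => mxop (p k)%:M).
Proof.
move=> [pM pp pS pu]; split.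
- move=> k; split; first exact: mxop_mem.
  by rewrite mxop_scalar; apply: diagop_commutant; case: (pM k).
- move=> k; have [p2 ph] := pp k; split.
    rewrite -mxopM -scalar_mxM; congr (mxop _%:M).
    by apply: elt_inj; rewrite eltME.
  rewrite /hermitian_op badj_mxop tr_scalar_mx map_scalar_mx; congr (mxop _%:M).
  by apply: elt_inj; rewrite starE.
- move=> k; rewrite -mxopM -scalar_mxM; congr (mxop _%:M).
  by apply: elt_inj; rewrite eltME.
- move=> u; apply: hcvg_pow => i; have := pu (hcoord u i); congr hcvg.
  by apply/funext => k; rewrite mxop_scalar diagopE.
Qed.

Lemma central_seq_diagE (P : nat -> bop K) : central_seq Mn P ->
  exists p : nat -> elt A, central_seq MA (fun k => elt_bop (p k)) /\ P = (fun k => mxop (p k)%:M).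
Proof.
move=> [PM PP PS Pu].
have /choice[p hp] : forall k, exists c : elt A, P k = mxop c%:M.
  move=> k; have [/mxopP[a aE] Pc] := PM k; have [|c ac] := @central_mxop a.
    by rewrite -aE.
  by exists c; apply: bopP => u; rewrite aE ac.
have scal (c d : elt A) : mxop c%:M = mxop d%:M -> c = d.
  move=> /mxop_inj/matrixP/(_ (Ordinal n_gt0) (Ordinal n_gt0)).
  by rewrite !mxE eqxx !mulr1n.
exists p; split; last exact/funext.
apply: elt_central_seq.
- by move=> k; apply: scal; rewrite scalar_mxM mxopM -!hp; have [-> _] := PP k.
- move=> k; apply: scal; rewrite -map_scalar_mx -[X in map_mx _ X]tr_scalar_mx -badj_mxop -hp.
  by case: (PP k).
- by move=> k; apply: scal; rewrite scalar_mxM mxopM -!hp PS.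
- move=> x; have i0 := Ordinal n_gt0; have := hcvg_coord i0 (Pu (dvec i0 x)).
  rewrite dvecE eqxx; congr hcvg; apply/funext => k.
  by rewrite hp mxop_dvec mxE eqxx mulr1n.
Qed.

(** Multiplicativity of the determinant carries idempotence and monotonicity over from e to g, and
    its compatibility with transposition and [star] carries self-adjointness. From e = e^2 and e
    adj(e) = det(e) one gets e g = g. *)
Lemma matrix_central_minorants : central_minorants Mn.
Proof.
move=> e Me pe eS eu.
have /choice[a ha] : forall k, exists a, e k = mxop a.
  by move=> k; have [a aE] := mxopP (Me k); exists a; apply: bopP => u; rewrite aE.
pose g k := \det (a k).
have gg k : a k *m a k = a k.
  by apply: mxop_inj; rewrite mxopM -ha; case: (pe k).
have gcs : central_seq MA (fun k => elt_bop (g k)).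
  apply: elt_central_seq.
  - by move=> k; rewrite /g -det_mulmx gg.
  - move=> k; rewrite /g -det_map_mx -det_tr map_trmx; congr (\det _).
    by apply: mxop_inj; rewrite -badj_mxop -ha; case: (pe k).
  - move=> k; rewrite /g -det_mulmx; congr (\det _).
    by apply: mxop_inj; rewrite mxopM -!ha.
  - have : scvg g (\det (1%:M : 'M[elt A]_n)).
      apply: (@scvg_det _ _ A n a 1%:M) => i j; split.
        exists 1 => k x; rewrite -mxop_dvec -ha mul1r; apply: le_trans (hnorm_coord _ _) _.
        by have := proj_bnd (pe k) (dvec j x); rewrite mul1r hnorm_dvec.
      move=> x; have := hcvg_coord i (eu (dvec j x)); rewrite dvecE mxE.
      have -> : (if i == j then x else 0) = ((i == j)%:R : elt A) x by case: eqP.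
      by congr hcvg; apply/funext => k; rewrite ha mxop_dvec.
    by rewrite det1 => -[].
exists (fun k => mxop (g k)%:M); split; first exact: central_seq_diag.
by move=> k; rewrite ha -mxopM /g -mul_mx_adj mulmxA gg.
Qed.

End MatrixAlgebra.

(** * The ring of locally measurable operators *)

Section LSRing.
Variables (R : realType) (H : hilbertType R) (A : cvn H).
Local Notation bop := (bop H).
Local Notation MA := (cvn_set A).
Let vnA := cvnP A.

Record ls := Ls { ls_op : operator H; ls_in : LS MA ls_op }.

HB.instance Definition _ := gen_eqMixin ls.
HB.instance Definition _ := gen_choiceMixin ls.

Lemma ls_inj (x y : ls) : ls_op x = ls_op y -> x = y.
Proof.
case: x y => [x hx] [y hy] /= e; rewrite -e in hy *.
by congr Ls; exact: Prop_irrelevance.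
Qed.

Implicit Types (x y z : ls) (p q : nat -> bop).

Definition lsapp x p (b : nat -> elt A) := bdd_approx MA (ls_op x) p (fun k => b k).

Lemma approx_elt (x : operator H) p b : bdd_approx MA x p b ->
  exists c : nat -> elt A, bdd_approx MA x p (fun k => c k).
Proof.
move=> ap; have [_ Mb _ _ _] := ap.
have /choice[c hc] : forall k, exists c : elt A, c = b k :> bop by move=> k; exact: elt_exists.
by exists c; rewrite (_ : (fun k => elt_bop (c k)) = b)//; exact/funext.
Qed.

(** The ring axioms involve at most three elements, so three approximations along one central
    sequence are enough to check them on coefficients. *)
Lemma lsapp_seq x y z : exists p b c d, [/\ lsapp x p b, lsapp y p c & lsapp z p d].
Proof.
have [p [b xb]] := LS_approx vnA (@cvn_central_minorants R H A) (ls_in x).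
have [q [c yc]] := LS_approx vnA (@cvn_central_minorants R H A) (ls_in y).
have [r [d zd]] := LS_approx vnA (@cvn_central_minorants R H A) (ls_in z).
have [p' [b' [c' [xb' yc']]]] := approx_common vnA xb yc.
have [cp' _ _ _ _] := xb'; have [cr _ _ _ _] := zd.
have := approx_refine vnA xb' cr; have := approx_refine vnA yc' cr.
have := approx_refine vnA zd cp'.
have -> : (fun k => r k * p' k) = (fun k => p' k * r k).
  by apply/funext => k; rewrite (central_seq_commpq k cr cp').
move=> /approx_elt[d0 hd] /approx_elt[c0 hc] /approx_elt[b0 hb].
by exists (fun k => p' k * r k), b0, c0, d0.
Qed.

Lemma lsapp_eq x y p b c : lsapp x p b -> lsapp y p c -> (forall k, b k = c k) -> x = y.
Proof.
move=> xb yc bc; apply: ls_inj; move: xb yc.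
rewrite /lsapp (_ : (fun k => elt_bop (b k)) = (fun k => elt_bop (c k))).
  by move=> [_ _ _ _ ->] [_ _ _ _ ->].
by apply/funext => k; rewrite bc.
Qed.

Lemma lsapp_coef x p b c : lsapp x p b -> lsapp x p c -> forall k, b k = c k.
Proof. by move=> xb xc k; apply: elt_inj; have /(congr1 (fun f => f k)) := approx_coef xb xc. Qed.

Fact ls_add_in x y : LS MA (ls_add (ls_op x) (ls_op y)).
Proof.
have [p [b [c [_ [xb yc _]]]]] := lsapp_seq x y y.
exact (approx_LS vnA (approx_add vnA xb yc)).
Qed.

Fact ls_mul_in x y : LS MA (ls_mul (ls_op x) (ls_op y)).
Proof.
have [p [b [c [_ [xb yc _]]]]] := lsapp_seq x y y.
exact (approx_LS vnA (approx_mul vnA xb yc)).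
Qed.

Fact ls_opp_in x : LS MA [set z | ls_op x (z.1, - z.2)].
Proof.
have [p [b [c [_ [xb _ _]]]]] := lsapp_seq x x x.
apply: (approx_LS vnA (p := p) (b := fun k => - elt_bop (b k))).
have := approx_opp vnA xb; congr (bdd_approx _ _ _ _).
apply/seteqP; split=> -[u v] /=; rewrite (approxE _ _ xb) => h k; have := h k;
  rewrite bopN bopNE.
  by move=> ->; rewrite opprK.
by move=> <-; rewrite opprK.
Qed.

Fact ls_graph_in (a : elt A) : LS MA (op_graph a).
Proof. exact: (approx_LS vnA (approx_graph vnA (central_seq1 vnA) (elt_mem a))). Qed.

Definition lsgraph (a : elt A) := Ls (ls_graph_in a).
Definition lsadd x y := Ls (ls_add_in x y).
Definition lsmul x y := Ls (ls_mul_in x y).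
Definition lsopp x := Ls (ls_opp_in x).

Lemma lsapp_add x y p b c : lsapp x p b -> lsapp y p c ->
  lsapp (lsadd x y) p (fun k => b k + c k).
Proof. exact: approx_add. Qed.

Lemma lsapp_mul x y p b c : lsapp x p b -> lsapp y p c ->
  lsapp (lsmul x y) p (fun k => b k * c k).
Proof. exact: approx_mul. Qed.

Lemma lsapp_opp x p b : lsapp x p b -> lsapp (lsopp x) p (fun k => - b k).
Proof.
move=> xb; have := approx_opp vnA xb; rewrite /lsapp; congr (bdd_approx _ _ _ _).
apply/seteqP; split=> -[u v] /=; rewrite (approxE _ _ xb) => h k; have := h k;
  rewrite bopN bopNE.
  by move=> ->; rewrite opprK.
by move=> <-; rewrite opprK.
Qed.

Lemma lsapp_graph x p b (a : elt A) : lsapp x p b -> exists2 q : nat -> elt A,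
  (forall k, q k = p k :> bop) & lsapp (lsgraph a) p (fun k => a * q k).
Proof.
move=> [cp _ _ _ _]; have [pM _ _ _] := cp.
have /choice[q hq] : forall k, exists c : elt A, c = p k :> bop.
  by move=> k; apply: elt_exists; case: (pM k).
exists q => //; have := approx_graph vnA cp (elt_mem a); congr (bdd_approx _ _ _ _).
by apply/funext => k; rewrite eltME hq.
Qed.

Lemma lsapp_proj x p b (q : nat -> elt A) : lsapp x p b -> (forall k, q k = p k :> bop) ->
  forall k, q k * b k = b k.
Proof.
by move=> [_ _ _ pb _] qp k; apply: elt_inj; rewrite eltME qp pb.
Qed.

Fact lsaddA : associative lsadd.
Proof.
move=> x y z; have [p [b [c [d [xb yc zd]]]]] := lsapp_seq x y z.
apply: (lsapp_eq (lsapp_add xb (lsapp_add yc zd)) (lsapp_add (lsapp_add xb yc) zd)).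
by move=> k; rewrite addrA.
Qed.

Fact lsaddC : commutative lsadd.
Proof.
move=> x y; have [p [b [c [d [xb yc _]]]]] := lsapp_seq x y y.
by apply: (lsapp_eq (lsapp_add xb yc) (lsapp_add yc xb)) => k; rewrite addrC.
Qed.

Fact lsadd0 : left_id (lsgraph 0) lsadd.
Proof.
move=> x; have [p [b [c [d [xb _ _]]]]] := lsapp_seq x x x.
have [q _ h0] := lsapp_graph 0 xb.
by apply: (lsapp_eq (lsapp_add h0 xb) xb) => k; rewrite mul0r add0r.
Qed.

Fact lsaddN : left_inverse (lsgraph 0) lsopp lsadd.
Proof.
move=> x; have [p [b [c [d [xb _ _]]]]] := lsapp_seq x x x.
have [q _ h0] := lsapp_graph 0 xb.
by apply: (lsapp_eq (lsapp_add (lsapp_opp xb) xb) h0) => k; rewrite mul0r addNr.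
Qed.

HB.instance Definition _ := GRing.isZmodule.Build ls lsaddA lsaddC lsadd0 lsaddN.

Fact lsmulA : associative lsmul.
Proof.
move=> x y z; have [p [b [c [d [xb yc zd]]]]] := lsapp_seq x y z.
apply: (lsapp_eq (lsapp_mul xb (lsapp_mul yc zd)) (lsapp_mul (lsapp_mul xb yc) zd)).
by move=> k; rewrite mulrA.
Qed.

Fact lsmulC : commutative lsmul.
Proof.
move=> x y; have [p [b [c [d [xb yc _]]]]] := lsapp_seq x y y.
by apply: (lsapp_eq (lsapp_mul xb yc) (lsapp_mul yc xb)) => k; rewrite mulrC.
Qed.

Fact lsmul1 : left_id (lsgraph 1) lsmul.
Proof.
move=> x; have [p [b [c [d [xb _ _]]]]] := lsapp_seq x x x.
have [q qp h1] := lsapp_graph 1 xb.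
by apply: (lsapp_eq (lsapp_mul h1 xb) xb) => k; rewrite mul1r (lsapp_proj xb qp).
Qed.

Fact lsmulDl : left_distributive lsmul lsadd.
Proof.
move=> x y z; have [p [b [c [d [xb yc zd]]]]] := lsapp_seq x y z.
apply: (lsapp_eq (lsapp_mul (lsapp_add xb yc) zd) (lsapp_add (lsapp_mul xb zd) (lsapp_mul yc zd))).
by move=> k; rewrite mulrDl.
Qed.

Fact lsmulr1 : right_id (lsgraph 1) lsmul.
Proof. by move=> x; rewrite lsmulC lsmul1. Qed.
Fact lsmulDr : right_distributive lsmul lsadd.
Proof. by move=> x y z; rewrite !(lsmulC x) lsmulDl. Qed.

HB.instance Definition _ := GRing.Zmodule_isPzRing.Build ls
  lsmulA lsmul1 lsmulr1 lsmulDl lsmulDr.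
HB.instance Definition _ := GRing.PzRing_hasCommutativeMul.Build ls lsmulC.

Lemma lsM_app x y p b c : lsapp x p b -> lsapp y p c -> lsapp (x * y) p (fun k => b k * c k).
Proof. exact: lsapp_mul. Qed.

(** The quasi-inverse is (a^* a)^-1 a^* off the kernel of a and 0 on it. It may be unbounded, so it
    is glued from [c k * star a], where [c k] inverts [star a * a] on the range of [e k]. *)
Lemma lsgraph_regular (a : elt A) : exists y, lsgraph a * y * lsgraph a = lsgraph a.
Proof.
have [||e0' [e' [c' [[pe eS eu] [ce0 ce cc] [pe0 Te0 e0e] Tc [cec ec]]]]] :=
  @spectral_inverse R H (star a * a).
- by rewrite /hermitian_op eltME starE badjM badjK.
- by move=> u; rewrite eltME bopME starE badjPl rdot_ge0.
have inA (f : bop) : (forall g, GRing.comm g (elt_bop (star a * a)) -> GRing.comm g f) ->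
    exists b : elt A, b = f :> bop.
  move=> h; apply: elt_exists; apply: (vn_bicomm vnA) => g Mg; apply: h.
  by apply: (vn_comm _ Mg); exact: elt_mem.
have [e0 he0] := inA _ ce0.
have /choice[e he] : forall k, exists b : elt A, b = e' k :> bop by move=> k; apply: inA; exact: ce.
have /choice[c hc] : forall k, exists b : elt A, b = c' k :> bop by move=> k; apply: inA; exact: cc.
(* |a e0 u|^2 = <e0 u, a^* a e0 u>, and e0 projects on the kernel of [star a * a]. *)
have ae0 : a * e0 = 0.
  apply: eltP => u; rewrite eltME elt0E bopME bop0E he0; apply: rdot_eq0.
  have := congr1 (fun f : bop => f u) Te0; rewrite eltME !bopME bop0E starE => h.
  by rewrite badjP h rdot0r.
have e0e0 : e0 * e0 = e0 by apply: elt_inj; rewrite eltME he0; case: pe0.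
have ee k : e k * e k = e k by apply: elt_inj; rewrite eltME he; case: (pe k).
have e0ek k : e0 * e k = 0 by apply: elt_inj; rewrite eltME he he0 e0e.
have Tce k : star a * a * c k = e k by apply: elt_inj; rewrite eltME hc he Tc.
have ce' k : c k * e k = c k by apply: elt_inj; rewrite !eltME hc he cec.
have ecj j k : (j <= k)%N -> e j * c k = c j.
  by move=> jk; apply: elt_inj; rewrite !eltME !hc he ec.
have e0c k : e0 * c k = 0 by rewrite -ce' mulrCA e0ek mulr0.
have herm0 : star e0 = e0 by apply: elt_inj; rewrite starE he0; case: pe0.
have hermk k : star (e k) = e k by apply: elt_inj; rewrite starE he; case: (pe k).
(* The kernel part is added so that the sequence increases to 1; the coefficients [y0 k] vanish on
   it. *)
pose p k := e0 + e k.
have eSk k : e k.+1 * e k = e k by apply: elt_inj; rewrite eltME !he eS.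
have hermp k : star (p k) = p k.
  by rewrite -[RHS](_ : star e0 + star (e k) = _); [exact: rmorphD|rewrite herm0 hermk].
have cp : central_seq MA (fun k => elt_bop (p k)).
  split.
  - by move=> k; split; [exact: elt_mem|exact/cvn_commutant/elt_mem].
  - move=> k; split; last by rewrite /hermitian_op -starE hermp.
    rewrite -eltME /p mulrDl !mulrDr e0e0 e0ek ee (mulrC (e k)) e0ek addr0 add0r //.
  - move=> k; rewrite -eltME /p mulrDl !mulrDr e0e0 e0ek (mulrC (e k.+1) e0) e0ek.
    by rewrite addr0 add0r eSk.
  - move=> u; have := hcvgD (hcvg_cst (e0' u)) (eu u); rewrite addrC subrK.
    by congr hcvg; apply/funext => k; rewrite /p eltDE bopDE he0 he.
pose y0 k := c k * star a.
have ay : bdd_approx MA (glue_op (fun k => elt_bop (p k)) (fun k => elt_bop (y0 k)))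
    (fun k => p k) (fun k => y0 k).
  apply: glue_approx => //.
  - by move=> k; exact: elt_mem.
  - move=> k; rewrite -eltME /y0 /p; congr elt_bop.
    have -> : c k * star a * (e0 + e k) = (e0 * c k + c k * e k) * star a by ring.
    by rewrite e0c add0r ce'.
  - move=> j k jk; rewrite -eltME /y0 /p; congr elt_bop.
    have -> : (e0 + e j) * (c k * star a) = (e0 * c k + e j * c k) * star a by ring.
    by rewrite e0c add0r ecj.
pose y := Ls (approx_LS vnA ay).
exists y; have yy : lsapp y (fun k => p k) y0 by [].
have [q qp ha] := lsapp_graph a yy.
have {}qp k : q k = p k by apply: elt_inj; exact: qp.
apply: (lsapp_eq (lsM_app (lsM_app ha yy) ha) ha) => k; rewrite qp /y0 /p.
have aek : a * (e0 + e k) = a * e k by rewrite mulrDr ae0 add0r.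
rewrite aek.
have -> : a * e k * (c k * star a) * (a * e k) = (star a * a * c k) * (e k * e k) * a by ring.
by rewrite Tce !ee mulrC.
Qed.

(** In the ring, x B = D. As B is injective it is not a zero divisor, so its quasi-inverse y is an
    inverse and x = D y. If D z D = D, then B z is a quasi-inverse of x: x (B z) x = D z D y = D y =
    x. *)
Lemma ls_regular x : exists y, x * y * x = x.
Proof.
have [aff _] := ls_in x.
have [B' [D' [[MB MD] _ _ xBD B0]]] := bounded_transform vnA aff.
have [B hB] := elt_exists MB; have [D hD] := elt_exists MD.
have [p [b [_ [_ [xb _ _]]]]] := lsapp_seq x x x.
have [q qp Bq] := lsapp_graph B xb; have [q' q'p Dq] := lsapp_graph D xb.
have qq' k : q' k = q k by apply: elt_inj; rewrite qp q'p.
have xB : x * lsgraph B = lsgraph D.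
  apply: (lsapp_eq (lsM_app xb Bq) Dq) => k.
  have [[_ pp _ _] _ _ _ _] := xb.
  have bB : b k * B = q k * D.
    apply: eltP => u; rewrite !eltME !bopME qp hB hD.
    by have := xBD u; rewrite (approxE _ _ xb) => ->.
  have qb : q k * q k = q k by apply: elt_inj; rewrite eltME qp; case: (pp k).
  have -> : b k * (B * q k) = (b k * B) * q k by ring.
  have -> : D * q' k = D * (q k * q k) by rewrite qb qq'.
  by rewrite bB; ring.
have Binj z : z * lsgraph B = 0 -> z = 0.
  move=> zB0; have [r [w [_ [_ [zw _ _]]]]] := lsapp_seq z z z.
  have [s sr Bs] := lsapp_graph B zw; have [s' _ zs] := lsapp_graph 0 zw.
  have h := lsM_app zw Bs; rewrite zB0 in h.
  apply: (lsapp_eq zw zs) => k; rewrite mul0r; apply: eltP => u; apply: B0.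
  have := lsapp_coef h zs k; rewrite mul0r => e.
  have sw := lsapp_proj zw sr k.
  have {}e : B * w k = 0 by rewrite -e -[in LHS]sw; ring.
  by rewrite -hB -bopME -eltME e.
have [y By] := lsgraph_regular B.
(* B y B = B gives (1 - B y) B = 0, and B can be cancelled by [Binj]. *)
have By1 : lsgraph B * y = 1.
  apply/eqP; rewrite eq_sym -subr_eq0; apply/eqP/Binj.
  by rewrite mulrBl mul1r By subrr.
have [z Dz] := lsgraph_regular D.
exists (lsgraph B * z).
have xE : x = lsgraph D * y by rewrite -xB -mulrA By1 mulr1.
by rewrite mulrA xB {1}xE mulrA Dz -xE.
Qed.

End LSRing.

(** * Automorphisms of matrices over a regular ring *)

Section RegularRing.
Variables (L : comPzRingType) (n : nat) (i0 : 'I_n).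

Lemma central_scalar_mx (a : 'M[L]_n) :
  (forall i j, a *m delta_mx i j = delta_mx i j *m a) -> a = (a i0 i0)%:M.
Proof.
move=> cd; apply/matrixP => i j; rewrite mxE.
have := congr1 (fun m : 'M[L]_n => m i i0) (cd j i0).
rewrite !mxE (bigD1 j)//= mxE !eqxx mulr1 big1 ?addr0; last first.
  by move=> k kj; rewrite mxE (negbTE kj) mulr0.
move=> ->; rewrite (bigD1 i0)//= mxE eqxx andbT big1 ?addr0; last first.
  by move=> k kj; rewrite mxE (negbTE kj) andbF mul0r.
by case: eqP => _; rewrite ?mul1r ?mul0r.
Qed.

Hypothesis regular : forall x : L, exists y, x * y * x = x.

(* The supports s_k = t_k t_k' are made disjoint one after the other; the part
   q of 1 which is left at the end kills every t_k, hence kills 1. *)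
Lemma regular_partition_nat m (t : nat -> L) : \sum_(k < m) t k = 1 ->
  exists a b : nat -> L, (forall k l, k != l -> a k * b l = 0) /\
    \sum_(k < m) a k * b k * t k = 1.
Proof.
move=> t1; have /choice[t' tt] : forall k, exists y, t k * y * t k = t k by move=> k; exact: regular.
pose s k := t k * t' k; pose q k := \prod_(j < k) (1 - s j).
have ss k : s k * s k = s k by rewrite /s mulrA tt.
have qS k : q k.+1 = q k * (1 - s k) by rewrite /q big_ord_recr.
have qq k : q k * q k = q k.
  elim: k => [|k IH]; first by rewrite /q big_ord0 mulr1.
  have -> : q k.+1 * q k.+1 = (q k * q k) * (1 - s k - s k + s k * s k) by rewrite qS; ring.
  by rewrite IH ss qS; ring.
have sq k l : (k < l)%N -> s k * q l = 0.
  elim: l => // l IH; rewrite ltnS leq_eqVlt => /orP[/eqP ->|/IH h].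
    have -> : s l * q l.+1 = q l * (s l - s l * s l) by rewrite qS; ring.
    by rewrite ss subrr mulr0.
  by rewrite qS mulrA h mul0r.
pose a k := q k * s k.
have aa k : a k * a k = a k.
  have -> : a k * a k = (q k * q k) * (s k * s k) by rewrite /a; ring.
  by rewrite qq ss.
have aS m' : \sum_(k < m') a k = 1 - q m'.
  elim: m' => [|k IH]; first by rewrite big_ord0 /q big_ord0 subrr.
  by rewrite big_ord_recr /= IH qS /a; ring.
have disj k l : (k < l)%N -> a k * a l = 0.
  move=> kl; have -> : a k * a l = q k * s l * (s k * q l) by rewrite /a; ring.
  by rewrite sq// mulr0.
have qm : q m = 0.
  rewrite -[LHS]mulr1 -t1 mulr_sumr big1// => k _.
  have -> : t k = t k * t' k * t k by rewrite tt.
  by have -> : q m * (t k * t' k * t k) = s k * q m * t k; [rewrite /s; ring|rewrite sq// mul0r].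
exists a, (fun k => a k * t' k); split.
  move=> k l; rewrite neq_ltn mulrA => /orP[kl|lk]; first by rewrite disj// mul0r.
  by rewrite (mulrC (a k)) disj// mul0r.
have := aS m; rewrite qm subr0 => <-; apply: eq_bigr => k _.
have -> : a k * (a k * t' k) * t k = (a k * a k) * s k by rewrite /s; ring.
by rewrite aa /a -mulrA ss.
Qed.

Lemma regular_partition m (t : 'I_m -> L) : \sum_k t k = 1 ->
  exists a b : 'I_m -> L, (forall k l, k != l -> a k * b l = 0) /\
    \sum_k a k * b k * t k = 1.
Proof.
(* The successive removal of supports runs over naturals, so t is extended by 0. *)
pose T (k : nat) : L := oapp t 0 (insub k).
have Tt (k : 'I_m) : T k = t k by rewrite /T valK.
move=> t1; have [|a [b [ab abT]]] := @regular_partition_nat m T.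
  by rewrite (eq_bigr t) // => k _; exact: Tt.
exists (fun k => a k), (fun k => b k); split; first by move=> k l kl; exact: ab.
by rewrite -[RHS]abT; apply: eq_bigr => k _; rewrite Tt.
Qed.

Lemma delta_mx_sum (X : 'M[L]_n) : X = \sum_i \sum_j (X i j)%:M *m delta_mx i j.
Proof.
rewrite [LHS]matrix_sum_delta; apply: eq_bigr => i _; apply: eq_bigr => j _.
by rewrite mul_scalar_mx.
Qed.

Lemma mul_delta_mx_delta (i j k l : 'I_n) : delta_mx i j *m (delta_mx k l : 'M[L]_n) =
  (if j == k then delta_mx i l else 0) :> 'M[L]_n.
Proof. by rewrite mul_delta_mx_cond; case: eqP. Qed.

Lemma sum_delta_mx : \sum_i delta_mx i i = 1%:M :> 'M[L]_n.
Proof.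
rewrite [RHS]delta_mx_sum; apply: eq_bigr => i _; rewrite (bigD1 i)//= big1 ?addr0.
  by rewrite mxE eqxx mul1mx.
by move=> j ji; rewrite mxE eq_sym (negbTE ji) mul_scalar_mx scale0r.
Qed.

Variables (Phi : 'M[L]_n -> 'M[L]_n).
Hypotheses (PhiD : forall X Y, Phi (X + Y) = Phi X + Phi Y)
  (PhiM : forall X Y, Phi (X *m Y) = Phi X *m Phi Y)
  (Phi_bij : bijective Phi).

Let Phi0 : Phi 0 = 0.
Proof. by apply: (addIr (Phi 0)); rewrite -PhiD addr0 add0r. Qed.

Let Phi_sum (I : Type) (r : seq I) (F : I -> 'M[L]_n) :
  Phi (\sum_(i <- r) F i) = \sum_(i <- r) Phi (F i).
Proof. by elim/big_rec2: _ => // i X Y _ <-; rewrite PhiD. Qed.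

Let Phi1 : Phi 1%:M = 1%:M.
Proof.
have [Phi' K' K] := Phi_bij.
by have := PhiM 1%:M (Phi' 1%:M); rewrite mul1mx K mulmx1.
Qed.

(** By surjectivity of Phi, the image of a central matrix commutes with all matrix units. *)
Let Phi_scalar a : Phi a%:M = ((Phi a%:M) i0 i0)%:M.
Proof.
have [Phi' K' K] := Phi_bij; apply: central_scalar_mx => i j.
by rewrite -[delta_mx i j]K -!PhiM scalar_mxC.
Qed.

Let psi (a : L) : L := (Phi a%:M) i0 i0.

Lemma scalar_mx_inj : injective (fun a : L => a%:M : 'M[L]_n).
Proof. by move=> a b /matrixP/(_ i0 i0); rewrite !mxE eqxx. Qed.

Let psi_bij : bijective psi.
Proof.
have [Phi' K' K] := Phi_bij.
have Phi'_scalar a : exists b, Phi' a%:M = b%:M.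
  exists ((Phi' a%:M) i0 i0); apply: central_scalar_mx => i j.
  by apply: (bij_inj Phi_bij); rewrite !PhiM K scalar_mxC.
exists (fun a => (Phi' a%:M) i0 i0) => a.
  have := Phi_scalar a; rewrite -/(psi a) => <-.
  by rewrite K' mxE eqxx.
have [b hb] := Phi'_scalar a.
by rewrite /psi [in (Phi' _)]hb [b%:M i0 i0]mxE eqxx -hb K mxE eqxx.
Qed.

Let psiD a b : psi (a + b) = psi a + psi b.
Proof. by rewrite /psi raddfD PhiD mxE. Qed.

Let psiM a b : psi (a * b) = psi a * psi b.
Proof.
apply: scalar_mx_inj; rewrite scalar_mxM -!Phi_scalar -PhiM -scalar_mxM.
by rewrite [RHS]Phi_scalar.
Qed.

Let PhiE i j : 'M[L]_n := Phi (delta_mx i j).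

Let PhiEM i j k l : PhiE i j *m PhiE k l = if j == k then PhiE i l else 0.
Proof. by rewrite /PhiE -PhiM mul_delta_mx_delta; case: eqP => // _; rewrite Phi0. Qed.

Let P : 'M[L]_n := PhiE i0 i0.

(** For the matrix unit e = [delta_mx i0 i0], the compression e X e is a scalar multiple of e; Phi
    carries this to P, and its surjectivity reaches every X. *)
Let corner X : exists s : L, P *m X *m P = s *: P.
Proof.
have [Phi' K' K] := Phi_bij; rewrite -[X]K.
rewrite /P /PhiE -!PhiM.
have [s ->] : exists s, delta_mx i0 i0 *m Phi' X *m delta_mx i0 i0 = s%:M *m delta_mx i0 i0.
  exists ((Phi' X) i0 i0); rewrite -{1 2}(mul_delta_mx (0 : 'I_1) i0 i0) !mulmxA.
  rewrite -(mulmxA (delta_mx i0 0)) -rowE -(mulmxA (delta_mx i0 0)) -colE.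
  rewrite [col _ _]mx11_scalar !mxE mul_mx_scalar -scalemxAl mul_delta_mx.
  by rewrite mul_scalar_mx.
by exists (psi s); rewrite PhiM Phi_scalar mul_scalar_mx.
Qed.

(** Surjectivity of psi writes a P as the image of a multiple b of the matrix unit, and injectivity
    of Phi gives b = 0. *)
Let faithful a : a *: P = 0 -> a = 0.
Proof.
have [psi' K' K] := psi_bij; rewrite -[a]K; set b := psi' a.
rewrite -mul_scalar_mx -Phi_scalar -PhiM mul_scalar_mx => h.
have : b *: delta_mx i0 i0 = 0 :> 'M[L]_n by apply: (bij_inj Phi_bij); rewrite h Phi0.
by move/matrixP/(_ i0 i0); rewrite !mxE !eqxx mulr1 => ->; rewrite /psi raddf0 Phi0 mxE.
Qed.

(** Nothing is known about the off-diagonal t_kl, so the column (a_k) and the row (b_l) satisfy a_k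
    b_l = 0 for k <> l: only the t_kk survive in P c r P, with weighted sum 1. *)
Lemma rank_one_factor : exists (c : 'cV[L]_n) (r : 'rV[L]_n), P *m c *m (r *m P) = P.
Proof.
have PP : P *m P = P by rewrite PhiEM eqxx.
have /choice[t ht] : forall kl : 'I_n * 'I_n, exists s, P *m delta_mx kl.1 kl.2 *m P = s *: P.
  by move=> kl; exact: corner.
(* Summing P e_kk P over k gives P P = P, and a scalar is determined by its multiple of P. *)
have t1 : \sum_k t (k, k) = 1.
  apply/eqP; rewrite eq_sym -subr_eq0; apply/eqP/faithful.
  rewrite scalerBl scale1r scaler_suml.
  under eq_bigr do rewrite -ht /=.
  by rewrite -mulmx_suml -mulmx_sumr sum_delta_mx mulmx1 PP subrr.
have [a [b [ab abt]]] := regular_partition t1.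
exists (\col_k a k), (\row_k b k); rewrite mulmxA -(mulmxA P).
have -> : (\col_k a k) *m (\row_k b k) = \sum_k (a k * b k) *: delta_mx k k.
  apply/matrixP => i j; rewrite !mxE big_ord1 !mxE summxE.
  have [<-|ij] := eqVneq i j.
    rewrite (bigD1 i)//= !mxE eqxx mulr1 big1 ?addr0// => k ki.
    by rewrite !mxE eq_sym (negbTE ki) mulr0.
  rewrite ab// big1// => k _; rewrite !mxE.
  by case: eqP => [<-|]; rewrite ?mulr0//= eq_sym (negbTE ij) mulr0.
rewrite mulmx_sumr mulmx_suml.
under eq_bigr do rewrite -scalemxAr -scalemxAl (ht (_, _)) scalerA.
by rewrite -scaler_suml abt scale1r.
Qed.

Theorem matrix_automorphism : exists (psi : L -> L) (Y Z : 'M[L]_n),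
  [/\ bijective psi, forall a b, psi (a + b) = psi a + psi b,
      forall a b, psi (a * b) = psi a * psi b, Y *m Z = 1%:M /\ Z *m Y = 1%:M
    & forall X, Phi X = Y *m map_mx psi X *m Z].
Proof.
have [c [r crP]] := rank_one_factor.
(* Column i of Y is Phi(e_{i i0}) c, which makes Y intertwine the two systems of matrix units:
   Phi(e_ij) Y = Y e_ij. *)
pose Y : 'M[L]_n := \sum_i PhiE i i0 *m c *m delta_mx (0 : 'I_1) i.
pose Z : 'M[L]_n := \sum_j delta_mx j (0 : 'I_1) *m (r *m PhiE i0 j).
have Ydelta i (k : 'I_1) : Y *m delta_mx i k = PhiE i i0 *m c *m delta_mx 0 k.
  rewrite mulmx_suml (bigD1 i)//= -mulmxA mul_delta_mx big1 ?addr0// => j ji.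
  by rewrite -mulmxA mul_delta_mx_cond (negbTE ji) mulr0n mulmx0.
have YdeltaM i j : Y *m delta_mx i j = PhiE i i0 *m c *m delta_mx 0 j.
  by rewrite -(mul_delta_mx (0 : 'I_1)) mulmxA Ydelta -mulmxA mul_delta_mx.
have PhiY i j : PhiE i j *m Y = Y *m delta_mx i j.
  rewrite YdeltaM mulmx_sumr (bigD1 j)//= !mulmxA PhiEM eqxx big1 ?addr0// => k kj.
  by rewrite !mulmxA PhiEM eq_sym (negbTE kj) !mul0mx.
(* The product is the sum over i of Phi(e_{i i0}) (P c r P) Phi(e_{i0 i}) = Phi(e_ii), that is
   Phi(1) = 1. *)
have YZ : Y *m Z = 1%:M.
  rewrite mulmx_sumr -Phi1 -sum_delta_mx Phi_sum; apply: eq_bigr => i _.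
  rewrite mulmxA Ydelta (_ : delta_mx 0 0 = 1%:M) ?mulmx1; last first.
    by apply/matrixP => k l; rewrite !ord1 !mxE.
  have l i' : PhiE i' i0 = PhiE i' i0 *m P by rewrite PhiEM eqxx.
  have r' i' : PhiE i0 i' = P *m PhiE i0 i' by rewrite PhiEM eqxx.
  rewrite [in LHS]l [in LHS]r'.
  have -> : PhiE i i0 *m P *m c *m (r *m (P *m PhiE i0 i)) =
      PhiE i i0 *m (P *m c *m (r *m P)) *m PhiE i0 i by rewrite !mulmxA.
  by rewrite crP -l PhiEM eqxx.
(* Over a commutative ring a one-sided inverse of a square matrix is two-sided, hence [mulmx1C]. *)
clearbody Y Z; exists psi, Y, Z; split=> //; first by split=> //; exact: mulmx1C.
move=> X; rewrite {1}(delta_mx_sum X) Phi_sum (delta_mx_sum (map_mx psi X)).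
rewrite mulmx_sumr mulmx_suml; apply: eq_bigr => i _.
rewrite Phi_sum mulmx_sumr mulmx_suml; apply: eq_bigr => j _.
have e : Y *m ((psi (X i j))%:M *m delta_mx i j) = (psi (X i j))%:M *m (PhiE i j *m Y).
  by rewrite PhiY !mulmxA scalar_mxC.
by rewrite PhiM Phi_scalar -/(psi _) mxE e -!mulmxA YZ mulmx1.
Qed.

End RegularRing.

(** * Matrices of locally measurable operators *)

Section MatricesOverLS.
Variables (R : realType) (H : hilbertType R) (n : nat) (A : cvn H).
Local Notation MA := (cvn_set A).
Local Notation K := (hilbert_pow H n).
Local Notation Mn := (matrix_algebra n MA).
Let vnA := cvnP A.
Let vnM : von_neumann_algebra Mn := matrix_algebra_vn n A.
Implicit Types (X Y : 'M[ls A]_n) (p q : nat -> elt A).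

Definition toop X : operator K := operator_of_mx (map_mx (@ls_op R H A) X).

Definition mxapp X p (b : nat -> 'M[elt A]_n) := forall i j, lsapp (X i j) (fun k => elt_bop (p k)) (fun k => b k i j).

(** A matrix has finitely many entries, so the product of their central sequences serves all of them
    at once. *)
Lemma lsapp_seq_mem (s : seq (ls A)) : exists p, central_seq MA (fun k => elt_bop (p k)) /\
  forall x, x \in s -> exists b, lsapp x (fun k => elt_bop (p k)) b.
Proof.
elim: s => [|x s [p [cp ps]]].
  by exists (fun=> 1); split=> //; exact: (central_seq1 vnA).
have [q' [b [_ [_ [xb _ _]]]]] := lsapp_seq x x x.
have [cq _ _ _ _] := xb.
have [q hq] : exists q : nat -> elt A, (fun k => elt_bop (q k)) = q'.
  have /choice[q hq] : forall k, exists c : elt A, elt_bop c = q' k.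
    by move=> k; apply: elt_exists; have [qM _ _ _] := cq; case: (qM k).
  by exists q; exact/funext.
rewrite -hq in xb cq.
have pqE : (fun k => elt_bop (p k * q k)) = (fun k => elt_bop (p k) * elt_bop (q k)) by [].
exists (fun k => p k * q k); split; first by rewrite pqE; exact: (central_seqM vnA).
move=> y; rewrite inE => /orP[/eqP ->|/ps[c yc]].
  exists (fun k => b k * p k); have := approx_refine vnA xb cp.
  rewrite /lsapp; congr (bdd_approx _ _ _ _).
  by apply/funext => k; rewrite -!eltME mulrC.
by exists (fun k => c k * q k); have := approx_refine vnA yc cq.
Qed.

Lemma mxapp_exists X Y : exists p b c, central_seq MA (fun k => elt_bop (p k)) /\
  (mxapp X p b /\ mxapp Y p c).
Proof.
have [p [cp ps]] := lsapp_seq_mem ([seq X ij.1 ij.2 | ij : 'I_n * 'I_n] ++ [seq Y ij.1 ij.2 | ij : 'I_n * 'I_n]).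
have /choice[b hb] : forall ij : 'I_n * 'I_n, exists b, lsapp (X ij.1 ij.2) (fun k => elt_bop (p k)) b.
  by move=> ij; apply: ps; rewrite mem_cat; apply/orP; left; apply/mapP; exists ij; rewrite ?mem_enum.
have /choice[c hc] : forall ij : 'I_n * 'I_n, exists b, lsapp (Y ij.1 ij.2) (fun k => elt_bop (p k)) b.
  by move=> ij; apply: ps; rewrite mem_cat; apply/orP; right; apply/mapP; exists ij; rewrite ?mem_enum.
exists p, (fun k => \matrix_(i, j) b (i, j) k), (fun k => \matrix_(i, j) c (i, j) k); split=> //.
split=> i j; [have := hb (i, j)|have := hc (i, j)]; rewrite /lsapp; congr (bdd_approx _ _ _ _);
  by apply/funext => k; rewrite mxE.
Qed.

Hypothesis n_gt0 : (0 < n)%N.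

(** Cutting by scalar projections leaves bounded matrices, and [approx_closure] identifies the
    closure in [operator_of_mx] with the operator glued from them. *)
Lemma toop_approx X p b : central_seq MA (fun k => elt_bop (p k)) -> mxapp X p b ->
  bdd_approx Mn (toop X) (fun k => mxop (p k)%:M) (fun k => mxop (b k)).
Proof.
move=> cp Xb; have cP := central_seq_diag n cp.
have bp k i j : b k i j * p k = b k i j.
  by have [_ _ h _ _] := Xb i j; apply: elt_inj; rewrite eltME h.
have pb l k i j : (l <= k)%N -> p l * b k i j = b l i j.
  by have [_ _ _ h _] := Xb i j => lk; apply: elt_inj; rewrite eltME h.
have ag : bdd_approx Mn (glue_op (fun k => mxop (p k)%:M) (fun k => mxop (b k)))
    (fun k => mxop (p k)%:M) (fun k => mxop (b k)).
  apply: glue_approx => //.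
  - by move=> k; exact: mxop_mem.
  - move=> k; rewrite -mxopM mul_mx_scalar; congr mxop; apply/matrixP => i j.
    by rewrite mxE mulrC bp.
  - move=> l k lk; rewrite -mxopM mul_scalar_mx; congr mxop; apply/matrixP => i j.
    by rewrite mxE pb.
rewrite /toop /operator_of_mx (approx_closure ag)//.
- move=> u v [V [XV vV]] k; apply: hcoordP => i /=.
  rewrite -[LHS]/(hcoord (mxop (p k)%:M v) i) -[RHS]/(hcoord (mxop (b k) u) i).
  rewrite mxop_scalar diagopE vV bop_sum mxopE; apply: eq_bigr => j _.
  by have := XV i j; rewrite mxE (approxE _ _ (Xb i j)) => ->.
- move=> k u; exists (\matrix_(i, j) b k i j (hcoord u j)); split=> [i j|i].
    have e : hcoord (mxop (p k)%:M u) j = p k (hcoord u j) by rewrite mxop_scalar diagopE.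
    by have := approx_mem (Xb i j) k (hcoord u j); rewrite -e !mxE.
  by apply: etrans (mxopE _ _ _) _; apply: eq_bigr => j _; rewrite mxE.
Qed.

Lemma toop_LS X : LS Mn (toop X).
Proof.
have [p [b [_ [cp [Xb _]]]]] := mxapp_exists X X.
exact (approx_LS vnM (toop_approx cp Xb)).
Qed.

Lemma toop_inj : injective toop.
Proof.
move=> X Y XY; have [p [b [c [cp [Xb Yc]]]]] := mxapp_exists X Y.
have h1 := toop_approx cp Xb; have h2 := toop_approx cp Yc; rewrite XY in h1.
apply/matrixP => i j; apply: (lsapp_eq (Xb i j) (Yc i j)) => k.
by have /(congr1 (fun f => f k))/mxop_inj -> := approx_coef h1 h2.
Qed.

(** Central projections of the matrix algebra are scalar, so compatibility of the bounded matrices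
    along them holds entry by entry, and each entry glues to an element of [ls A]. *)
Lemma toop_surj x : LS Mn x -> exists X, toop X = x.
Proof.
move=> /(LS_approx vnM (@matrix_central_minorants R H n A))[P [B xB]].
have [cP MB BP PB xE] := xB.
have [p [cp Pp]] := central_seq_diagE n_gt0 cP.
have /choice[b hb] : forall k, exists b : 'M[elt A]_n, B k = mxop b.
  by move=> k; have [a aE] := mxopP (MB k); exists a; apply: bopP => u; rewrite aE.
have gX i j : bdd_approx MA (glue_op (fun k => elt_bop (p k)) (fun k => elt_bop (b k i j)))
    (fun k => elt_bop (p k)) (fun k => elt_bop (b k i j)).
  apply: glue_approx => //.
  - by move=> k; exact: elt_mem.
  - move=> k; rewrite -eltME; congr elt_bop.
    have := BP k; rewrite hb Pp -mxopM mul_mx_scalar => /mxop_inj/matrixP/(_ i j).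
    by rewrite mxE mulrC.
  - move=> l k lk; rewrite -eltME; congr elt_bop.
    have := PB l k lk; rewrite !hb Pp -mxopM mul_scalar_mx => /mxop_inj/matrixP/(_ i j).
    by rewrite mxE.
exists (\matrix_(i, j) Ls (approx_LS vnA (gX i j))).
have [|_ _ _ _ ->] := @toop_approx (\matrix_(i, j) Ls (approx_LS vnA (gX i j))) p b cp.
  by move=> i j; rewrite mxE; exact: gX.
rewrite xE Pp; congr glue_op; by apply/funext => k; rewrite hb.
Qed.

Lemma approx_same (M : set (K -> K)) x y P B C : bdd_approx M x P B -> bdd_approx M y P C ->
  B = C -> x = y.
Proof. by move=> [_ _ _ _ ->] [_ _ _ _ ->] ->. Qed.

Lemma toopD X Y : toop (X + Y) = ls_add (toop X) (toop Y).
Proof.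
have [p [b [c [cp [Xb Yc]]]]] := mxapp_exists X Y.
have XYbc : mxapp (X + Y) p (fun k => b k + c k).
  move=> i j; rewrite mxE; have := lsapp_add (Xb i j) (Yc i j); rewrite /lsapp.
  by congr (bdd_approx _ _ _ _); apply/funext => k; rewrite mxE.
apply: (approx_same (toop_approx cp XYbc) (approx_add vnM (toop_approx cp Xb) (toop_approx cp Yc))).
by apply/funext => k; rewrite mxopD.
Qed.

Lemma lsapp_sum (I : Type) (r : seq I) (F : I -> ls A) (p : nat -> bop H) (f : nat -> I -> elt A) :
  central_seq MA p -> (forall i, lsapp (F i) p (f^~ i)) ->
  lsapp (\sum_(i <- r) F i) p (fun k => \sum_(i <- r) f k i).
Proof.
move=> cp h; elim: r => [|i r IH].
  rewrite big_nil; have := approx_graph vnA cp (elt_mem (0 : elt A)); rewrite /lsapp.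
  congr (bdd_approx _ _ _ _); apply/funext => k.
  by rewrite big_nil elt0E mul0r.
rewrite big_cons; have := lsapp_add (h i) IH; rewrite /lsapp; congr (bdd_approx _ _ _ _).
by apply/funext => k; rewrite big_cons.
Qed.

Lemma toopM X Y : toop (X *m Y) = ls_mul (toop X) (toop Y).
Proof.
have [p [b [c [cp [Xb Yc]]]]] := mxapp_exists X Y.
have XYbc : mxapp (X *m Y) p (fun k => b k *m c k).
  move=> i j; rewrite mxE.
  have := @lsapp_sum _ (index_enum 'I_n) (fun l => X i l * Y l j) _ (fun k l => b k i l * c k l j) cp.
  move=> /(_ (fun l => lsM_app (Xb i l) (Yc l j))); rewrite /lsapp.
  by congr (bdd_approx _ _ _ _); apply/funext => k; rewrite mxE.
apply: (approx_same (toop_approx cp XYbc) (approx_mul vnM (toop_approx cp Xb) (toop_approx cp Yc))).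
by apply/funext => k; rewrite mxopM.
Qed.

Lemma toop1 : toop 1%:M = @ls_one R K.
Proof.
have cp := central_seq1 vnA.
have app1 : mxapp 1%:M (fun=> 1) (fun=> 1%:M).
  move=> i j; rewrite !mxE; case: (i == j); rewrite /= ?mulr1n ?mulr0n.
    have := approx_graph vnA cp (elt_mem (1 : elt A)); rewrite /lsapp.
    by congr (bdd_approx _ _ _ _); apply/funext => k; rewrite mulr1.
  have := approx_graph vnA cp (elt_mem (0 : elt A)); rewrite /lsapp.
  by congr (bdd_approx _ _ _ _); apply/funext => k; rewrite mulr1.
have h := toop_approx (p := fun=> 1) cp app1.
have [cP _ _ _ _] := h.
have := approx_graph vnM cP (vn1 vnM) => h1.
apply: (approx_same h h1).
by apply/funext => k; rewrite mul1r.
Qed.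

End MatricesOverLS.

(** Stated for an arbitrary embedding [io] because it serves twice: for [ls] with its own product,
    and for matrices with [mulmx]. *)
Lemma ring_automorphism_transport (R : realType) (V : hilbertType R) (M : set (V -> V))
    (T : Type) (add mul : T -> T -> T) (io : T -> operator V) (f : T -> T)
    (F : operator V -> operator V) :
  (forall t, LS M (io t)) -> (forall x, LS M x -> exists t, io t = x) -> injective io ->
  (forall s t, io (add s t) = ls_add (io s) (io t)) ->
  (forall s t, io (mul s t) = ls_mul (io s) (io t)) ->
  bijective f -> (forall s t, f (add s t) = add (f s) (f t)) ->
  (forall s t, f (mul s t) = mul (f s) (f t)) -> (forall t, F (io t) = io (f t)) ->
  ring_automorphism M F.
Proof.
move=> ioLS ioS ioI ioD ioM [g fg gf] fD fM Fio; split.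
- split.
  + by move=> _ /ioS[t <-]; rewrite Fio; exact: ioLS.
  + move=> x y /set_mem/ioS[s <-] /set_mem/ioS[t <-].
    by rewrite !Fio => /ioI/(can_inj fg) ->.
  + by move=> _ /ioS[t <-]; exists (io (g t)); [exact: ioLS|rewrite Fio gf].
- by move=> _ _ /ioS[s <-] /ioS[t <-]; rewrite -ioD !Fio fD ioD.
- by move=> _ _ /ioS[s <-] /ioS[t <-]; rewrite -ioM !Fio fM ioM.
Qed.

Lemma transport_exists (R : realType) (V : hilbertType R) (T : Type) (io : T -> operator V)
  (f : T -> T) : injective io -> exists F : operator V -> operator V, forall t, F (io t) = io (f t).
Proof.
move=> ioI; have /choice[F hF] : forall x, exists y, forall t, io t = x -> io (f t) = y.
  move=> x; have [[t <-]|nx] := pselect (exists t, io t = x).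
    by exists (io (f t)) => s /ioI ->.
  (* Off the image of [io] an arbitrary value is allowed; x itself is taken. *)
  by exists x => t tx; case: nx; exists t.
by exists F => t; rewrite -(hF (io t) t).
Qed.

Theorem proposition4p2 (R : realType) (H : hilbertType R) (n : nat)
    (A : set (H -> H)) (Psi : operator (hilbert_pow H n) ->
                              operator (hilbert_pow H n)) :
  (1 <= n)%N ->
  von_neumann_algebra A ->
  commutative_algebra A ->
  ring_automorphism (matrix_algebra n A) Psi ->
  exists (psi : operator H -> operator H)
         (psi' : operator (hilbert_pow H n) -> operator (hilbert_pow H n))
         (y yinv : operator (hilbert_pow H n)),
    [/\ ring_automorphism A psi,
        ring_automorphism (matrix_algebra n A) psi',
        entrywise A psi psi',
        ls_inverse (matrix_algebra n A) y yinv
      & forall x, LS (matrix_algebra n A) x ->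
          Psi x = ls_mul (ls_mul y (psi' x)) yinv].
Proof.
move=> n_gt0 vnA cA [[PsiLS PsiI PsiS] PsiD PsiM].
pose A' := Cvn vnA cA.
pose to : 'M[ls A']_n -> operator (hilbert_pow H n) := @toop R H n A'.
have toLS X : LS (matrix_algebra n A) (to X) := toop_LS X.
have toS x : LS (matrix_algebra n A) x -> exists X, to X = x by move=> /(@toop_surj R H n A' n_gt0).
have toI : injective to := @toop_inj R H n A'.
have toD X Y : to (X + Y) = ls_add (to X) (to Y) := toopD X Y.
have toM X Y : to (X *m Y) = ls_mul (to X) (to Y) := toopM X Y.
(* Psi is carried to matrices over the commutative regular ring [ls A'], where [matrix_automorphism]
   applies. *)
have /choice[Phi toPhi] : forall X, exists Y, to Y = Psi (to X).
  by move=> X; apply: toS; exact: PsiLS.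
have PhiD X Y : Phi (X + Y) = Phi X + Phi Y.
  by apply: toI; rewrite toPhi !toD PsiD// !toPhi.
have PhiM X Y : Phi (X *m Y) = Phi X *m Phi Y.
  by apply: toI; rewrite toPhi !toM PsiM// !toPhi.
have Phi_bij : bijective Phi.
  have /choice[Phi' hPhi'] : forall Y, exists X, Phi X = Y.
    move=> Y; have [_ /toS[X <-] XY] := PsiS _ (toLS Y).
    by exists X; apply: toI; rewrite toPhi.
  exists Phi' => // X; apply: toI; apply: PsiI; rewrite ?inE//.
  by rewrite -!toPhi hPhi'.
have [psi [Y [Z [psi_bij psiD psi_M [YZ ZY] PhiE]]]] :=
  matrix_automorphism (Ordinal n_gt0) (@ls_regular R H A') PhiD PhiM Phi_bij.
have ls_opI : injective (@ls_op R H A') by move=> x y; exact: ls_inj.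
have [psiO psiOE] := transport_exists psi ls_opI.
have [psiO' psiOE'] := transport_exists (map_mx psi) toI.
exists psiO, psiO', (to Y), (to Z); split.
- apply: (@ring_automorphism_transport R H A (ls A') +%R *%R (@ls_op R H A') psi) => //.
  + by move=> t; exact: ls_in.
  + by move=> x hx; exists (Ls (A := A') hx).
- apply: (@ring_automorphism_transport R _ _ 'M[ls A']_n +%R (@mulmx _ n n n) to (map_mx psi)) => //.
  + have [psi' K K'] := psi_bij.
    by exists (map_mx psi') => X; apply/matrixP => i j; rewrite !mxE ?K ?K'.
  + by move=> X X'; apply/matrixP => i j; rewrite !mxE psiD.
  (* Additivity forces psi 0 = 0, which is required to move psi through the finite sums of a matrix
     product. *)
  + have psi0 : psi 0 = 0 by apply: (addIr (psi 0)); rewrite -psiD !add0r.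
    move=> X X'; apply/matrixP => i j; rewrite !mxE.
    rewrite (big_morph psi psiD psi0); apply: eq_bigr => k _.
    by rewrite psi_M !mxE.
- split=> [x /toS[X <-]|X LX].
    by exists (map_mx (@ls_op R H A') X) => // i j; rewrite mxE; exact: ls_in.
  have -> : X = map_mx (@ls_op R H A') (\matrix_(i, j) Ls (A := A') (LX i j)).
    by apply/matrixP => i j; rewrite !mxE.
  rewrite -[operator_of_mx (map_mx (@ls_op R H A') _)]/(to _) psiOE' /to /toop; congr operator_of_mx.
  by apply/matrixP => i j; rewrite !mxE psiOE.
- by split; rewrite ?toLS// -toM ?YZ ?ZY; exact: toop1.
- by move=> _ /toS[X <-]; rewrite psiOE' -toPhi PhiE -!toM.
Qed.
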